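(* Let $\alpha\in\bar{\mathbb{Q}}\setminus\{0,1\}$ be such that all conjugates of $\alpha$ over $\mathbb{Q}$ are in $Z^\times$. Then $T(\alpha)\cap\boldsymbol{\mu}$ has at most two elements different from $\alpha$, and the set $T(\alpha)\cap\boldsymbol{\mu}$ can be effectively determined. If $\alpha\in\boldsymbol{\mu}\setminus\{1\}$, then \[ \{\alpha,\alpha^2\}\subseteq T(\alpha)\cap\boldsymbol{\mu}\subseteq\{\alpha,\alpha^2,-\alpha^2\}, \] except when $\alpha=-1$, where $T(-1)\cap\boldsymbol{\mu}=\{-1\}$.
   Context: For $\lambda \in \mathbb{C}\setminus\{0,1\}$ let $E_\lambda \colon y^2 = x(x-1)(x-\lambda)$. For $\alpha \in \mathbb{C}\setminus\{0,1\}$ let $P_\alpha(\lambda)$ be a point on $E_\lambda$ with $x$-coordinate $\alpha$ (well defined up to sign), and set $T(\alpha) = \{\lambda \in \mathbb{C}\setminus\{0,1\} : P_\alpha(\lambda) \text{ is a torsion point of } E_\lambda\}$. $\boldsymbol{\mu}=\exp(2\pi i\mathbb{Q})\subseteq\mathbb{C}$ is the set of all roots of unity. $\bar{\mathbb{Q}}\subseteq\mathbb{C}$ is the algebraic closure of $\mathbb{Q}$; fix an embedding $\bar{\mathbb{Q}}\hookrightarrow\bar{\mathbb{Q}}_2$ and let $Z\subseteq\bar{\mathbb{Q}}$ be the subring of elements whose image in $\bar{\mathbb{Q}}_2$ is integral, with unit group $Z^\times$. ''Effectively determined'' means that there is an algorithm computing the set from $\alpha$. *)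

(* Defs.v *)
From HB Require Import structures.
From mathcomp Require Import all_boot all_order all_algebra.
From mathcomp Require Import complex.
From mathcomp Require Import boolp classical_sets functions cardinality reals.

Set Implicit Arguments.
Unset Strict Implicit.
Unset Printing Implicit Defensive.
Import Order.TTheory GRing.Theory Num.Theory.
Local Open Scope ring_scope.
Local Open Scope complex_scope.
Local Open Scope classical_set_scope.

(** * The Legendre family and torsion *)

Section Legendre.
Variables (F : fieldType) (lam : F).

(* [None] is the point at infinity, the neutral element of the group law. *)
Definition point : Type := option (F * F).

Definition on_legendre (P : point) : bool :=
  if P is Some (x, y) then y ^+ 2 == x * (x - 1) * (x - lam) else true.

(* Chord-tangent law for y^2 = x^3 - (1 + lam) x^2 + lam x; meaningful for
   points of the curve. *)
Definition legendre_add (P Q : point) : point :=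
  match P, Q with
  | None, _ => Q
  | _, None => P
  | Some (x1, y1), Some (x2, y2) =>
      if (x1 == x2) && (y1 == - y2) then None else
      let s := if x1 == x2
               then (3 * x1 ^+ 2 - 2 * (1 + lam) * x1 + lam) / (2 * y1)
               else (y2 - y1) / (x2 - x1) in
      let x3 := s ^+ 2 + (1 + lam) - x1 - x2 in
      Some (x3, s * (x1 - x3) - y1)
  end.

Definition legendre_mul (n : nat) (P : point) : point :=
  iter n (legendre_add P) None.

Definition legendre_torsion (P : point) : Prop :=
  on_legendre P /\ exists2 n, (0 < n)%N & legendre_mul n P = None.

End Legendre.

(* The ordinate y of a point with abscissa a is only determined up to sign, and
   the choice of sign does not affect being torsion. *)
Definition T (R : realType) (a : R[i]) : set R[i] :=
  [set lam | [/\ lam <> 0, lam <> 1 &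
     exists y : R[i], legendre_torsion lam (Some (a, y))]].

Definition roots_of_unity (R : realType) : set R[i] :=
  [set z | exists2 n, (0 < n)%N & n.-unity_root z].
Arguments roots_of_unity R : clear implicits.

(** * The field of algebraic numbers, as a subfield of the complex numbers *)

Definition algebraic (R : realType) : {pred R[i]} :=
  fun z => `[< algebraicOver (ratr : rat -> R[i]) z >].

Lemma algebraic_divring_closed (R : realType) : divring_closed (@algebraic R).
Proof.
split=> [|x y /asboolP xA /asboolP yA|x y /asboolP xA /asboolP yA].
- exact/asboolP/algebraic1.
- exact/asboolP/algebraic_sub.
- exact/asboolP/algebraic_div.
Qed.

HB.instance Definition _ (R : realType) :=
  GRing.isDivringClosed.Build R[i] (@algebraic R) (@algebraic_divring_closed R).

Record Qbar (R : realType) :=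
  MkQbar { qbar_val :> R[i]; _ : qbar_val \in @algebraic R }.

HB.instance Definition _ (R : realType) := [isSub for @qbar_val R].
HB.instance Definition _ (R : realType) := [Choice of Qbar R by <:].
HB.instance Definition _ (R : realType) :=
  [SubChoice_isSubIntegralDomain of Qbar R by <:].
HB.instance Definition _ (R : realType) :=
  [SubIntegralDomain_isSubField of Qbar R by <:].

Definition conjugate (R : realType) (a b : Qbar R) : Prop :=
  exists P : {poly rat}, [/\ irreducible_poly P,
    root (map_poly ratr P) a & root (map_poly ratr P) b].

(** * p-adic integrality *)

Definition padic_abs (R : realType) (p : nat) (q : rat) : R :=
  if q == 0 then 0
  else p%:R ^ ((logn p `|denq q|)%:Z - (logn p `|numq q|)%:Z).

(* F with absolute value N is the completion of the rationals for the p-adic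
   absolute value, i.e. the field of p-adic numbers, which is unique up to a
   unique isometric isomorphism. *)
Record is_padic_field (R : realType) (p : nat) (F : fieldType) (N : F -> R) :
    Prop := IsPadicField {
  padicN_ge0 : forall x, 0 <= N x;
  padicN_eq0 : forall x, N x = 0 <-> x = 0;
  padicNM : forall x y, N (x * y) = N x * N y;
  padicND : forall x y, N (x + y) <= Num.max (N x) (N y);
  padicN_rat : forall q : rat, N (ratr q) = padic_abs R p q;
  padic_dense : forall (x : F) (e : R), 0 < e ->
    exists q : rat, N (x - ratr q) < e;
  padic_complete : forall u : nat -> F,
    (forall e : R, 0 < e -> exists n0, forall m n, (n0 <= m)%N -> (n0 <= n)%N ->
       N (u m - u n) < e) ->
    exists l : F, forall e : R, 0 < e -> exists n0, forall n, (n0 <= n)%N ->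
       N (u n - l) < e
}.

(* u is integral over the ring {x : F | N x <= 1} of p-adic integers. *)
Definition padic_integral (R : realType) (F : fieldType) (N : F -> R)
    (K : fieldType) (j : F -> K) (u : K) : Prop :=
  exists P : {poly F},
    [/\ P \is monic, forall i, N P`_i <= 1 & root (map_poly j P) u].

Section Zring.
Variables (R : realType) (F : fieldType) (N : F -> R) (K : fieldType).
Variables (j : F -> K) (iota : Qbar R -> K).

Definition Zring : set (Qbar R) := [set x | padic_integral N j (iota x)].

Definition Zunits : set (Qbar R) :=
  [set x | Zring x /\ exists2 y, Zring y & x * y = 1].

Definition conjugates_in_Zunits (a : Qbar R) : Prop :=
  forall b, conjugate a b -> Zunits b.

End Zring.

(** * Algorithms: partial recursive functions *)

Inductive recfun : Type :=
  | RZero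
  | RSucc
  | RProj of nat
  | RComp of recfun & seq recfun
  | RPrec of recfun & recfun
  | RMin of recfun.

(* [computes f v y]: on input v, f halts with output y.  In [RPrec] and [RMin]
   the recursion/search variable is the first argument. *)
Inductive computes : recfun -> seq nat -> nat -> Prop :=
  | computes_zero v : computes RZero v 0
  | computes_succ x v : computes RSucc (x :: v) x.+1
  | computes_proj i v : (i < size v)%N -> computes (RProj i) v (nth 0%N v i)
  | computes_comp f gs v w y :
      computes_all gs v w -> computes f w y -> computes (RComp f gs) v y
  | computes_prec0 f g v y :
      computes f v y -> computes (RPrec f g) (0%N :: v) y
  | computes_precS f g n v r y :
      computes (RPrec f g) (n :: v) r -> computes g (n :: r :: v) y ->
      computes (RPrec f g) (n.+1 :: v) y
  | computes_min f v n (h : nat -> nat) :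
      (forall m, (m < n)%N -> computes f (m :: v) (h m).+1) ->
      computes f (n :: v) 0 -> computes (RMin f) v n
with computes_all : seq recfun -> seq nat -> seq nat -> Prop :=
  | computes_nil v : computes_all [::] v [::]
  | computes_cons f fs v y ys :
      computes f v y -> computes_all fs v ys ->
      computes_all (f :: fs) v (y :: ys).

(** * Encoding of algebraic numbers and finite sets *)

Definition int_decode (n : nat) : int :=
  if odd n then - (n./2.+1)%:Z else (n./2)%:Z.

Definition poly_decode (R : realType) (c : nat) : {poly R[i]} :=
  Poly [seq (int_decode m)%:~R | m <- CodeSeq.decode c].

(* c encodes a nonzero integer polynomial p and a rational disc with centre
   (x + y i) / (d + 1) and radius 1 / (d + 1) in which z is the only root of p.
   Every algebraic number has such codes. *)
Definition codes_number (R : realType) (c : nat) (z : R[i]) : Prop :=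
  exists p x y d : nat,
    [/\ c = CodeSeq.code [:: p; x; y; d],
        poly_decode R p != 0 &
        let ctr : R[i] := ((int_decode x)%:~R / d.+1%:R) +i*
                          ((int_decode y)%:~R / d.+1%:R) in
        forall w : R[i],
          root (poly_decode R p) w /\ `|w - ctr| < d.+1%:R^-1 <-> w = z].

(* c encodes a list of codes enumerating S without repetition. *)
Definition codes_set (R : realType) (c : nat) (S : set R[i]) : Prop :=
  exists s : seq R[i],
    [/\ uniq s, S = [set` s], size s = size (CodeSeq.decode c) &
        forall i, (i < size s)%N ->
          codes_number (nth 0%N (CodeSeq.decode c) i) (nth 0 s i)].

(* Main.v *)
(** Fix a valuation ring of C in which 2 is not invertible (Chevalley), and let lam
    be a root of unity. Duplication on E_lam strictly increases the absolute value
    of an abscissa x with |x| > 1, so abscissae of torsion points are integral.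
    Applied to the double of a point with abscissa a, this gives lam = a or
    |lam - a^2| <= |2|. As 1 is the only root of unity congruent to 1 modulo 4, and
    1, -1 are the only ones congruent to 1 modulo 2, at most two values lam <> a
    remain, which differ by a sign, and lam is in {a, a^2, -a^2} if a is a root of
    unity.

    A point is torsion if and only if its abscissa is preperiodic under duplication;
    of the associativity of the group law this only uses (P + P) + Q = P + (P + Q)
    and -P + (P + Q) = Q. Duplication contracts distances by an exact factor, so two
    points of a preperiodic orbit that are congruent modulo 32 are equal. Integral
    elements of a d-dimensional rational space fill at most m^d classes modulo m,
    which bounds the length of the orbit and, since lam^(2k) = a^(4k) modulo 4, the
    order of lam. Hence T(a) meets the roots of unity in the N-th roots of unity
    lam <> 1 at which one of finitely many explicit integral polynomials in (a, lam)
    vanishes. A Liouville inequality decides this from approximations of a and lam,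
    which the algorithm finds by unbounded search. *)

Require Import Defs.
From mathcomp Require Import all_boot all_order all_algebra.
From mathcomp Require Import complex separable cyclotomic.
From mathcomp Require Import boolp classical_sets functions cardinality reals.
From mathcomp Require Import ring lra zify.
Import Order.TTheory GRing.Theory Num.Theory.
Set Implicit Arguments. Unset Strict Implicit. Unset Printing Implicit Defensive.
Local Open Scope ring_scope.

(** * The group law and duplication *)

(** The contraction factor reflects the invariant differential dx/y, which duplication multiplies by
    2: with D(x) = x (x - 1) (x - lam), the form dx^2 / D(x) is multiplied by 4. A finite version
    exists because 4 D(u) times each of u', u' - 1, u' - lam is the square of a quadratic in u,
    while 4 D(u) D(v) (u' - v') is u - v times the polarisations of these three quadratics. For u
    close to v a quadratic and its polarisation have the same absolute value, and |u - v|^2 / |D(u)|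
    is multiplied by exactly |4| < 1.

    Uniformity in lam is what makes the set computable. The order of lam is bounded by counting
    powers of a modulo 4 inside Q(a), whose dimension does not involve lam; only then does Q(a, lam)
    have bounded dimension, which in turn bounds the orbit.

    The search looks for a certificate: approximations of a and of all N-th roots of unity at once,
    with discs that separate them. Any accepted certificate yields the right answer, so that
    existence of one matters only for termination. *)

Section GroupLaw.
Variables (F : fieldType) (lam : F).
Hypotheses (nz2 : 2 != 0 :> F) (lam0 : lam != 0) (lam1 : lam != 1).

Local Notation on := (on_legendre lam).
Local Notation "P ++ Q" := (legendre_add lam P Q).

Definition legendre_opp (P : Defs.point F) : Defs.point F :=
  if P is Some (x, y) then Some (x, - y) else None.
Local Notation opp := legendre_opp.

Lemma oppPK : involutive opp.
Proof. by case=> [[x y]|] //=; rewrite opprK. Qed.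

Lemma on_opp P : on (opp P) = on P.
Proof. by case: P => [[x y]|] //=; rewrite sqrrN. Qed.

Lemma addP0 P : P ++ None = P. Proof. by case: P => [[]|]. Qed.

Lemma addPN P : opp P ++ P = None.
Proof. by case: P => [[x y]|] //=; rewrite !eqxx. Qed.

Lemma addNP P : P ++ opp P = None.
Proof. by rewrite -{1}(oppPK P) addPN. Qed.

(* The line through (x1, y1) with slope s meets the curve in the points with
   abscissae x1, x2, x3. *)
Definition line x1 x2 x3 y1 s :=
  [/\ 1 + lam = x1 + x2 + x3 - s ^+ 2,
      lam = 2 * s * (y1 - s * x1) + (x1 * x2 + x1 * x3 + x2 * x3) &
      (y1 - s * x1) ^+ 2 = x1 * x2 * x3].

(** At the roots 0, 1 and [lam] of the cubic its derivative is [lam], [1 - lam] and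
    [lam * (lam - 1)]. *)
Lemma on_smooth x y : on (Some (x, y)) -> y = 0 ->
  3 * x ^+ 2 - 2 * (1 + lam) * x + lam != 0.
Proof.
move=> /= /eqP + y0; rewrite y0 expr0n /= => /esym/eqP.
rewrite !mulf_eq0 !subr_eq0 => /orP[/orP[]|] /eqP->.
- by rewrite (_ : _ + _ = lam)//; ring.
- by rewrite (_ : _ + _ = 1 - lam) ?subr_eq0 1?eq_sym//; ring.
- by rewrite (_ : _ + _ = lam * (lam - 1)) ?mulf_neq0 ?subr_eq0//; ring.
Qed.

(** The equations in [line] compare coefficients: the cubic minus the square of the line is (x -
    x1)(x - x2)(x - x3). *)
Lemma line_on x1 x2 x3 y1 s x : line x1 x2 x3 y1 s ->
  (x - x1) * (x - x2) * (x - x3) = 0 -> on (Some (x, y1 + s * (x - x1))).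
Proof.
move=> [e2 e1 e0] e /=; apply/eqP.
have -> : x * (x - 1) * (x - lam) = x ^+ 3 - (1 + lam) * x ^+ 2 + lam * x by ring.
rewrite e2 {1}e1.
have -> : y1 + s * (x - x1) = s * x + (y1 - s * x1) by ring.
rewrite sqrrD e0; apply/eqP; rewrite -subr_eq0 -(opprK (_ - _)) oppr_eq0.
by apply/eqP; rewrite -[RHS]e; ring.
Qed.

Lemma add_line x1 x2 x3 y1 s : line x1 x2 x3 y1 s ->
  Some (x2, y1 + s * (x2 - x1)) <> opp (Some (x1, y1)) ->
  Some (x1, y1) ++ Some (x2, y1 + s * (x2 - x1)) =
  Some (x3, - (y1 + s * (x3 - x1))).
Proof.
move=> [e2 e1 e0] /= neq.
have [x12|x12] := eqVneq x1 x2; last first.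
  have x21 : x2 - x1 != 0 by rewrite subr_eq0 eq_sym.
  rewrite [y1 + _ - _]addrAC subrr add0r mulfK// e2; congr (Some (_, _)); ring.
move: neq; rewrite -x12 subrr mulr0 addr0 => neq.
have [yy|y2] := eqVneq y1 (- y1); first by case: neq; rewrite -yy.
have y20 : 2 * y1 != 0.
  apply: contra_neq y2 => e; apply/eqP; rewrite -subr_eq0 opprK; apply/eqP.
  by rewrite -[RHS]e; ring.
have -> /= : (3 * x1 ^+ 2 - 2 * (1 + lam) * x1 + lam) / (2 * y1) = s.
  apply: (mulIf y20); rewrite divfK// e2 {1}e1 -x12; ring.
rewrite e2 -x12; congr (Some (_, _)); ring.
Qed.

Lemma lineP x1 y1 x2 y2 : on (Some (x1, y1)) -> on (Some (x2, y2)) ->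
  Some (x2, y2) <> opp (Some (x1, y1)) ->
  exists s x3, line x1 x2 x3 y1 s /\ y2 = y1 + s * (x2 - x1).
Proof.
move=> /= /eqP on1 /eqP on2 neq.
have [x12|x12] := eqVneq x1 x2.
  subst x2; have : (y2 - y1) * (y2 + y1) == 0 by rewrite -subr_sqr on1 on2 subrr.
  rewrite mulf_eq0 subr_eq0 addr_eq0 => /orP[]/eqP y12; last by case: neq; rewrite y12.
  subst y2; have y10 : y1 != 0.
    by apply/eqP => y0; apply: neq; rewrite y0 oppr0.
  pose s := (3 * x1 ^+ 2 - 2 * (1 + lam) * x1 + lam) / (2 * y1).
  have sE : s * (2 * y1) = 3 * x1 ^+ 2 - 2 * (1 + lam) * x1 + lam.
    by rewrite divfK// mulf_neq0.
  exists s, (s ^+ 2 + (1 + lam) - 2 * x1); split; last by rewrite subrr mulr0 addr0.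
  split; first by ring.
    have -> : 2 * s * (y1 - s * x1) = s * (2 * y1) - 2 * s ^+ 2 * x1 by ring.
    by rewrite sE; ring.
  have -> : (y1 - s * x1) ^+ 2 = y1 ^+ 2 - s * (2 * y1) * x1 + s ^+ 2 * x1 ^+ 2 by ring.
  by rewrite on1 sE; ring.
have x21 : x2 - x1 != 0 by rewrite subr_eq0 eq_sym.
pose s := (y2 - y1) / (x2 - x1).
have sE : y2 = y1 + s * (x2 - x1) by rewrite divfK// addrC subrK.
have e1 : lam = 2 * s * (y1 - s * x1) + (x1 * x2 + x1 * (s ^+ 2 + (1 + lam) - x1 - x2) + x2 * (s ^+ 2 + (1 + lam) - x1 - x2)).
  apply: (mulIf x21); apply/eqP; rewrite -subr_eq0; apply/eqP.
  have /eqP : y2 ^+ 2 - y1 ^+ 2 - (x2 * (x2 - 1) * (x2 - lam) - x1 * (x1 - 1) * (x1 - lam)) = 0.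
    by rewrite on1 on2 subrr.
  rewrite sE -oppr_eq0 => /eqP <-; ring.
exists s, (s ^+ 2 + (1 + lam) - x1 - x2); split=> //; split=> //; first by ring.
have -> : (y1 - s * x1) ^+ 2 = y1 ^+ 2 - (2 * s * (y1 - s * x1)) * x1 - s ^+ 2 * x1 ^+ 2 by ring.
have -> : 2 * s * (y1 - s * x1) = lam - (x1 * x2 + x1 * (s ^+ 2 + (1 + lam) - x1 - x2) + x2 * (s ^+ 2 + (1 + lam) - x1 - x2)).
  by rewrite {1}e1 addrK.
by rewrite on1; ring.
Qed.

Lemma addPC P Q : on P -> on Q -> P ++ Q = Q ++ P.
Proof.
case: P Q => [[x1 y1]|] [[x2 y2]|] // o1 o2.
have [->|neq] := pselect (Some (x2, y2) = opp (Some (x1, y1))).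
  by rewrite addNP addPN.
have [s [x3 [l yE]]] := lineP o1 o2 neq.
subst y2; rewrite (add_line l)//.
have l' : line x2 x1 x3 (y1 + s * (x2 - x1)) s.
  by case: l => e2 e1 e0; split; [rewrite e2|rewrite {1}e1|rewrite (mulrC x2) -e0]; ring.
have e : y1 = y1 + s * (x2 - x1) + s * (x1 - x2) by ring.
rewrite {3}e (add_line l'); first by congr (Some (_, _)); ring.
rewrite -e => /(congr1 opp) e'; apply: neq; rewrite e' oppPK //.
Qed.

Lemma on_add P Q : on P -> on Q -> on (P ++ Q).
Proof.
case: P Q => [[x1 y1]|] [[x2 y2]|] // o1 o2.
have [->|neq] := pselect (Some (x2, y2) = opp (Some (x1, y1))).
  by rewrite addNP.
have [s [x3 [l yE]]] := lineP o1 o2 neq.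
subst y2; rewrite (add_line l)// -on_opp /= opprK.
by apply: (line_on l); rewrite subrr mulr0.
Qed.

Lemma oppD P Q : opp (P ++ Q) = opp P ++ opp Q.
Proof.
case: P Q => [[x1 y1]|] [[x2 y2]|] //=.
have -> : (- y1 == - - y2) = (y1 == - y2) by rewrite (inj_eq oppr_inj).
case: ifP => // _; have [->|x12] := eqVneq x1 x2.
  by rewrite /= !mulrN invrN mulrN !sqrrN; congr (Some (_, _)); ring.
have -> : - y2 - - y1 = - (y2 - y1) by ring.
by rewrite mulNr sqrrN; congr (Some (_, _)); ring.
Qed.

Local Arguments legendre_add : simpl never.

(** The points [opp P], [P ++ Q] and [opp Q] lie on the reflection of the line through [P] and [Q],
    so [line] holds again with the second and third abscissae exchanged. The exception to
    [add_line], where [P ++ Q] is [P], would make the curve singular at a point with ordinate 0. *)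
Lemma addKP P Q : on P -> on Q -> opp P ++ (P ++ Q) = Q.
Proof.
case: P Q => [[x1 y1]|] [[x2 y2]|] // o1 o2; last by rewrite addP0 addPN.
have [->|neq] := pselect (Some (x2, y2) = opp (Some (x1, y1))).
  by rewrite addNP addP0.
have [s [x3 [l yE]]] := lineP o1 o2 neq.
subst y2; rewrite (add_line l)//.
have l' : line x1 x3 x2 (- y1) (- s).
  by case: l => e2 e1 e0; split; [rewrite e2|rewrite {1}e1|rewrite mulrAC -e0]; ring.
have e : - (y1 + s * (x3 - x1)) = - y1 + (- s) * (x3 - x1) by ring.
rewrite /= e (add_line l'); first by congr (Some (_, _)); ring.
rewrite /= opprK => -[x31]; rewrite x31 subrr mulr0 addr0 => y1N.
have y10 : y1 = 0.
  apply/eqP; rewrite -(mulrI_eq0 _ (mulfI nz2)); apply/eqP.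
  by rewrite mulr_natl mulr2n -{1}y1N addNr.
have /eqP[] := on_smooth o1 y10.
by case: l => e2 e1 e0; rewrite e2 {1}e1 x31 y10; ring.
Qed.

(** The degenerate positions reduce to cancellation by [addKP] or to commutativity. In the remaining
    ones every slope has an explicit nonzero denominator and the claim is a rational identity. *)
Lemma double_add P Q : on P -> on Q -> (P ++ P) ++ Q = P ++ (P ++ Q).
Proof.
move=> oP oQ; case: P oP => [[x1 y1]|] // o1; set P := Some (x1, y1) in o1 *.
case: Q oQ => [[x2 y2]|] // o2; last by rewrite !addP0.
set Q := Some (x2, y2) in o2 *.
have oN : on (opp P) by rewrite on_opp.
have [PN|PN] := pselect (P = opp P).
  by rewrite {2}PN addNP {1}PN addKP.
have [QN|QN] := pselect (Q = opp P).
  rewrite QN addNP addP0 addPC ?on_add//; exact: addKP.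
have [PQN|PQN] := pselect (P ++ Q = opp P).
  by rewrite PQN addNP -(addKP o1 o2 : _ = Q) PQN -oppD addNP.
have [QD|QD] := pselect (Q = opp (P ++ P)).
  rewrite QD addNP oppD; have := addKP oN oN; rewrite oppPK => ->.
  by rewrite addNP.
have [QP|QP] := pselect (Q = P).
  by rewrite QP addPC// on_add.
have x12 : x1 != x2.
  apply/eqP => x12; have [s [x3 [_]]] := lineP o1 o2 QN; rewrite -x12 subrr mulr0 addr0 => yE.
  by apply: QP; rewrite /Q yE -x12.
have [s [x3 [l yE]]] := lineP o1 o2 QN.
have PQE : P ++ Q = Some (x3, - (y1 + s * (x3 - x1))) by rewrite /Q yE (add_line l)// -yE.
have x13 : x1 != x3.
  apply/eqP => x13; apply: PQN; rewrite PQE -x13 subrr mulr0 addr0 //.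
have [t [x4 [m _]]] := lineP o1 o1 PN.
have PPE : P ++ P = Some (x4, - (y1 + t * (x4 - x1))).
  have {2}-> : P = Some (x1, y1 + t * (x1 - x1)) by rewrite subrr mulr0 addr0.
  by rewrite (add_line m)// subrr mulr0 addr0.
have y10 : y1 != 0 by apply/eqP => y0; apply: PN; rewrite /P y0 /= oppr0.
(* The derivative of (x - x1)(x - x2)(x - x3) at [x1] is 2 [y1] times the tangent slope [t] minus
   the chord slope [s]. *)
have tE : t = s + (x1 - x2) * (x1 - x3) / (2 * y1).
  have nz : 2 * y1 != 0 by rewrite mulf_neq0.
  apply: (mulIf nz); rewrite [RHS]mulrDl divfK//.
  case: l m => e2 e1 e0 [f2 f1 f0].
  have : 3 * x1 ^+ 2 - 2 * (1 + lam) * x1 + lam = t * (2 * y1).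
    by rewrite f2 {1}f1; ring.
  by move=> <-; rewrite e2 {1}e1; ring.
have l2 : 1 + lam = x1 + x2 + x3 - s ^+ 2 by case: l.
have x4E : x4 = t ^+ 2 - s ^+ 2 + x2 + x3 - x1.
  case: m => f2 _ _; rewrite l2 in f2.
  have -> : x4 = (x1 + x1 + x4 - t ^+ 2) + t ^+ 2 - x1 - x1 by ring.
  by rewrite -f2; ring.
have x13' : x3 - x1 != 0 by rewrite subr_eq0 eq_sym.
have x12' : x2 - x1 != 0 by rewrite subr_eq0 eq_sym.
have [x42|x42] := eqVneq x4 x2; last first.
  have x42' : x2 - x4 != 0 by rewrite subr_eq0 eq_sym.
  rewrite PPE PQE /P /Q /legendre_add (negPf x13) (negPf x42) /= l2 yE.
  rewrite x4E tE in x42' *.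
  set D := (X in X != 0) in x42'.
  have side : x2 * (4 * y1 ^+ 2) -
      ((s * (2 * y1) + (x1 - x2) * (x1 - x3)) ^+ 2 + - s ^+ 2 * (4 * y1 ^+ 2) +
       x2 * (4 * y1 ^+ 2) + x3 * (4 * y1 ^+ 2) + - x1 * (4 * y1 ^+ 2)) != 0.
    rewrite (_ : _ - _ = 2 * 2 * y1 ^+ 2 * D).
      by rewrite !mulf_neq0 ?expf_neq0.
    by rewrite /D; field; rewrite y10 nz2.
  by congr (Some (_, _)); field; rewrite y10 nz2 x13' side.
(* In this last case the left side doubles [P ++ P] along a tangent, while the right side adds [P]
   along a chord. *)
have QE : Q = P ++ P.
  have := o2; have := on_add o1 o1; rewrite PPE /= x42 => /eqP e1 /eqP e2.
  have := subrr (x2 * (x2 - 1) * (x2 - lam)); rewrite -{1}e2 -e1 => /eqP.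
  rewrite subr_sqr mulf_eq0 subr_eq0 addr_eq0 => /orP[]/eqP e; first by rewrite /Q e.
  by case: QD; rewrite PPE x42 /Q e.
have y20 : y2 != 0.
  apply/eqP => y20; apply: QD; rewrite -QE /Q /= y20 oppr0 //.
have y2E : y2 = - (y1 + t * (x2 - x1)) by have := QE; rewrite PPE /Q x42 => -[].
have y20' : - (y1 + t * (x2 - x1)) != 0 by rewrite -y2E.
have y2N : y2 == - y2 = false.
  apply/eqP => e; case/eqP: y20; apply/eqP.
  by rewrite -(mulrI_eq0 _ (mulfI nz2)) mulr_natl mulr2n {1}e addNr.
have lE : 1 + lam = x1 + x1 + x2 - t ^+ 2 by case: m; rewrite x42.
have lE1 : lam = 2 * t * (y1 - t * x1) + (x1 * x1 + x1 * x2 + x1 * x2).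
  by case: m; rewrite x42.
have sE : s = (- (y1 + t * (x2 - x1)) - y1) / (x2 - x1).
  by rewrite -y2E yE addrAC subrr add0r mulfK.
have x3E : x3 = s ^+ 2 + (x1 + x1 + x2 - t ^+ 2) - x1 - x2.
  by rewrite -lE l2; ring.
rewrite -QE PQE /P /Q /legendre_add (negPf x13) eqxx y2N lE lE1 y2E /=.
rewrite x3E sE in x13' *.
set D := (X in X != 0) in x13'.
have side : (- (y1 + t * (x2 - x1)) - y1) ^+ 2 +
   (x1 + x1 + x2 - t ^+ 2) * (x2 - x1) ^+ 2 + - x1 * (x2 - x1) ^+ 2 +
   - x2 * (x2 - x1) ^+ 2 + - x1 * (x2 - x1) ^+ 2 != 0.
  rewrite (_ : _ + _ = (x2 - x1) ^+ 2 * D) ?mulf_neq0 ?expf_neq0//.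
  by rewrite /D; field.
by congr (Some (_, _)); field; rewrite y20' x12' nz2 side.
Qed.

(** The Lattès map of duplication on the projective line, with [None] as the fixed point at
    infinity. *)
Definition xdouble (x : option F) : option F :=
  if x is Some x then
    if x * (x - 1) * (x - lam) == 0 then None
    else Some ((x ^+ 2 - lam) ^+ 2 / (4 * (x * (x - 1) * (x - lam))))
  else None.

Definition abscissa (P : Defs.point F) : option F := omap fst P.

Lemma abscissa_double P : on P -> abscissa (P ++ P) = xdouble (abscissa P).
Proof.
case: P => [[x y]|] //= /eqP oP; rewrite -oP sqrf_eq0 /legendre_add eqxx /=.
have [->|y0] := eqVneq y 0; first by rewrite oppr0 eqxx.
have -> : (y == - y) = false.
  apply/eqP => e; case/eqP: y0; apply/eqP.
  by rewrite -(mulrI_eq0 _ (mulfI nz2)) mulr_natl mulr2n {1}e addNr.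
have nz4 : 4 != 0 :> F by rewrite (_ : 4 = 2 * 2) ?mulf_neq0//; ring.
rewrite /=; congr Some; apply: (mulIf (_ : 4 * y ^+ 2 != 0)).
  by rewrite mulf_neq0 ?expf_neq0.
rewrite divfK; last first.
  by rewrite mulf_neq0 ?expf_neq0.
have -> : ((3 * x ^+ 2 - 2 * (1 + lam) * x + lam) / (2 * y)) ^+ 2 +
  (1 + lam) - x - x = ((3 * x ^+ 2 - 2 * (1 + lam) * x + lam) ^+ 2  +
  (1 + lam - x - x) * (4 * y ^+ 2)) / (4 * y ^+ 2).
  by field; rewrite y0 nz4 nz2.
rewrite divfK ?oP; first by ring.
by rewrite -oP mulf_neq0 ?expf_neq0.
Qed.

Definition preperiodic (x : F) :=
  exists i j : nat, (i < j)%N /\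
    iter i xdouble (Some x) = iter j xdouble (Some x).

Lemma eq_abscissa P Q : on P -> on Q -> abscissa P = abscissa Q ->
  P = Q \/ P = opp Q.
Proof.
case: P Q => [[x1 y1]|] [[x2 y2]|] //=; last by left.
move=> /eqP o1 /eqP o2 [x12]; subst x2.
have /eqP : y1 ^+ 2 - y2 ^+ 2 = 0 by rewrite o1 o2 subrr.
by rewrite subr_sqr mulf_eq0 subr_eq0 addr_eq0 => /orP[]/eqP->; [left|right].
Qed.

(** * Torsion points and preperiodic abscissae *)

Section Torsion.
Variable P : Defs.point F.
Hypothesis oP : on P.

Local Notation mul n Q := (iter n (legendre_add lam P) Q).
Local Notation double := (fun Q => Q ++ Q).

Lemma on_mul n Q : on Q -> on (mul n Q).
Proof. by move=> oQ; elim: n => //= n; apply: on_add. Qed.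

Lemma on_double k : on (iter k double P).
Proof. by elim: k => //= k o; apply: on_add. Qed.

(* Translation by the double of a point is twice the translation by that point;
   this is the only form of associativity that is needed. *)
Lemma add_double k Q : on Q -> iter k double P ++ Q = mul (2 ^ k) Q.
Proof.
elim: k Q => [|k IH] Q oQ //=.
rewrite double_add ?on_double// !IH ?on_mul//.
by rewrite -iterD expnS mul2n -addnn.
Qed.

Lemma double_mul k : iter k double P = mul (2 ^ k) None.
Proof. by rewrite -add_double// addP0. Qed.

Lemma mulI n Q Q' : on Q -> on Q' -> mul n Q = mul n Q' -> Q = Q'.
Proof.
move=> oQ oQ'; elim: n => //= n IH e; apply: IH.
by rewrite -(addKP oP (on_mul n oQ)) e addKP// on_mul.
Qed.

Lemma iter_xdouble k : iter k xdouble (abscissa P) = abscissa (iter k double P).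
Proof. by elim: k => //= k ->; rewrite abscissa_double// on_double. Qed.

(** If n kills [P], two powers of 2 agree modulo n and the corresponding doubles coincide.
    Conversely, equal abscissae mean that 2^i [P] is plus or minus 2^j [P], so 2^j - 2^i or 2^j +
    2^i kills [P]. *)
Lemma torsion_preperiodic :
  (exists2 n, (0 < n)%N & legendre_mul lam n P = None) <->
  (exists i j : nat, (i < j)%N /\
    iter i xdouble (abscissa P) = iter j xdouble (abscissa P)).
Proof.
split=> [[n n0 nP]|[i [j [ij]]]].
  have per q m : mul (q * n + m) None = mul m None :> Defs.point F.
    have -> : (q * n + m = m + q * n)%N by rewrite addnC.
    rewrite iterD; congr (mul m _); elim: q => // q IH.
    by rewrite mulSn iterD IH.
  have modn_mul k : mul k None = mul (k %% n) None :> Defs.point F.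
    by rewrite {1}(divn_eq k n) per.
  pose f (k : 'I_n.+1) : 'I_n := Ordinal (ltn_pmod (2 ^ k) n0).
  have /injectivePn[i [j nij fij]] : ~~ injectiveb f.
    apply/negP => /injectiveP/leq_card; rewrite !card_ord ltnn //.
  have e : iter i xdouble (abscissa P) = iter j xdouble (abscissa P).
    rewrite !iter_xdouble !double_mul modn_mul [in RHS]modn_mul.
    by case: fij => ->.
  case: (ltngtP i j) nij => ij; first by exists i, j.
    by exists j, i.
  by rewrite (val_inj ij) eqxx.
rewrite !iter_xdouble => /(eq_abscissa (on_double i) (on_double j))[].
  rewrite !double_mul => e; exists (2 ^ j - 2 ^ i)%N.
    by rewrite subn_gt0 ltn_exp2l.
  apply/esym; apply: (@mulI (2 ^ i)) => //; first by rewrite on_mul.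
  by rewrite e -iterD subnKC// leq_exp2l// ltnW.
move=> e; exists (2 ^ j + 2 ^ i)%N; first by rewrite addn_gt0 expn_gt0.
rewrite /legendre_mul iterD -double_mul -add_double ?on_double// e.
by rewrite addNP.
Qed.
End Torsion.
End GroupLaw.

(** * Valuation rings above 2 *)

Section Chevalley.
Variable K : numFieldType.

Definition no_half_subring (A : set K) : Prop :=
  [/\ A 1, forall x y, A x -> A y -> A (x - y),
      forall x y, A x -> A y -> A (x * y) & ~ A 2^-1].

Section Subring.
Variable A : set K.
Hypothesis hA : no_half_subring A.

Let A1 : A 1. Proof. by case: hA. Qed.
Let AB x y : A x -> A y -> A (x - y). Proof. by case: hA => _ + _ _; apply. Qed.
Let AM x y : A x -> A y -> A (x * y). Proof. by case: hA => _ _ + _; apply. Qed.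
Let A0 : A 0. Proof. by rewrite -(subrr 1); apply: AB. Qed.
Let AN x : A x -> A (- x). Proof. by rewrite -sub0r; apply: AB. Qed.
Let AD x y : A x -> A y -> A (x + y).
Proof. by move=> Ax Ay; rewrite -(opprK y); apply: AB => //; apply: AN. Qed.
Let Asum n (f : 'I_n -> K) : (forall i, A (f i)) -> A (\sum_i f i).
Proof. by move=> Af; apply: big_ind. Qed.
Let AX n x : A x -> A (x ^+ n).
Proof. by move=> Ax; elim: n => [|n IH]; rewrite ?expr0// exprS; apply: AM. Qed.
Let Anat n : A n%:R.
Proof. by elim: n => // n IH; rewrite -natr1; apply: AD. Qed.

Hypothesis Amax : forall B : set K, (A `<` B)%classic -> ~ no_half_subring B.

(** The values at [x] of polynomials over [A] form a strictly larger ring, which by maximality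
    contains 1/2. *)
Lemma max_adjoin x : ~ A x ->
  exists p : {poly K}, (forall i, A p`_i) /\ p.[x] = 2^-1.
Proof.
move=> nAx; apply: contrapT => noP.
pose B : set K := [set z | exists p : {poly K}, (forall i, A p`_i) /\ z = p.[x]]%classic.
apply: (Amax (B := B)).
  split=> [z Az|BA].
    exists z%:P; split=> [i|]; last by rewrite hornerC.
    by rewrite coefC; case: ifP.
  by apply: nAx; apply: BA; exists 'X; split=> [i|]; rewrite ?hornerX// coefX; case: eqP.
split.
- exists 1; split=> [i|]; last by rewrite hornerC.
  by rewrite coef1; case: eqP.
- move=> _ _ [p [Ap ->]] [q [Aq ->]]; exists (p - q); split=> [i|].
    by rewrite coefB; apply: AB.
  by rewrite hornerD hornerN.
- move=> _ _ [p [Ap ->]] [q [Aq ->]]; exists (p * q); split=> [i|].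
    by rewrite coefM; apply: Asum => k; apply: AM.
  by rewrite hornerM.
- by case=> p [Ap e]; apply: noP; exists p.
Qed.

(** This puts 2 into every maximal ideal. Otherwise 1/2 is a polynomial over [A] in the inverse of u
    = 1 + 2a; multiplication by a power of u, which is 1 modulo 2, brings 1/2 into [A]. *)
Lemma max_inv a : A a -> A (1 + 2 * a)^-1.
Proof.
move=> Aa; apply: contrapT => /max_adjoin[p [Ap]].
set u := 1 + 2 * a => e.
have n2 : 2 != 0 :> K by rewrite pnatr_eq0.
have Au : A u by apply: AD => //; apply: AM.
have u0 : u != 0.
  apply/eqP => u0; case: hA => _ _ _; apply.
  rewrite (_ : 2^-1 = - a); first by apply: AN.
  by apply: (mulfI n2); rewrite divff// mulrN -[LHS](addrK (2 * a)) -/u u0 sub0r.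
have Aun n : exists2 b, A b & u ^+ n = 1 + 2 * b.
  elim: n => [|n [b Ab eb]]; first by exists 0; rewrite ?expr0 ?mulr0 ?addr0.
  exists (a + b + 2 * a * b); last by rewrite exprS eb /u; ring.
  by apply: AD; [apply: AD|apply: AM => //; apply: AM].
have [b Ab eb] := Aun (size p).
case: hA => _ _ _; apply.
have -> : 2^-1 = u ^+ size p * 2^-1 - b by rewrite eb; field.
apply: AB => //; rewrite -e horner_coef mulr_sumr; apply: Asum => i.
rewrite mulrCA; apply: AM => //.
by rewrite exprVn -expfB//; apply: AX.
Qed.

(** Chevalley's descent: if both [x] and its inverse are missing, 1/2 is a polynomial in each, and
    the relation of lower degree removes the leading term of the other one. *)
Lemma max_total x : A x \/ A x^-1.
Proof.
have n2 : 2 != 0 :> K by rewrite pnatr_eq0.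
apply: contrapT => /not_orP[/[dup] nAx /max_adjoin[p [Ap ep]] /[dup] nAx' /max_adjoin[q [Aq eq]]].
have [N] := ubnP (size p + size q)%N.
elim: N x p q Ap Aq ep eq nAx nAx' => // N IH x p q Ap Aq ep eq nAx nAx' sN.
wlog qp : x p q Ap Aq ep eq nAx nAx' sN / (size q <= size p)%N.
  move=> W; case: (leqP (size q) (size p)) => h; first exact: (W x p q).
  by apply: (W x^-1 q p); rewrite ?invrK// 1?addnC// ltnW.
have x0 : x != 0 by apply/eqP => x0; apply: nAx; rewrite x0.
case sp : (size p) => [|n].
  move/eqP: sp; rewrite size_poly_eq0 => /eqP p0.
  by move: ep; rewrite p0 horner0 => /esym/eqP; rewrite invr_eq0 (negPf n2).
(* Twice the relation for 1/x reads 1 - 2 q_0 = 2 (q_1 / x + ...). Dividing by the unit 1 - 2 q_0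
   expresses 1 without a constant term. *)
pose u := (1 + 2 * (- q`_0))^-1.
have Au : A u by apply: max_inv; apply: AN.
have u0 : 1 + 2 * (- q`_0) != 0.
  apply/eqP => e; case: hA => _ _ _; apply; rewrite (_ : 2^-1 = q`_0) //.
  by apply: (mulfI n2); rewrite divff// -[LHS](addrK (2 * - q`_0)) e sub0r mulrN opprK.
pose c j := 2 * u * q`_j.
have Ac j : A (c j) by apply: AM => //; apply: AM.
have ec : \sum_(i < n) c i.+1 * x^-1 ^+ i.+1 = 1.
  have : q.[x^-1] = \sum_(i < n.+1) q`_i * x^-1 ^+ i.
    rewrite (horner_coef_wide _ (n := n.+1))// -sp //.
  rewrite eq big_ord_recl expr0 mulr1 => e.
  have -> : \sum_(i < n) c i.+1 * x^-1 ^+ i.+1 = 2 * u * (2^-1 - q`_0).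
    rewrite e addrAC subrr add0r mulr_sumr; apply: eq_bigr => i _.
    by rewrite /c mulrA.
  by rewrite mulrAC mulrBr divff// /u -mulrN mulfV.
(* The leading term p_n x^n is multiplied by the expression of 1 in [ec], which leaves only
   exponents below n. *)
pose p' := \poly_(i < n) (p`_i + p`_n * c (n - i)%N).
apply: (IH x p' q) => //.
- move=> i; rewrite coef_poly; case: ifP => // _.
  by apply: AD => //; apply: AM.
- rewrite horner_poly -ep (horner_coef_wide _ (n := n.+1)) ?sp// big_ord_recr /=.
  rewrite -[X in _ = _ + p`_n * X]mul1r -ec mulr_suml.
  under eq_bigr do rewrite mulrDl.
  rewrite big_split /=; congr (_ + _).
  rewrite mulr_sumr [RHS](reindex_inj rev_ord_inj) /=; apply: eq_bigr => i _.
  have -> : x ^+ n = x ^+ (n - i) * x ^+ i by rewrite -exprD subnK// ltnW.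
  have xk : x ^+ (n - i) != 0 by rewrite expf_neq0.
  rewrite subnSK// exprVn; move: (x ^+ (n - i)) xk => y y0.
  by field.
- move: sN; rewrite sp addSn ltnS; apply: leq_ltn_trans.
  by rewrite leq_add2r size_poly.
Qed.
End Subring.

Lemma exists_valuation_ring :
  exists V : set K, no_half_subring V /\ forall x, V x \/ V x^-1.
Proof.
pose P (A : set K) := A = set0 \/ no_half_subring A.
have [F FP Ftot|V [PV Vmax]] := @Zorn_bigcup K P.
  have [->|/set0P[z [X FX Xz]]] := eqVneq (\bigcup_(X in F) X)%classic set0; first by left.
  have sub Y y : F Y -> Y y -> no_half_subring Y.
    by move=> /FP[->|].
  have two x y : (\bigcup_(X in F) X)%classic x -> (\bigcup_(X in F) X)%classic y ->
      exists2 Y, F Y & Y x /\ Y y.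
    move=> [Y FY Yx] [Z FZ Zy]; case: (Ftot Y Z FY FZ) => YZ.
      by exists Z => //; split => //; apply: YZ.
    by exists Y => //; split => //; apply: YZ.
  right; split.
  - by exists X => //; case: (sub X z FX Xz).
  - move=> x y Ux Uy; have [Y FY [Yx Yy]] := two x y Ux Uy.
    by exists Y => //; case: (sub Y x FY Yx) => _ + _ _; apply.
  - move=> x y Ux Uy; have [Y FY [Yx Yy]] := two x y Ux Uy.
    by exists Y => //; case: (sub Y x FY Yx) => _ _ + _; apply.
  - by case=> Y FY Yh; case: (sub Y _ FY Yh) => _ _ _; apply.
have hZ : no_half_subring [set x : K | exists z : int, x = z%:~R]%classic.
  split.
  - by exists 1.
  - by move=> _ _ [m ->] [n ->]; exists (m - n); rewrite rmorphB.
  - by move=> _ _ [m ->] [n ->]; exists (m * n); rewrite rmorphM.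
  - case=> z e; have : (1 : K) = (2 * z)%:~R.
      by rewrite rmorphM /= -e mulfV// pnatr_eq0.
    by rewrite -[1]/(1%:~R) => /intr_inj; lia.
have hV : no_half_subring V.
  case: PV => // V0; case: (Vmax [set x : K | exists z : int, x = z%:~R]%classic); last by right.
  rewrite V0; split; first by [].
  by move/(_ 1); apply; exists 1.
exists V; split => // x; apply: max_total => //.
by move=> B AB hB; apply: (Vmax B) => //; right.
Qed.
End Chevalley.

(** * Dynamics of duplication *)

Lemma unity_neq0 (F : idomainType) (z : F) n : (0 < n)%N -> z ^+ n = 1 -> z != 0.
Proof.
move=> n0 zn; apply: contraTneq (oner_neq0 F) => z0.
by rewrite -zn z0 expr0n gtn_eqF// eqxx.
Qed.

(** * Comparison of absolute values for a valuation ring *)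

Section Valuation.
Variables (K : numFieldType) (V : set K).
Hypotheses (hV : no_half_subring V) (Vtotal : forall x, V x \/ V x^-1).

(* [a <=| b] means |a| <= |b| for the valuation with ring V, for which |2| < 1. *)
Definition vle (a b : K) := exists2 t, V t & a = t * b.
Local Notation "a <=| b" := (vle a b) (at level 70, no associativity).

Lemma V1 : V 1. Proof. by case: hV. Qed.
Lemma VB x y : V x -> V y -> V (x - y). Proof. by case: hV => _ + _ _; apply. Qed.
Lemma VM x y : V x -> V y -> V (x * y). Proof. by case: hV => _ _ + _; apply. Qed.
Lemma V0 : V 0. Proof. by rewrite -(subrr 1); apply: VB; apply: V1. Qed.
Lemma VN x : V x -> V (- x). Proof. by rewrite -sub0r; apply: VB; apply: V0. Qed.
Lemma VD x y : V x -> V y -> V (x + y).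
Proof. by move=> Vx Vy; rewrite -(opprK y); apply: VB => //; apply: VN. Qed.
Lemma Vnat n : V n%:R.
Proof. by elim: n => [|n IH]; [exact: V0|rewrite -natr1; apply: VD => //; exact: V1]. Qed.
Lemma Vint (n : int) : V n%:~R.
Proof. by case: n => n; [exact: Vnat|rewrite NegzE mulrNz; apply: VN; exact: Vnat]. Qed.

Lemma vle1 x : (x <=| 1) <-> V x.
Proof. by split=> [[t Vt ->]|Vx]; [rewrite mulr1|exists x; rewrite ?mulr1]. Qed.

Lemma vle_refl a : a <=| a. Proof. by exists 1; rewrite ?mul1r//; apply: V1. Qed.

Lemma vle_trans b a c : a <=| b -> b <=| c -> a <=| c.
Proof. by move=> [t Vt ->] [s Vs ->]; exists (t * s); rewrite ?mulrA//; apply: VM. Qed.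

Lemma vle0 a : 0 <=| a. Proof. by exists 0; rewrite ?mul0r//; apply: V0. Qed.

Lemma vle_eq0 a : a <=| 0 -> a = 0. Proof. by case=> t _ ->; rewrite mulr0. Qed.

Lemma vle_total a b : a <=| b \/ b <=| a.
Proof.
have [->|b0] := eqVneq b 0; first by right; apply: vle0.
have [->|a0] := eqVneq a 0; first by left; apply: vle0.
case: (Vtotal (a / b)) => h; [left|right].
  by exists (a / b); rewrite ?divfK.
by exists (a / b)^-1 => //; rewrite invf_div divfK.
Qed.

Lemma vle_mul a b c d : a <=| b -> c <=| d -> a * c <=| b * d.
Proof. by move=> [t Vt ->] [s Vs ->]; exists (t * s); [apply: VM|ring]. Qed.

Lemma vle_mull c a b : a <=| b -> c * a <=| c * b.
Proof. by apply: vle_mul; apply: vle_refl. Qed.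

Lemma vle_cancel c a b : c != 0 -> c * a <=| c * b -> a <=| b.
Proof.
move=> c0 [t Vt e]; exists t => //.
by apply: (mulfI c0); rewrite e mulrCA.
Qed.

Lemma vle_add a b c : a <=| c -> b <=| c -> a + b <=| c.
Proof. by move=> [t Vt ->] [s Vs ->]; exists (t + s); [apply: VD|rewrite mulrDl]. Qed.

Lemma vle_oppl a b : a <=| b -> - a <=| b.
Proof. by move=> [t Vt ->]; exists (- t); [apply: VN|rewrite mulNr]. Qed.

Lemma vle_sub a b c : a <=| c -> b <=| c -> a - b <=| c.
Proof. by move=> ac bc; apply: vle_add => //; apply: vle_oppl. Qed.

Lemma vle_sqr a b : a ^+ 2 <=| b ^+ 2 -> a <=| b.
Proof.
move=> ab; case: (vle_total a b) => // ba.
have [->|a0] := eqVneq a 0; first exact: vle0.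
apply: (vle_cancel a0); rewrite -expr2; apply: (vle_trans ab).
by rewrite expr2; apply: vle_mul => //; apply: vle_refl.
Qed.

Lemma vle_exp n a b : a <=| b -> a ^+ n <=| b ^+ n.
Proof.
move=> ab; elim: n => [|n IH]; first by rewrite !expr0; apply: vle_refl.
by rewrite !exprS; apply: vle_mul.
Qed.

Lemma vle_mulV t a : V t -> t * a <=| a. Proof. by exists t. Qed.

Lemma dominant a b : ~ (b <=| a) -> b <=| a + b.
Proof.
move=> ba; case: (vle_total a (a + b)) => h.
  by rewrite -{1}(addKr a b) addrC; apply: vle_sub => //; apply: vle_refl.
case: ba; rewrite -(addKr a b) addrC; apply: vle_sub => //; exact: vle_refl.
Qed.

Lemma not_1le2 : ~ (1 <=| 2).
Proof.
case=> t Vt e; case: hV => _ _ _; apply.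
have n2 : 2 != 0 :> K by rewrite pnatr_eq0.
by rewrite (_ : 2^-1 = t)//; apply: (mulIf n2); rewrite mulVf.
Qed.

Lemma not_le_mul2 a : a != 0 -> ~ (a <=| 2 * a).
Proof.
move=> a0 h; apply: not_1le2; apply: (vle_cancel a0).
by rewrite mulr1 mulrC.
Qed.

Section Unity.
Variables (z : K) (n : nat).
Hypotheses (n0 : (0 < n)%N) (zn : z ^+ n = 1).

Lemma unity_V : V z.
Proof.
case: (Vtotal z) => // Vz; have -> : z = z^-1 ^+ n.-1.
  have z0 := unity_neq0 n0 zn.
  by apply: (mulIf (expf_neq0 n.-1 z0)); rewrite -exprMn mulVf// expr1n -exprS prednK.
by elim: (n.-1) => [|m IH]; [exact: V1|rewrite exprS; apply: VM].
Qed.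

End Unity.

Lemma unity_le1 z n : (0 < n)%N -> z ^+ n = 1 -> 1 <=| z.
Proof.
move=> n0 zn; have : V z^-1 by apply: (@unity_V _ n) => //; rewrite exprVn zn invr1.
move=> Vz; exists z^-1 => //; rewrite mulVf//; exact: unity_neq0 zn.
Qed.

(** Induction on the exponent. For odd n and z not 1, the sum of the powers of z vanishes but is
    congruent to n modulo 4, so 1 would be divisible by 2. For even n, z^(n/2) is 1 or -1, and -1 is
    not congruent to 1 modulo 4. *)
Lemma unity_mod4 z n : (0 < n)%N -> z ^+ n = 1 -> z - 1 <=| 4 -> z = 1.
Proof.
have [N] := ubnP n; elim: N n => // N IH n nN n0 zn z4.
have Vz : V z by apply: (@unity_V _ n).
have pow i : z ^+ i - 1 <=| 4.
  elim: i => [|i Hi]; first by rewrite expr0 subrr; apply: vle0.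
  rewrite exprS (_ : _ - 1 = z * (z ^+ i - 1) + (z - 1)); last by ring.
  by apply: vle_add => //; case: Hi => t Vt ->; exists (z * t); [apply: VM|ring].
have four2 : 4 = 2 * 2 :> K by rewrite -natrM.
have [on|en] := boolP (odd n).
  have : (z - 1) * (\sum_(i < n) z ^+ i) = 0 by rewrite -subrX1 zn subrr.
  move/eqP; rewrite mulf_eq0 subr_eq0 => /orP[/eqP//|/eqP s0].
  case: not_1le2; have : (\sum_(i < n) (z ^+ i - 1)) <=| 4.
    by apply: (big_ind (fun s => s <=| 4)) => // [|a b]; [apply: vle0|exact: vle_add].
  rewrite sumrB s0 sub0r sumr_const card_ord => n4.
  have e1 : (1 : K) = n%:R - 2 * (n./2)%:R.
    have nE : (n = 2 * n./2 + 1)%N by lia.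
    by rewrite {1}nE natrD natrM addrC addKr.
  rewrite [X in X <=| _]e1.
  apply: vle_sub; last by exists (n./2)%:R; [apply: Vnat|rewrite mulrC].
  rewrite -[n%:R]opprK; apply: vle_oppl; apply: vle_trans n4 _.
  by exists 2; [apply: Vnat|].
have nE : n = (n./2).*2 by rewrite -{1}(odd_double_half n) (negPf en).
have h0 : (0 < n./2)%N by rewrite nE double_gt0 in n0.
apply: (IH n./2) => //; first by rewrite nE -addnn in nN; lia.
have : z ^+ n./2 ^+ 2 = 1 by rewrite -exprM muln2 -nE.
move/eqP; rewrite sqrf_eq1 => /orP[/eqP//|/eqP e].
have := pow n./2; rewrite e => h; case: not_1le2.
apply: (vle_cancel (_ : 2 != 0 :> K)); rewrite ?pnatr_eq0// mulr1 -four2.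
by rewrite (_ : 2 = - (- 1 - 1)); [apply: vle_oppl|ring].
Qed.

(** As z^2 - 1 = (z - 1)(z - 1 + 2), the square is 1 modulo 4. *)
Lemma unity_mod2 z n : (0 < n)%N -> z ^+ n = 1 -> z - 1 <=| 2 -> z = 1 \/ z = -1.
Proof.
move=> n0 zn z2; have : z ^+ 2 = 1.
  apply: (@unity_mod4 _ n) => //; first by rewrite exprAC zn expr1n.
  have -> : 4 = 2 * 2 :> K by rewrite -natrM.
  rewrite (_ : _ - 1 = (z - 1) * (z - 1 + 2)); last by ring.
  by apply: vle_mul => //; apply: vle_add => //; apply: vle_refl.
by move/eqP; rewrite sqrf_eq1 => /orP[]/eqP; [left|right].
Qed.

(** * Duplication for a root of unity [lam] other than 1 *)

Section Dynamics.
Variables (lam : K) (n : nat).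
Hypotheses (n0 : (0 < n)%N) (lamn : lam ^+ n = 1) (lam1 : lam != 1).

Local Notation f := (xdouble lam).
Let D u := u * (u - 1) * (u - lam).

Let Vl : V lam. Proof. exact: (@unity_V _ n). Qed.
Let l1 : 1 <=| lam. Proof. exact: (@unity_le1 _ n). Qed.
Let n2 : 2 != 0 :> K. Proof. by rewrite pnatr_eq0. Qed.
Let n4 : 4 != 0 :> K. Proof. by rewrite pnatr_eq0. Qed.
Let four2 : 4 = 2 * 2 :> K. Proof. by rewrite -natrM. Qed.
(** If |1 - lam| <= |2|, then [unity_mod2] leaves only [lam = -1], where equality holds. *)
Let l2 : 2 <=| 1 - lam.
Proof.
case: (vle_total 2 (1 - lam)) => // h.
have [|l|->] := @unity_mod2 lam n n0 lamn.
- by rewrite -opprB; apply: vle_oppl.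
- by move: lam1; rewrite l eqxx.
- by rewrite opprK; apply: vle_refl.
Qed.
Let l10 : 1 - lam != 0. Proof. by rewrite subr_eq0 eq_sym. Qed.

Lemma xdouble_Some u u' : f (Some u) = Some u' ->
  D u != 0 /\ 4 * u' * D u = (u ^+ 2 - lam) ^+ 2.
Proof.
rewrite /=; case: ifPn => // Du [<-]; split => //.
move: Du; rewrite -/(D u) => Du; by field.
Qed.

(** For |x| > 1 one has |x^2 - lam| = |x|^2 and |D(x)| <= |x|^3, so the image has absolute value at
    least |x| / |4|. *)
Lemma escape x : ~ (x <=| 1) ->
  exists2 x', f (Some x) = Some x' & ~ (x' <=| x).
Proof.
move=> x1; have Vx : ~ V x by move=> /vle1.
have x0 : x != 0 by apply/eqP => h; apply: Vx; rewrite h; apply: V0.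
have Dx : D x != 0.
  rewrite !mulf_eq0 !subr_eq0 !negb_or; apply/andP; split; first (apply/andP; split => //).
    by apply/eqP => h; apply: Vx; rewrite h; apply: V1.
  by apply/eqP => h; apply: Vx; rewrite h.
have /= [x' fx] : exists x', f (Some x) = Some x'.
  by rewrite /= -/(D x) (negPf Dx); eexists.
exists x' => // xx; have [_ e] := xdouble_Some fx.
have x1' : 1 <=| x by case: (vle_total 1 x).
have xn : ~ (x ^+ 2 <=| lam).
  move=> h; apply: x1; apply: vle_sqr; rewrite expr1n; apply: vle_trans h _.
  exact/vle1.
have h1 : x ^+ 2 <=| x ^+ 2 - lam.
  rewrite addrC; apply: dominant => h; apply: xn; apply: vle_trans h _.
  by apply: vle_oppl; apply: vle_refl.
have h2 : (x ^+ 2) ^+ 2 <=| 2 * ((x ^+ 2) ^+ 2).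
  apply: vle_trans (vle_exp 2 h1) _; rewrite -e.
  have -> : 2 * x ^+ 2 ^+ 2 = (2 * x) * (x * x * x) by ring.
  apply: vle_mul.
    by rewrite four2 -mulrA; apply: vle_mull; apply: vle_trans (vle_mulV _ (Vnat 2)) _.
  apply: vle_mul; [apply: vle_mul|].
  - exact: vle_refl.
  - by apply: vle_sub => //; apply: vle_refl.
  - apply: vle_sub; first exact: vle_refl.
    by apply: vle_trans x1'; apply/vle1.
by apply: not_le_mul2 h2; rewrite !expf_neq0.
Qed.

(** Everything follows from (u^2 - lam)^2 = 4 u' D(u). It gives |u^2 - lam| <= |2| < 1, hence |u| =
    1. If |u - 1| < |1 - lam|, then |u^2 - lam| = |1 - lam| and |u - lam| <= |1 - lam|, whence |1 -
    lam| <= |4| |u - 1|, a contradiction; the case of u - lam is symmetric. *)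
Lemma integral_unit u u' : u <=| 1 -> u' <=| 1 -> f (Some u) = Some u' ->
  [/\ u ^+ 2 - lam <=| 2, 1 <=| u, 1 - lam <=| u - 1 & 1 - lam <=| u - lam].
Proof.
move=> u1 u'1 /xdouble_Some[Du e].
have e' : (u ^+ 2 - lam) ^+ 2 <=| 4 * (u - 1) * (u - lam).
  rewrite -e (_ : 4 * u' * D u = (u' * u) * (4 * (u - 1) * (u - lam))).
    by apply: vle_mulV; apply: VM; apply/vle1.
  by rewrite /D; ring.
have Vu := (iffLR (vle1 _)) u1.
have V1l : V (u - 1) by apply: VB => //; apply: V1.
have Vul : V (u - lam) by apply: VB.
have h2 : u ^+ 2 - lam <=| 2.
  apply: vle_sqr; apply: vle_trans e' _; rewrite -mulrA mulrC.
  by rewrite four2 -expr2; apply: vle_mulV; apply: VM.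
split=> //.
- case: h2 => t Vt et; have /vle_sqr : 1 ^+ 2 <=| u ^+ 2 by
    rewrite expr1n -[u ^+ 2](subrK lam) et; apply: vle_trans l1 _; apply: dominant;
    move=> h; apply: not_1le2; apply: vle_trans l1 _; apply: vle_trans h _; apply: vle_mulV.
  by [].
- have [//|h] := vle_total (1 - lam) (u - 1).
  apply: contrapT => nh.
  have nz : u - 1 != 0.
    by apply: contraNneq Du => h0; rewrite /D h0 mulr0 mul0r.
  have a1 : 1 - lam <=| u ^+ 2 - lam.
    rewrite (_ : _ ^+ 2 - _ = (u - 1) * (u + 1) + (1 - lam)); last by ring.
    apply: dominant => h'; apply: nh; apply: vle_trans h' _.
    by rewrite mulrC; apply: vle_mulV; apply: VD => //; apply: V1.
  have a2 : u - lam <=| 1 - lam.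
    rewrite (_ : u - lam = (u - 1) + (1 - lam)); last by ring.
    by apply: vle_add => //; apply: vle_refl.
  have : (1 - lam) * (1 - lam) <=| (1 - lam) * (4 * (u - 1)).
    rewrite -expr2; apply: vle_trans (vle_exp 2 a1) _; apply: vle_trans e' _.
    by rewrite mulrC; apply: vle_mul => //; apply: vle_refl.
  move/(vle_cancel l10) => h4; apply: nh; apply: vle_trans h4 _.
  exact: vle_mulV (Vnat 4).
- have [//|h] := vle_total (1 - lam) (u - lam).
  apply: contrapT => nh.
  have a1 : 1 - lam <=| u ^+ 2 - lam.
    rewrite (_ : _ ^+ 2 - _ = (u - lam) * (u + lam) + lam * (lam - 1)); last by ring.
    have a0 : 1 - lam <=| lam * (lam - 1).
      rewrite -{1}[1 - lam]mul1r; apply: vle_mul => //.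
      by rewrite -opprB; apply: vle_oppl; apply: vle_refl.
    apply: (vle_trans a0); apply: dominant => h'; apply: nh.
    apply: vle_trans a0 _; apply: vle_trans h' _.
    by rewrite mulrC; apply: vle_mulV; apply: VD.
  have a2 : u - 1 <=| 1 - lam.
    rewrite (_ : u - 1 = (u - lam) - (1 - lam)); last by ring.
    by apply: vle_sub => //; apply: vle_refl.
  have : (1 - lam) * (1 - lam) <=| (1 - lam) * (4 * (u - lam)).
    rewrite -expr2; apply: vle_trans (vle_exp 2 a1) _; apply: vle_trans e' _.
    rewrite (_ : 4 * (u - 1) * (u - lam) = (u - 1) * (4 * (u - lam))); last by ring.
    by apply: vle_mul => //; apply: vle_refl.
  move/(vle_cancel l10) => h4; apply: nh; apply: vle_trans h4 _.
  exact: vle_mulV (Vnat 4).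
Qed.

Definition veq a b := a <=| b /\ b <=| a.

Lemma veq_trans b a c : veq a b -> veq b c -> veq a c.
Proof. by move=> [h1 h2] [h3 h4]; split; [exact: vle_trans h3|exact: vle_trans h2]. Qed.
Lemma veq_mul a b c d : veq a b -> veq c d -> veq (a * c) (b * d).
Proof. by move=> [h1 h2] [h3 h4]; split; apply: vle_mul. Qed.
Lemma veq_refl a : veq a a. Proof. by split; apply: vle_refl. Qed.
Lemma veq_sym a b : veq a b -> veq b a. Proof. by case. Qed.
Lemma veq_cancel c a b : c != 0 -> veq (c * a) (c * b) -> veq a b.
Proof. by move=> c0 [h1 h2]; split; apply: (vle_cancel c0). Qed.

Lemma veq_perturb a b : ~ (a <=| b) -> veq (a - b) a.
Proof.
move=> h; split.
  by apply: vle_sub; [exact: vle_refl|case: (vle_total a b)].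
rewrite addrC; apply: dominant => h'; apply: h; apply: vle_trans h' _.
by apply: vle_oppl; apply: vle_refl.
Qed.

(* The doubling map contracts: with D(x) = x(x-1)(x-lam), the quantity
   |u - v|^2 / |D(u)| is multiplied by |4|. *)
Lemma contract u v u' v' : f (Some u) = Some u' -> f (Some v) = Some v' ->
  u <=| 1 -> v <=| 1 -> 1 <=| u -> 1 <=| v -> 1 <=| u' -> u' <=| 1 ->
  2 <=| u - 1 -> 2 <=| u - lam ->
  2 <=| u' - 1 -> 2 <=| u' - lam -> u - v <=| 16 -> u != v ->
  u' != v' /\ veq ((u' - v') ^+ 2 * D u) (4 * (u - v) ^+ 2 * D u').
Proof.
move=> /xdouble_Some[Du eu] /xdouble_Some[Dv ev] u1 v1 u1' v1' u'1' u'1 h1 hl h1' hl' uv16 uv.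
have Vu := (iffLR (vle1 _)) u1; have Vv := (iffLR (vle1 _)) v1.
(* Adding a point of order two permutes the fibres of duplication, so each of u', u' - 1 and u' -
   lam is a square over 4 D(u). *)
have e1 : (u ^+ 2 - 2 * u + lam) ^+ 2 = 4 * (u' - 1) * D u.
  by rewrite mulrBr mulrBl eu /D; ring.
have e2 : (u ^+ 2 - 2 * lam * u + lam) ^+ 2 = 4 * (u' - lam) * D u.
  by rewrite mulrBr mulrBl eu /D; ring.
have D4 : 2 ^+ 2 <=| D u.
  rewrite expr2 -[2 * 2]mul1r /D -mulrA.
  by apply: vle_mul => //; apply: vle_mul.
have p32 : 2 ^+ 4 <=| 4 * D u.
  by rewrite (_ : 2 ^+ 4 = 4 * 2 ^+ 2); [exact: vle_mull|ring].
have F0 : 2 ^+ 3 <=| u ^+ 2 - lam.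
  apply: vle_sqr; rewrite -eu mulrAC.
  apply: (@vle_trans (2 ^+ 4)).
    by rewrite (_ : (2 ^+ 3) ^+ 2 = 4 * 2 ^+ 4); [apply: vle_mulV (Vnat 4)|ring].
  by rewrite -[2 ^+ 4]mulr1; apply: vle_mul.
have F1 : 2 ^+ 3 <=| u ^+ 2 - 2 * u + lam.
  apply: vle_sqr; rewrite e1 mulrAC.
  apply: (@vle_trans (2 ^+ 4 * 2)).
    by rewrite (_ : (2 ^+ 3) ^+ 2 = 2 * (2 ^+ 4 * 2)); [apply: vle_mulV (Vnat 2)|ring].
  by apply: vle_mul.
have F2 : 2 ^+ 3 <=| u ^+ 2 - 2 * lam * u + lam.
  apply: vle_sqr; rewrite e2 mulrAC.
  apply: (@vle_trans (2 ^+ 4 * 2)).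
    by rewrite (_ : (2 ^+ 3) ^+ 2 = 2 * (2 ^+ 4 * 2)); [apply: vle_mulV (Vnat 2)|ring].
  by apply: vle_mul.
(* The quadratics have absolute value at least |8|, which exceeds |16|; replacing one factor u by v
   therefore does not change it. *)
have small a b c : 2 ^+ 3 <=| a -> c <=| u - v -> b = a - c -> veq b a.
  move=> ha hc ->; apply: veq_perturb => hac.
  have := vle_trans (vle_trans (vle_trans ha hac) hc) uv16.
  by rewrite (_ : 16 = 2 * 2 ^+ 3); [apply: not_le_mul2; rewrite expf_neq0|ring].
have G0 : veq (u * v - lam) (u ^+ 2 - lam).
  apply: (small _ _ (u * (u - v))) => //; [exact: vle_mulV|ring].
have G1 : veq (u * v - u - v + lam) (u ^+ 2 - 2 * u + lam).
  apply: (small _ _ ((u - 1) * (u - v))) => //; last by ring.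
  by apply: vle_mulV; apply: VB => //; apply: V1.
have G2 : veq (u * v - lam * u - lam * v + lam) (u ^+ 2 - 2 * lam * u + lam).
  apply: (small _ _ ((u - lam) * (u - v))) => //; last by ring.
  by apply: vle_mulV; apply: VB.
have small' a b : 2 <=| a -> b = a - (u - v) -> veq b a.
  move=> ha ->; apply: veq_perturb => hac.
  have := vle_trans (vle_trans ha hac) uv16.
  move=> h; apply: not_1le2; apply: (vle_cancel n2); rewrite mulr1.
  by apply: vle_trans h _; rewrite (_ : 16 = 4 * (2 * 2)); [apply: vle_mulV (Vnat 4)|ring].
have Dveq : veq (D v) (D u).
  apply: veq_mul; [apply: veq_mul|].
  - by split; [exact: vle_trans v1 u1'|exact: vle_trans u1 v1'].
  - by apply: small' => //; ring.
  - by apply: small' => //; ring.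
(* The three bilinear factors are the polarisations of the quadratics in [eu], [e1] and [e2]. *)
have key : 4 * (u' - v') * (D u * D v) =
   (u - v) * ((u * v - lam) * ((u * v - u - v + lam) * (u * v - lam * u - lam * v + lam))).
  have -> : 4 * (u' - v') * (D u * D v) = (4 * u' * D u) * D v - (4 * v' * D v) * D u by ring.
  by rewrite eu ev /D; ring.
(* After squaring, the polarisations become the squared quadratics, whose product is 64 D(u)^3
   D(u'). *)
have key2 : veq (16 * (u' - v') ^+ 2 * D u ^+ 2 * D u ^+ 2) (64 * (u - v) ^+ 2 * D u ^+ 3 * D u').
  have k1 : veq (16 * (u' - v') ^+ 2 * D u ^+ 2 * D u ^+ 2)
      (16 * (u' - v') ^+ 2 * D u ^+ 2 * D v ^+ 2).
    by apply: veq_mul (veq_refl _) _; apply/veq_sym; rewrite !expr2; apply: veq_mul.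
  apply: veq_trans k1 _.
  rewrite (_ : 16 * _ * _ * _ = (4 * (u' - v') * (D u * D v)) ^+ 2); last by ring.
  rewrite key.
  rewrite (_ : 64 * _ * _ * _ = (u - v) ^+ 2 * ((4 * u' * D u) * ((4 * (u' - 1) * D u) * (4 * (u' - lam) * D u)))); last by rewrite /D; ring.
  rewrite eu -e1 -e2 -!exprMn !expr2.
  by apply: veq_mul; apply: veq_mul (veq_refl _) _; apply: veq_mul => //; apply: veq_mul.
have key3 : veq ((u' - v') ^+ 2 * D u) (4 * (u - v) ^+ 2 * D u').
  apply: (@veq_cancel (16 * D u ^+ 3)).
    by rewrite mulf_neq0 ?expf_neq0// pnatr_eq0.
  rewrite (_ : 16 * D u ^+ 3 * ((u' - v') ^+ 2 * D u) = 16 * (u' - v') ^+ 2 * D u ^+ 2 * D u ^+ 2); last by ring.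
  by rewrite (_ : 16 * D u ^+ 3 * (4 * (u - v) ^+ 2 * D u') = 64 * (u - v) ^+ 2 * D u ^+ 3 * D u') //; ring.
split=> //; apply/eqP => uv'; move: key3; rewrite uv' subrr expr0n mul0r => -[_ /vle_eq0/eqP].
have nz a : 2 <=| a -> a != 0.
  by move=> h; apply/eqP => a0; case: (negP n2); move: h; rewrite a0 => /vle_eq0 ->.
have u'0 : u' != 0.
  by apply/eqP => h; move: u'1'; rewrite h => /vle_eq0/eqP; rewrite oner_eq0.
have [nz1 nzl] := (nz _ h1', nz _ hl').
have uv0 : u - v != 0 by rewrite subr_eq0.
by rewrite -uv'; apply/negP; rewrite /D !(mulf_neq0, expf_neq0).
Qed.

(** * Preperiodic orbits are integral and separated *)

Section Orbit.
Variable a : K.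
Hypothesis per : preperiodic lam a.
Let o i := iter i f (Some a).

(** From an abscissa that is not integral, [escape] makes absolute values increase strictly for
    ever, so nothing repeats. *)
Lemma orbit_le1 i x : o i = Some x -> x <=| 1.
Proof.
move=> oi; apply: contrapT => nx.
have run m : exists2 y, o (i + m) = Some y &
    ~ (y <=| 1) /\ forall y', o (i + m).+1 = Some y' -> ~ (y' <=| y).
  elim: m => [|m [y oy [y1 _]]].
    rewrite addn0; exists x => //; split=> // y'.
    by rewrite /o /= -/(o i) oi; case: (escape nx) => z -> nz [<-].
  have [z fz nz] := escape y1.
  have z1 : ~ (z <=| 1).
    by move=> h; apply: nz; apply: vle_trans h _; case: (vle_total 1 y) => // /y1.
  exists z; first by rewrite addnS /o /= -/(o _) oy.
  split=> // y'; rewrite addnS /o /= -/(o _) oy fz.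
  by have [w -> nw] := escape z1; move=> [<-].
have incr m p y z : o (i + m) = Some y -> o (i + (m + p).+1) = Some z -> ~ (z <=| y).
  move=> oy; elim: p z => [|p IH] z oz.
    have [y' + [_ H]] := run m; rewrite oy => -[e]; subst y'.
    by apply: H; rewrite -oz; congr o; lia.
  have [w ow [_ H]] := run (m + p).+1.
  have nzw : ~ (z <=| w) by apply: H; rewrite -oz; congr o; lia.
  move=> zy; apply: nzw; apply: vle_trans zy _.
  by case: (vle_total y w) => // /(IH _ ow).
have [p [q [pq e]]] := per.
have e' : o (i + p) = o (i + q) by rewrite /o !iterD e.
have [y oy [y1 _]] := run p.
apply: (incr p (q - p).-1 y y oy); last exact: vle_refl.
by rewrite -oy e'; congr o; lia.
Qed.

Lemma orbit_unit i x x' : o i = Some x -> o i.+1 = Some x' ->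
  [/\ x ^+ 2 - lam <=| 2, 1 <=| x, 2 <=| x - 1 & 2 <=| x - lam].
Proof.
move=> oi oi'; have x1 := orbit_le1 oi; have x1' := orbit_le1 oi'.
have [] := @integral_unit x x' x1 x1'; first by rewrite -oi' /o /= -/(o i) oi.
by move=> h1 h2 h3 h4; split=> //; apply: vle_trans l2 _.
Qed.

Lemma orbit_None i j : (i <= j)%N -> o i = None -> o j = None.
Proof.
by move=> ij oi; rewrite -(subnKC ij) addnC /o iterD -/(o i) oi; elim: (_ - _)%N => //= k ->.
Qed.

(** Suppose u and v differ; then [contract] applies at every finite step. If the later orbit reaches
    infinity, it first meets 0, 1 or [lam], from which [orbit_unit] keeps the earlier orbit away.
    Otherwise the pair recurs after a period, and its separation is both unchanged and multiplied by
    a positive power of |4|. *)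
Lemma orbit_close i j u v : (i < j)%N -> o i = Some u -> o j = Some v ->
  u - v <=| 32 -> u = v.
Proof.
move=> ij oi oj uv; apply/eqP; apply: contrapT => /negP neq.
(* Since i < j, the earlier orbit stays finite for one more step, as [orbit_unit] requires. *)
have fin k y : o (j + k) = Some y -> exists x, o (i + k).+1 = Some x.
  case E : (o (i + k).+1) => [x|]; first by exists x.
  by rewrite (@orbit_None _ (j + k) _ E)//; lia.
have [u1 ou1] : exists x, o i.+1 = Some x.
  by have := @fin 0 v; rewrite !addn0; apply.
have [_ hu1 hu2 hu3] := orbit_unit oi ou1.
have D4 : 2 ^+ 2 <=| D u.
  rewrite expr2 -[2 * 2]mul1r /D -mulrA.
  by apply: vle_mul => //; apply: vle_mul.
have Du : D u != 0.
  apply/eqP => h; move: D4; rewrite h => /vle_eq0/eqP.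
  by rewrite expf_eq0 (negPf n2).
(* This is the origin of 32: |D(u)| >= |4| and |D(x)| <= 1 give |x - y|^2 <= |32|^2 / |4| = |16|^2,
   which is what [contract] needs at every step. *)
have close16 k x y : x <=| 1 ->
    (x - y) ^+ 2 * D u <=| 4 ^+ k * (u - v) ^+ 2 * D x -> x - y <=| 16.
  move=> x1 xy; have Vx : V x by apply/vle1.
  have Dx : D x <=| 1.
    by apply/vle1; apply: VM; [apply: VM => //; apply: VB => //; apply: V1|apply: VB].
  apply: vle_sqr; apply: (@vle_cancel (2 ^+ 2)); first by rewrite expf_neq0.
  rewrite [in X in X <=| _]mulrC.
  apply: vle_trans (vle_mull _ D4) _; apply: vle_trans xy _.
  rewrite (_ : 2 ^+ 2 * 16 ^+ 2 = 32 ^+ 2 * 1); last by ring.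
  apply: vle_mul => //; rewrite -[32 ^+ 2]mul1r; apply: vle_mul; last exact: vle_exp.
  by apply/vle1; rewrite -natrX; apply: Vnat.
have run k y : o (j + k) = Some y -> exists2 x, o (i + k) = Some x &
   x != y /\ veq ((x - y) ^+ 2 * D u) (4 ^+ k * (u - v) ^+ 2 * D x).
  elim: k y => [|k IH] y oy.
    move: oy; rewrite !addn0 oj => -[<-]; exists u => //; split=> //.
    by rewrite expr0 mul1r; apply: veq_refl.
  have [x' ox'] := fin _ _ oy.
  rewrite !addnS in oy ox' *.
  case oz : (o (j + k)) => [z|]; last by rewrite (@orbit_None (j + k) (j + k).+1) in oy.
  have [x ox [xz xzv]] := IH _ oz.
  have [w ow] : exists w, o (i + k).+1 = Some w.
    case E : (o (i + k).+1) => [w|]; first by exists w.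
    by rewrite (orbit_None _ E) in ox'.
  have [_ x1 x2 x3] := orbit_unit ox ow.
  have [_ w1 w2 w3] := orbit_unit ow ox'.
  have [_ z1 _ _] := orbit_unit oz oy.
  have fx : f (Some x) = Some w by rewrite -ow /o /= -/(o _) ox.
  have fz : f (Some z) = Some y by rewrite -oy /o /= -/(o _) oz.
  have xz16 := close16 _ _ _ (orbit_le1 ox) (proj1 xzv).
  have [wy kv] := contract fx fz (orbit_le1 ox) (orbit_le1 oz) x1 z1 w1 (orbit_le1 ow) x2 x3 w2 w3 xz16 xz.
  exists w => //; split=> //.
  have Dx0 : D x != 0 by case: (xdouble_Some fx).
  apply: (veq_cancel Dx0).
  rewrite (_ : D x * _ = ((w - y) ^+ 2 * D x) * D u); last by ring.
  apply: veq_trans (veq_mul kv (veq_refl _)) _.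
  rewrite (_ : 4 * _ * _ * _ = (4 * D w) * ((x - z) ^+ 2 * D u)); last by ring.
  apply: veq_trans (veq_mul (veq_refl _) xzv) _.
  by rewrite [4 ^+ k.+1]exprS (_ : 4 * D w * (4 ^+ k * (u - v) ^+ 2 * D x) = D x * (4 * 4 ^+ k * (u - v) ^+ 2 * D w)); [apply: veq_refl|ring].
have [[m om]|noN] := pselect (exists m, o (j + m) = None).
  have ex : exists m, o (j + m) == None by exists m; rewrite om.
  case: (ex_minnP ex) => -[|k] /eqP ok kmin; first by rewrite addn0 oj in ok.
  case oz : (o (j + k)) => [z|]; last by have := kmin k; rewrite oz ltnn => /(_ isT).
  have [x ox [xz xzv]] := run _ _ oz.
  have [w ow] := fin _ _ oz.
  have [_ x1 x2 x3] := orbit_unit ox ow.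
  have Vz := orbit_le1 oz.
  have x16 := close16 _ _ _ (orbit_le1 ox) (proj1 xzv).
  have big : ~ (2 <=| 16).
    move=> h; apply: not_1le2; apply: (vle_cancel n2); rewrite mulr1.
    by apply: vle_trans h _; rewrite (_ : 16 = 4 * (2 * 2)); [apply: vle_mulV (Vnat 4)|ring].
  move: ok; rewrite addnS /o /= -/(o _) oz /=; case: ifP => // /eqP/eqP + _.
  rewrite !mulf_eq0 !subr_eq0 => /orP[/orP[]|] /eqP ez; subst z.
  - apply: big; apply: vle_trans x16; rewrite subr0; apply: vle_trans x1.
    by apply/vle1; apply: Vnat.
  - by apply: big; apply: vle_trans x16.
  - by apply: big; apply: vle_trans x16.
have fino m : exists y, o (j + m) = Some y.
  by case E : (o (j + m)) => [y|]; [exists y|case: noN; exists m].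
have [p [q [pq e]]] := per.
have sh k : o (k + p) = o (k + q) by rewrite /o !iterD e.
have [y oy] := fino p.
have [x ox [xy xyv]] := run _ _ oy.
have := oy; rewrite sh => /run[x']; rewrite -sh ox => -[<-] [_ xyv'].
have [w ow] := fin _ _ oy; have fx : f (Some x) = Some w by rewrite -ow /o /= -/(o _) ox.
have [Dx _] := xdouble_Some fx.
have [_] := veq_trans (veq_sym xyv') xyv.
have : (u - v) ^+ 2 * D x != 0 by rewrite mulf_neq0 ?expf_neq0// subr_eq0.
rewrite -!mulrA; move: (_ * D x) => X X0.
rewrite -(subnKC (ltnW pq)) exprD -!mulrA => /vle_cancel => /(_ (expf_neq0 _ n4)).
have -> : (q - p = (q - p).-1.+1)%N by rewrite prednK ?subn_gt0.
rewrite exprS {1}four2 -!mulrA => h; apply: (not_le_mul2 X0).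
apply: vle_trans h _; apply: vle_mull; rewrite mulrA; apply: vle_mulV.
by apply: VM; [apply: Vnat|rewrite -natrX; apply: Vnat].
Qed.
End Orbit.
End Dynamics.
End Valuation.

(** * Bounds for orbits and orders *)

Section Pigeonhole.
Variables (K : numFieldType) (V : set K).
Hypotheses (hV : no_half_subring V) (Vtotal : forall x, V x \/ V x^-1).
Local Notation "a <=| b" := (vle V a b) (at level 70, no associativity).

Definition rat_span (J : finType) (e : J -> K) (x : K) :=
  exists c : J -> rat, x = \sum_j ratr (c j) * e j.

Lemma V_sum (I : finType) (f : I -> K) : (forall i, V (f i)) -> V (\sum_i f i).
Proof. by move=> Vf; apply: big_ind => //; [exact: V0|exact: VD]. Qed.

(* Smith normal form: the Z-module spanned by the x_i is generated by at most
   d elements w_k which are integral combinations of the x_i. *)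
Lemma integral_generators (d n : nat) (e : 'I_d -> K) (x : 'I_n -> K) :
  (forall i, rat_span e (x i)) -> (forall i, V (x i)) ->
  exists (L : 'M[int]_n) (w : 'I_n -> K),
    [/\ forall i, x i = \sum_k (L i k)%:~R * w k, forall k, V (w k) &
        forall k : 'I_n, (d <= k)%N -> w k = 0].
Proof.
move=> /choice[c xE] Vx.
pose den := \prod_i \prod_j denq (c i j).
have den0 : den != 0.
  by apply/prodf_neq0 => i _; apply/prodf_neq0 => j _; rewrite denq_neq0.
have /choice[M ME] i : exists m : 'I_d -> int, forall j, c i j = (m j)%:~R / den%:~R.
  have H j : exists m : int, c i j = m%:~R / den%:~R.
    exists (numq (c i j) * ((\prod_(i' | i' != i) \prod_j denq (c i' j)) * \prod_(j' | j' != j) denq (c i j'))).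
    have -> : den = denq (c i j) * (\prod_(j' | j' != j) denq (c i j')) * (\prod_(i' | i' != i) \prod_j denq (c i' j)).
      by rewrite /den (bigD1 i)//=; congr (_ * _); rewrite (bigD1 j).
    rewrite !rmorphM /=.
    rewrite -[LHS]divq_num_den.
    set P1 := (\prod_(_ | _ != i) _)%:~R; set P2 := (\prod_(_ | _ != j) _)%:~R.
    have P10 : P1 != 0 :> rat.
      rewrite intr_eq0; apply/prodf_neq0 => i' _; apply/prodf_neq0 => j' _; exact: denq_neq0.
    have P20 : P2 != 0 :> rat by rewrite intr_eq0; apply/prodf_neq0 => j' _; exact: denq_neq0.
    by field; rewrite P10 P20 intr_eq0 denq_neq0.
  by have /choice[m mE] := H; exists m.
have [L Lu [R Ru [s _ ME']]] := int_Smith_normal_form (\matrix_(i, j) M i j).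
set S := (\matrix_(i, j) (s`_i *+ _)) in ME'.
pose ev : 'cV[K]_d := \col_j e j; pose xv : 'cV[K]_n := \col_i x i.
pose W : 'cV[K]_n := den%:~R^-1 *: (map_mx intr (S *m R) *m ev).
have xW : xv = map_mx intr L *m W.
  rewrite /W -scalemxAr mulmxA -map_mxM /= mulmxA -ME'.
  apply/colP => i; rewrite !mxE xE mulr_sumr; apply: eq_bigr => j _.
  rewrite !mxE ME. by rewrite fmorph_div /= !ratr_int mulrAC mulrC.
have WE : W = map_mx intr (invmx L) *m xv.
  by rewrite xW mulmxA -map_mxM /= mulVmx// map_mx1 mul1mx.
exists L, (fun k => W k 0); split.
- move=> i; have -> : x i = xv i 0 by rewrite mxE.
  by rewrite xW mxE; apply: eq_bigr => k _; rewrite mxE.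
- move=> k; rewrite WE mxE; apply: V_sum => i; rewrite !mxE.
  by apply: VM => //; apply: Vint.
- move=> k dk; rewrite /W mxE mxE big1 ?mulr0// => j _.
  rewrite mxE [X in X%:~R]mxE big1 ?mul0r// => i _.
  by rewrite mxE (_ : (_ == _) = false) ?mulr0n ?mul0r//; apply/negP => /eqP h; move: dk; rewrite h leqNgt ltn_ord.
Qed.

(** The lattice spanned by the finitely many points is generated by at most [#|J|] elements of [V],
    and points whose coordinates agree modulo m are congruent modulo m in [V]. *)
Lemma pigeonhole_span (J : finType) (e : J -> K) (m : nat) (x : nat -> K) :
  (0 < m)%N ->
  (forall i, (i <= m ^ #|J|)%N -> rat_span e (x i)) ->
  (forall i, (i <= m ^ #|J|)%N -> V (x i)) ->
  exists i j : nat, [/\ (i < j)%N, (j <= m ^ #|J|)%N & x i - x j <=| m%:R].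
Proof.
case: m => // m _ xe Vx; set n := (m.+1 ^ #|J|).+1.
have [||L [w [xL Vw w0]]] := @integral_generators #|J| n (e \o enum_val) (fun i => x i).
- move=> i; have [|c ->] := xe i; first by rewrite -ltnS.
  exists (c \o enum_val); rewrite (reindex (@enum_val J predT))//=.
  by exists enum_rank => j _; [exact: enum_valK|exact: enum_rankK].
- by move=> i; apply: Vx; rewrite -ltnS.
(* The default 0 serves indices k beyond the number of points, for which there is no generator. *)
pose col (i : 'I_n) : {ffun 'I_#|J| -> 'I_m.+1} := [ffun k : 'I_#|J| =>
  inord `|if insub (k : nat) is Some k' then (L i k' %% m.+1)%Z else 0|%N].
have /injectivePn[i [j nij ij]] : ~~ injectiveb col.
  by apply/negP => /injectiveP/leq_card; rewrite card_ffun !card_ord ltnn.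
have close : x i - x j <=| m.+1%:R.
  rewrite !xL -sumrB; apply: (big_ind (fun s => s <=| _)) => [|a b|k _].
  - exact: vle0.
  - exact: vle_add.
  have [kd|kd] := ltnP k #|J|; last by rewrite w0// !mulr0 subr0; apply: vle0.
  have /ffunP/(_ (Ordinal kd)) := ij; rewrite !ffunE /=.
  rewrite insubT //= .
  move=> kn; have -> : Sub (k : nat) kn = k by apply: val_inj.
  have m0 (z : int) : (0 <= (z %% m.+1)%Z)%R by rewrite modz_ge0.
  have lm (z : int) : (`|(z %% m.+1)%Z| < m.+1)%N.
    by rewrite -ltz_nat gez0_abs// ltz_mod.
  move/(congr1 val); rewrite /= !inordK// => /(congr1 Posz).
  rewrite !gez0_abs// => /eqP; rewrite eqz_mod_dvd => /dvdzP[q e'].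
  rewrite -mulrBl -rmorphB /= e' rmorphM /= mulrAC.
  by apply: vle_mulV; apply: VM => //; apply: Vint.
case: (ltngtP i j) => h; last by rewrite (val_inj h) eqxx in nij.
  by exists i, j; split => //; rewrite -ltnS.
exists j, i; split => //; first by rewrite -ltnS.
by rewrite -opprB; apply: vle_oppl.
Qed.
End Pigeonhole.

(** Once powers of X are removed, P = Q X + c with c nonzero, and the inverse is -Q(x) / c. This
    makes the span of monomials below closed under inversion. *)
Lemma algebraic_inv_poly (K : numFieldType) (x : K) (P : {poly rat}) :
  P != 0 -> root (map_poly ratr P) x -> x != 0 ->
  exists Q : {poly rat}, x^-1 = (map_poly ratr Q).[x].
Proof.
have [N] := ubnP (size P); elim: N P => // N IH P sP P0 rP x0.
have : P = (P - (P`_0)%:P) + (P`_0)%:P by rewrite subrK.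
have /eqP : (P - (P`_0)%:P).[0] = 0 by rewrite !hornerE horner_coef0 subrr.
move/factor_theorem => [Q ->]; rewrite subr0 => PE.
have rE : (map_poly ratr Q).[x] * x + ratr P`_0 = 0 :> K.
  move: rP; rewrite {1}PE rmorphD rmorphM /= map_polyX map_polyC /= /root !hornerE.
  by move/eqP.
have [P00|P00] := eqVneq P`_0 0.
  apply: (IH Q) => //.
  - move: sP; rewrite PE P00 addr0 size_mulX ?ltnS//.
    by apply: contraNneq P0 => Q0; rewrite PE Q0 P00 mul0r addr0.
  - by apply: contraNneq P0 => Q0; rewrite PE Q0 P00 mul0r addr0.
  - by move/eqP: rE; rewrite P00 rmorph0 addr0 mulf_eq0 (negPf x0) orbF.
exists (- (P`_0)^-1 *: Q); rewrite map_polyZ /= hornerZ.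
have c0 : ratr P`_0 != 0 :> K by rewrite fmorph_eq0.
apply: (mulIf x0); rewrite mulVf// -mulrA.
have -> : (map_poly ratr Q).[x] * x = - ratr P`_0 by apply/eqP; rewrite -addr_eq0 rE.
by rewrite rmorphN fmorphV /= mulrNN mulVf.
Qed.

(** * The field generated by [a] and [lam], and the length of the orbit *)

Section Field.
Variables (K : numFieldType) (a lam : K) (p : {poly rat}) (N : nat).
Hypotheses (p0 : p != 0) (pa : root (map_poly ratr p) a).
Hypotheses (N0 : (0 < N)%N) (lamN : lam ^+ N = 1).
Variable D : nat.
Hypothesis pD : (size p <= D.+1)%N.

(** These D N monomials span Q(a, lam), which contains the whole orbit. Counting classes needs a
    spanning family, not a basis. *)
Let e (ij : 'I_D * 'I_N) : K := a ^+ ij.1 * lam ^+ ij.2.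
Local Notation S := (rat_span e).

Lemma rat_span0 (J : finType) (f : J -> K) : rat_span f 0.
Proof. by exists (fun=> 0); rewrite big1// => j _; rewrite rmorph0 mul0r. Qed.

Lemma rat_spanD (J : finType) (f : J -> K) x y :
  rat_span f x -> rat_span f y -> rat_span f (x + y).
Proof.
move=> [c ->] [d ->]; exists (fun j => c j + d j); rewrite -big_split.
by apply: eq_bigr => j _; rewrite rmorphD mulrDl.
Qed.

Lemma rat_spanZ (J : finType) (f : J -> K) r x :
  rat_span f x -> rat_span f (ratr r * x).
Proof.
move=> [c ->]; exists (fun j => r * c j); rewrite mulr_sumr.
by apply: eq_bigr => j _; rewrite rmorphM mulrA.
Qed.

Lemma rat_span_gen (J : finType) (f : J -> K) j : rat_span f (f j).
Proof.
exists (fun j' => (j' == j)%:R); rewrite (bigD1 j)//= big1 ?addr0.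
  by rewrite eqxx rmorph1 mul1r.
by move=> i /negPf ->; rewrite rmorph0 mul0r.
Qed.

Lemma rat_span_sum (J I : finType) (f : J -> K) (g : I -> K) :
  (forall i, rat_span f (g i)) -> rat_span f (\sum_i g i).
Proof.
move=> H; apply: big_ind => //; [exact: rat_span0|exact: rat_spanD].
Qed.

Lemma pow_rat_span k : rat_span (fun i : 'I_D => a ^+ i) (a ^+ k).
Proof.
have -> : a ^+ k = (map_poly ratr ('X^k %% p)).[a].
  have := congr1 (fun q => (map_poly ratr q).[a]) (divp_eq 'X^k p).
  rewrite rmorphD rmorphM /= map_polyXn hornerXn hornerD hornerM => ->.
  by rewrite (eqP pa) mulr0 add0r.
rewrite (horner_coef_wide _ (n := D)); last first.
  by rewrite size_map_poly -ltnS (leq_trans _ pD)// ltn_modp.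
exists (fun i : 'I_D => ('X^k %% p)`_i).
by apply: eq_bigr => i _; rewrite coef_map.
Qed.

Lemma span_mon k l : S (a ^+ k * lam ^+ l).
Proof.
have -> : lam ^+ l = lam ^+ (l %% N) by rewrite {1}(divn_eq l N) exprD mulnC exprM lamN expr1n mul1r.
have [c ->] := pow_rat_span k; rewrite mulr_suml; apply: rat_span_sum => i.
rewrite -mulrA; apply: rat_spanZ.
exact: (@rat_span_gen _ e (i, Ordinal (ltn_pmod l N0))).
Qed.

Lemma spanM x y : S x -> S y -> S (x * y).
Proof.
move=> [c ->] [d ->]; rewrite mulr_suml; apply: rat_span_sum => i.
rewrite mulr_sumr; apply: rat_span_sum => j.
rewrite mulrACA; rewrite -rmorphM; apply: rat_spanZ.
rewrite /e mulrACA -!exprD; exact: span_mon.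
Qed.

Lemma span1 : S 1. Proof. by have := span_mon 0 0; rewrite !expr0 mulr1. Qed.
Lemma spana : S a. Proof. by have := span_mon 1 0; rewrite !expr0 mulr1. Qed.
Lemma spanl : S lam. Proof. by have := span_mon 0 1; rewrite !expr0 mul1r. Qed.
Lemma spanN x : S x -> S (- x).
Proof. by move=> /(rat_spanZ (-1)); rewrite rmorphN rmorph1 mulN1r. Qed.
Lemma spanB x y : S x -> S y -> S (x - y).
Proof. by move=> Sx /spanN; apply: rat_spanD. Qed.
Lemma spanX n x : S x -> S (x ^+ n).
Proof. by move=> Sx; elim: n => [|n IH]; [exact: span1|rewrite exprS; exact: spanM]. Qed.

Lemma span_algebraic x : S x -> algebraicOver (ratr : rat -> K) x.
Proof.
have aa : algebraicOver (ratr : rat -> K) a by exists p.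
have al : algebraicOver (ratr : rat -> K) lam.
  exists ('X^N - 1); first by rewrite -size_poly_gt0 size_XnsubC.
  by rewrite rmorphB /= map_polyXn rmorph1 /root !hornerE lamN subrr.
have aX y n : algebraicOver (ratr : rat -> K) y -> algebraicOver (ratr : rat -> K) (y ^+ n).
  by move=> ay; elim: n => [|n IH]; [exact: algebraic1|rewrite exprS; exact: algebraic_mul].
move=> [c ->]; apply: big_ind => [||j _]; [exact: algebraic0|exact: algebraic_add|].
apply: algebraic_mul; first exact: algebraic_id.
by apply: algebraic_mul; apply: aX.
Qed.

Lemma spanV x : S x -> S x^-1.
Proof.
move=> Sx; have [->|x0] := eqVneq x 0; first by rewrite invr0; apply: rat_span0.
have [P P0 rP] := span_algebraic Sx.
have [Q ->] := algebraic_inv_poly P0 rP x0.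
rewrite horner_coef; apply: rat_span_sum => i; rewrite coef_map /=.
by apply: rat_spanZ; apply: spanX.
Qed.

Lemma span_nat n : S n%:R.
Proof. by elim: n => [|n IH]; [exact: rat_span0|rewrite -natr1; apply: rat_spanD => //; exact: span1]. Qed.

Lemma span_orbit i x : iter i (xdouble lam) (Some a) = Some x -> S x.
Proof.
elim: i x => [|i IH] x /=; first by move=> [<-]; exact: spana.
case E : (iter i _ _) => [y|] //=; case: ifP => // _ [<-].
have Sy := IH _ E; have Sl := spanl; have S1 := span1.
apply: spanM; first by apply: spanX; apply: spanB => //; apply: spanX.
apply: spanV; apply: spanM; first exact: span_nat.
by apply: spanM; [apply: spanM => //|]; apply: spanB.
Qed.

(** If the orbit is finite up to step B = 32^(D N), two of its B + 1 points agree modulo 32 and are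
    equal by [orbit_close]. *)
Lemma orbit_bound : lam != 1 -> preperiodic lam a ->
  exists i j : nat, [/\ (i < j)%N, (j <= (32 ^ (D * N)).+1)%N &
    iter i (xdouble lam) (Some a) = iter j (xdouble lam) (Some a)].
Proof.
move=> lam1 per; have [V [hV Vt]] := exists_valuation_ring K.
pose o i := iter i (xdouble lam) (Some a).
set B := (32 ^ (D * N))%N.
(* If infinity is reached by step B, the repetition at B and B + 1 accounts for the successor in the
   bound. *)
case oB : (o B) => [z|]; last first.
  by exists B, B.+1; split => //; rewrite -/(o B) -/(o B.+1) oB; apply/esym; apply: (orbit_None (ltnW (ltnSn B))).
have /choice[x ox] i : exists x, (i <= B)%N -> o i = Some x.
  case oi : (o i) => [x|]; first by exists x.
  exists 0 => iB; by have := orbit_None iB oi; rewrite -/(o B) oB.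
have BE : (32 ^ #|{: 'I_D * 'I_N}| = B)%N by rewrite card_prod !card_ord.
have [| | |i [j [ij jB xij]]] := @pigeonhole_span K V hV {: 'I_D * 'I_N} e 32 x; rewrite ?BE//.
- by move=> i iB; apply: (@span_orbit i); exact: ox.
- by move=> i iB; apply/vle1; apply: (orbit_le1 hV Vt N0 lamN lam1 per (ox i iB)).
rewrite BE in jB; exists i, j; split => //; first exact: leqW.
have iB : (i <= B)%N by apply: leq_trans jB; apply: ltnW.
rewrite -/(o i) -/(o j) !ox//; congr Some.
by apply: (orbit_close hV Vt N0 lamN lam1 per ij (ox i iB) (ox j jB)).
Qed.
End Field.

(** * A bound for the order of [lam] in terms of [a] *)

Section Order.
Variables (K : numFieldType) (V : set K).
Hypotheses (hV : no_half_subring V) (Vt : forall x, V x \/ V x^-1).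
Variables (a lam : K) (n : nat).
Hypotheses (a0 : a != 0) (a1 : a != 1).
Hypotheses (n0 : (0 < n)%N) (lamn : lam ^+ n = 1) (lam1 : lam != 1).
Hypothesis per : preperiodic lam a.

(** For [a] different from 0, 1 and [lam] the double is finite, and [orbit_unit] applies at the
    start of the orbit. *)
Lemma unity_close : lam = a \/ [/\ V a, vle V 1 a & vle V (lam - a ^+ 2) 2].
Proof.
case: (eqVneq lam a) => la; [by left|right].
have a10 := orbit_le1 hV Vt n0 lamn lam1 per (erefl : iter 0 (xdouble lam) (Some a) = Some a).
case E : (xdouble lam (Some a)) => [x|]; last first.
  by move: E => /=; case: ifP => //; rewrite !mulf_eq0 !subr_eq0 (negPf a0) (negPf a1) eq_sym (negPf la).
have [h1 h2 _ _] := orbit_unit hV Vt n0 lamn lam1 per (erefl : iter 0 (xdouble lam) (Some a) = Some a) E.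
by split => //; [exact/vle1|rewrite -opprB; apply: vle_oppl].
Qed.

(** Among the first 4^D + 1 powers of a^4 two agree modulo 4, since Q(a) has dimension at most D.
    The same then holds for powers of lam^2, and [unity_mod4] gives lam^(2m) = 1 for some m <= 4^D,
    a divisor of the factorial. If lam = a, the powers of a are used directly. *)
Lemma order_bound (p : {poly rat}) D : p != 0 -> root (map_poly ratr p) a ->
  (size p <= D.+1)%N -> lam ^+ (2 * (4 ^ D)`!) = 1.
Proof.
move=> p0 pa pD.
have pig t : V a -> exists k m, [/\ (0 < m)%N, (m <= 4 ^ D)%N &
    vle V (a ^+ (t * k) - a ^+ (t * (k + m))) 4].
  move=> Va; have VX m : V (a ^+ m).
    by elim: m => [|m IH]; [exact: V1|rewrite exprS; apply: VM].
  have [| | |k [l [kl lD h]]] := @pigeonhole_span K V hV 'I_D (fun i => a ^+ i) 4 (fun k => a ^+ (t * k)) => //.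
    by move=> i _; exact: (pow_rat_span p0 pa pD).
  exists k, (l - k)%N; rewrite subn_gt0 subnKC ?(ltnW kl)//; split=> //.
  by rewrite card_ord in lD; apply: leq_trans lD; apply: leq_subr.
have fin (z : K) k m : z ^+ n = 1 -> (0 < m)%N -> (m <= 4 ^ D)%N ->
    vle V (z ^+ k - z ^+ (k + m)) 4 -> z ^+ (4 ^ D)`! = 1.
  move=> zn m0 mD h.
  have m4 : z ^+ m = 1.
    apply: (unity_mod4 hV Vt n0); first by rewrite exprAC zn expr1n.
    have zk : vle V 1 (z ^+ k).
      by apply: (unity_le1 hV Vt n0); rewrite exprAC zn expr1n.
    rewrite -[X in vle V X _]mul1r; apply: (vle_trans hV (vle_mul hV zk (vle_refl hV _))).
    by rewrite mulrBr mulr1 -exprD -opprB; apply: vle_oppl.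
  have /dvdnP[q ->] : (m %| (4 ^ D)`!)%N by apply: dvdn_fact; rewrite m0.
  by rewrite mulnC exprM m4 expr1n.
case: unity_close => [la|[Va a1' h]].
  have Va : V a by rewrite -la; apply: (unity_V hV Vt n0 lamn).
  have [k [m [m0 mD]]] := pig 1%N Va; rewrite !mul1n -la => /(fin _ _ _ lamn m0 mD) e.
  by rewrite mulnC exprM e expr1n.
have [k [m [m0 mD ak]]] := pig 4%N Va.
have Vl : V lam by apply: (unity_V hV Vt n0 lamn).
have VX x m' : V x -> V (x ^+ m').
  by move=> Vx; elim: m' => [|m' IH]; [exact: V1|rewrite exprS; apply: VM].
have h4 : vle V (lam ^+ 2 - a ^+ 4) 4.
  have -> : lam ^+ 2 - a ^+ 4 = (lam - a ^+ 2) * ((lam - a ^+ 2) + 2 * a ^+ 2) by ring.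
  have -> : 4 = 2 * 2 :> K by rewrite -natrM.
  apply: vle_mul => //; apply: vle_add => //.
  by rewrite mulrC; apply: vle_mulV; apply: VX.
have pw i : vle V (lam ^+ (2 * i) - a ^+ (4 * i)) 4.
  rewrite !exprM subrXX; rewrite mulrC; apply: (vle_trans hV _ h4); apply: vle_mulV.
  by apply: V_sum => // j; apply: VM => //; apply: (VX); apply: (VX).
rewrite exprM; apply: (fin _ k m) => //; first by rewrite exprAC lamn expr1n.
rewrite -!exprM.
have -> : lam ^+ (2 * k) - lam ^+ (2 * (k + m)) = (lam ^+ (2 * k) - a ^+ (4 * k))
  + (a ^+ (4 * k) - a ^+ (4 * (k + m))) - (lam ^+ (2 * (k + m)) - a ^+ (4 * (k + m))) by ring.
by apply: vle_sub => //; apply: vle_add.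
Qed.
End Order.

(** * Partial recursive functions *)

(** Only argument lists of length k are constrained, so functions can be written with [nth] on the
    list. *)
Definition rc (k : nat) (f : seq nat -> nat) :=
  exists r, forall v, size v = k -> computes r v (f v).
Definition rc1 (g : nat -> nat) := exists r, forall x, computes r [:: x] (g x).
Definition rc2 (g : nat -> nat -> nat) :=
  exists r, forall x y, computes r [:: x; y] (g x y).
Definition rc3 (g : nat -> nat -> nat -> nat) :=
  exists r, forall x y z, computes r [:: x; y; z] (g x y z).

Section NatLevel.
Local Open Scope nat_scope.

Lemma rc_proj k i : i < k -> rc k (fun v => nth 0 v i).
Proof. by move=> ik; exists (RProj i) => v sv; apply: computes_proj; rewrite sv. Qed.

Lemma rc_ap1 k g f : rc1 g -> rc k f -> rc k (fun v => g (f v)).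
Proof.
move=> [r hr] [s hs]; exists (RComp r [:: s]) => v sv.
apply: (computes_comp (w := [:: f v])); last exact: hr.
by apply: computes_cons; [exact: hs|exact: computes_nil].
Qed.

Lemma rc_ap2 k g f1 f2 : rc2 g -> rc k f1 -> rc k f2 ->
  rc k (fun v => g (f1 v) (f2 v)).
Proof.
move=> [r hr] [s hs] [t ht]; exists (RComp r [:: s; t]) => v sv.
apply: (computes_comp (w := [:: f1 v; f2 v])); last exact: hr.
apply: computes_cons; first exact: hs.
by apply: computes_cons; [exact: ht|exact: computes_nil].
Qed.

Lemma rc_ap3 k g f1 f2 f3 : rc3 g -> rc k f1 -> rc k f2 -> rc k f3 ->
  rc k (fun v => g (f1 v) (f2 v) (f3 v)).
Proof.
move=> [r hr] [s hs] [t ht] [u hu]; exists (RComp r [:: s; t; u]) => v sv.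
apply: (computes_comp (w := [:: f1 v; f2 v; f3 v])); last exact: hr.
apply: computes_cons; first exact: hs.
apply: computes_cons; first exact: ht.
by apply: computes_cons; [exact: hu|exact: computes_nil].
Qed.

Lemma rc1_succ : rc1 S. Proof. by exists RSucc => x; apply: computes_succ. Qed.

Lemma rc_const k n : rc k (fun=> n).
Proof.
elim: n => [|n IH]; first by exists RZero => v _; apply: computes_zero.
exact: (rc_ap1 rc1_succ IH).
Qed.

Lemma rc_rec k b s n : rc k b -> rc k.+2 s -> rc k n ->
  rc k (fun v => iteri (n v) (fun i r => s (i :: r :: v)) (b v)).
Proof.
move=> [rb hb] [rs hs] [rn hn].
exists (RComp (RPrec rb rs) (rn :: [seq RProj i | i <- iota 0 k])) => v sv.
apply: (computes_comp (w := n v :: v)).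
  apply: computes_cons; first exact: hn.
  have H m w : m + size w = size v -> drop m v = w ->
      computes_all [seq RProj i | i <- iota m (size w)] v w.
    elim: w m => [|x w IH] m e d /=; first exact: computes_nil.
    apply: computes_cons.
      have -> : x = nth 0 v m by rewrite -[m]addn0 -nth_drop d.
      by apply: computes_proj; rewrite -e /=; lia.
    apply: IH; first by rewrite /= in e; lia.
    by rewrite -add1n -drop_drop d /= drop0.
  by rewrite -sv; apply: H => //; apply: drop0.
elim: (n v) => [|m IH]; first exact: (computes_prec0 _ (hb v sv)).
apply: (computes_precS IH); apply: hs.
by rewrite /= sv.
Qed.

Lemma rc1_of g : rc 1 (fun v => g (nth 0 v 0)) -> rc1 g.
Proof. by move=> [r h]; exists r => x; apply: (h [:: x]). Qed.
Lemma rc2_of g : rc 2 (fun v => g (nth 0 v 0) (nth 0 v 1)) -> rc2 g.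
Proof. by move=> [r h]; exists r => x y; apply: (h [:: x; y]). Qed.
Lemma rc3_of g : rc 3 (fun v => g (nth 0 v 0) (nth 0 v 1) (nth 0 v 2)) -> rc3 g.
Proof. by move=> [r h]; exists r => x y z; apply: (h [:: x; y; z]). Qed.

Lemma eq_rc k f g : (forall v, size v = k -> f v = g v) -> rc k f -> rc k g.
Proof. by move=> fg [r h]; exists r => v sv; rewrite -fg//; apply: h. Qed.

Lemma rc_iteri2 (s : nat -> nat -> nat -> nat -> nat) (b : nat -> nat -> nat) :
  rc2 b -> rc 4 (fun v => s (nth 0 v 0) (nth 0 v 1) (nth 0 v 2) (nth 0 v 3)) ->
  rc2 (fun n m => iteri n (fun i r => s i r n m) (b n m)).
Proof.
move=> hb hs; apply: rc2_of.
have := @rc_rec 2 (fun v => b (nth 0 v 0) (nth 0 v 1)) _ (fun v => nth 0 v 0) _ hs (rc_proj _).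
by apply; first by apply: rc_ap2 => //; apply: rc_proj.
Qed.

Ltac rc_step := first
  [ exact: rc_const | exact: rc_proj
  | match goal with h : rc1 _ |- _ => apply: (rc_ap1 h) end
  | match goal with h : rc2 _ |- _ => apply: (rc_ap2 h) end
  | match goal with h : rc3 _ |- _ => apply: (rc_ap3 h) end ].

Lemma rc2_add : rc2 addn.
Proof.
have hS := rc1_succ.
have := @rc_iteri2 (fun i r n m => r.+1) (fun n m => m).
move=> H; have {}H : rc2 (fun n m => iteri n (fun _ r => r.+1) m).
  by apply: H; [apply: rc2_of|]; repeat rc_step.
case: H => r h; exists r => x y; rewrite (_ : x + y = iteri x (fun _ r => r.+1) y) //.
by elim: x => //= x <-.
Qed.

Lemma rc1_pred : rc1 predn.
Proof.
apply: rc1_of.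
apply: (@eq_rc _ (fun v => iteri (nth 0 v 0) (fun i r => nth 0 [:: i, r & v] 0) 0)).
  by move=> v _; case: (nth 0 v 0).
by apply: (@rc_rec 1 _ (fun v => nth 0 v 0)); repeat rc_step.
Qed.

Lemma rc2_sub : rc2 subn.
Proof.
have hP := rc1_pred; apply: rc2_of.
apply: (@eq_rc _ (fun v => iteri (nth 0 v 1) (fun i r => (nth 0 [:: i, r & v] 1).-1) (nth 0 v 0))).
  by move=> v _ /=; elim: (nth 0 v 1) => [|n /= ->]; rewrite ?subn0// subnS.
by apply: (@rc_rec 2 _ (fun v => (nth 0 v 1).-1)); repeat rc_step.
Qed.

Lemma rc2_mul : rc2 muln.
Proof.
have hA := rc2_add; apply: rc2_of.
apply: (@eq_rc _ (fun v => iteri (nth 0 v 0) (fun i r => nth 0 [:: i, r & v] 3 + nth 0 [:: i, r & v] 1) 0)).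
  by move=> v _ /=; elim: (nth 0 v 0) => //= n ->; rewrite mulSn.
by apply: (@rc_rec 2 _ (fun v => nth 0 v 3 + nth 0 v 1)); repeat rc_step.
Qed.

Lemma rc2_exp : rc2 expn.
Proof.
have hM := rc2_mul; apply: rc2_of.
apply: (@eq_rc _ (fun v => iteri (nth 0 v 1) (fun i r => nth 0 [:: i, r & v] 2 * nth 0 [:: i, r & v] 1) 1)).
  by move=> v _ /=; elim: (nth 0 v 1) => //= n ->; rewrite expnS.
by apply: (@rc_rec 2 _ (fun v => nth 0 v 2 * nth 0 v 1)); repeat rc_step.
Qed.

Lemma rc1_fact : rc1 factorial.
Proof.
have hM := rc2_mul; have hS := rc1_succ; apply: rc1_of.
apply: (@eq_rc _ (fun v => iteri (nth 0 v 0) (fun i r => (nth 0 [:: i, r & v] 0).+1 * nth 0 [:: i, r & v] 1) 1)).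
  by move=> v _ /=; elim: (nth 0 v 0) => //= n ->; rewrite factS.
by apply: (@rc_rec 1 _ (fun v => (nth 0 v 0).+1 * nth 0 v 1)); repeat rc_step.
Qed.

Lemma rc2_leq : rc2 (fun m n => m <= n).
Proof.
have hB := rc2_sub; apply: rc2_of.
apply: (@eq_rc _ (fun v => 1 - (nth 0 v 0 - nth 0 v 1))); last by repeat rc_step.
by move=> v _; rewrite /leq; case: (nth 0 v 0 - nth 0 v 1).
Qed.

Lemma rc2_eq : rc2 (fun m n => m == n).
Proof.
have hL := rc2_leq; have hM := rc2_mul; apply: rc2_of.
apply: (@eq_rc _ (fun v => (nth 0 v 0 <= nth 0 v 1) * (nth 0 v 1 <= nth 0 v 0))).
  by move=> v _; rewrite eqn_leq mulnb.
by repeat rc_step.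
Qed.

Lemma rc3_cond : rc3 (fun b x y => if b != 0 then x else y).
Proof.
have hM := rc2_mul; have hA := rc2_add; have hB := rc2_sub; apply: rc3_of.
apply: (@eq_rc _ (fun v => (1 - (1 - nth 0 v 0)) * nth 0 v 1 + (1 - nth 0 v 0) * nth 0 v 2)).
  by move=> v _; case: (nth 0 v 0) => [|n]; rewrite /= ?subn0 ?mul1n ?mul0n ?addn0.
by repeat rc_step.
Qed.

Lemma rc1_odd : rc1 odd.
Proof.
have hB := rc2_sub; apply: rc1_of.
apply: (@eq_rc _ (fun v => iteri (nth 0 v 0) (fun i r => 1 - nth 0 [:: i, r & v] 1) 0)).
  by move=> v _ /=; elim: (nth 0 v 0) => //= n ->; case: odd.
by apply: (@rc_rec 1 _ (fun v => 1 - nth 0 v 1)); repeat rc_step.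
Qed.

Lemma rc1_half : rc1 half.
Proof.
have hA := rc2_add; have hO := rc1_odd; apply: rc1_of.
apply: (@eq_rc _ (fun v => iteri (nth 0 v 0) (fun i r => odd (nth 0 [:: i, r & v] 0) + nth 0 [:: i, r & v] 1) 0)).
  by move=> v _ /=; elim: (nth 0 v 0) => //= n ->; lia.
by apply: (@rc_rec 1 _ (fun v => odd (nth 0 v 0) + nth 0 v 1)); repeat rc_step.
Qed.

Definition halves n c := iteri n (fun _ => half) c.

Lemma rc2_halves : rc2 halves.
Proof.
have hH := rc1_half; apply: rc2_of.
apply: (@eq_rc _ (fun v => iteri (nth 0 v 0) (fun i r => half (nth 0 [:: i, r & v] 1)) (nth 0 v 1))) => //.
by apply: (@rc_rec 2 _ (fun v => half (nth 0 v 1))); repeat rc_step.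
Qed.

Lemma halves_pow n k m : halves n (2 ^ (n + k) * m) = 2 ^ k * m.
Proof.
elim: n k => // n IH k; rewrite /halves /= -/(halves n _) addSnnS IH expnS -mulnA mul2n.
by rewrite doubleK.
Qed.

Lemma rc1_search (P : nat -> nat -> bool) (g : nat -> nat) :
  rc2 (fun n c => P n c) -> (forall c, P (g c) c) ->
  (forall c n, P n c -> g c <= n) -> rc1 g.
Proof.
move=> hP Pg gmin; have hB := rc2_sub.
have [r hr] : rc2 (fun n c => 1 - P n c) by apply: rc2_of; repeat rc_step.
exists (RMin r) => c; apply: (computes_min (h := fun=> 0)); last first.
  by have := hr (g c) c; rewrite Pg.
move=> m mg; have := hr m c; rewrite (_ : P m c = false) ?subn0//.
by apply/negP => /gmin; rewrite leqNgt mg.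
Qed.

(** [CodeSeq.code] sends [n :: s] to 2^n (2c + 1), where c is the code of [s]. The head is therefore
    the 2-adic valuation, and the tail is half of the odd part, rounded down. *)
Definition chead c := logn 2 c.
Definition ctail c := half (halves (chead c) c).
Definition ccons n c := 2 ^ n * c.*2.+1.

Lemma chead_cons n c : chead (ccons n c) = n.
Proof.
rewrite /chead /ccons lognM ?expn_gt0// pfactorK// logn_coprime ?addn0//.
by rewrite coprime2n /= odd_double.
Qed.

Lemma ctail_cons n c : ctail (ccons n c) = c.
Proof.
by rewrite /ctail chead_cons /ccons -{2}[n]addn0 halves_pow expn0 mul1n /= uphalf_double.
Qed.

Lemma ccons_chead c : 0 < c -> c = ccons (chead c) (ctail c).
Proof.
move=> c0; have [m oddm e] := pfactor_coprime (erefl : prime 2) c0.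
have h : halves (chead c) c = m.
  rewrite [X in halves _ X]e mulnC.
  by have := halves_pow (chead c) 0 m; rewrite addn0 mul1n.
rewrite /ccons /ctail h {1}e mulnC; congr (_ * _).
by rewrite coprime2n in oddm; rewrite -{1}(odd_double_half m) oddm.
Qed.

Lemma rc1_head : rc1 chead.
Proof.
have hO := rc1_odd; have hH := rc2_halves; have hE := rc2_eq; have hA := rc2_add; have hL := rc2_leq.
(* The summand for c = 0 stops the search on the code of the empty list, where no quotient is
   odd. *)
apply: (@rc1_search (fun n c => 0 < odd (halves n c) + (c == 0))).
- by apply: rc2_of; repeat rc_step.
- move=> c; have [->|c0] := posnP c; first by rewrite addn1.
  rewrite {2}(ccons_chead c0) /ccons -{2}[chead c]addn0 halves_pow expn0 mul1n /=.
  by rewrite odd_double.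
- move=> c n; have [->|c0] := posnP c; first by rewrite /chead logn0.
  rewrite addn0; apply: contraTT; rewrite -ltnNge => nc.
  have := halves_pow n (chead c - n) (ctail c).*2.+1.
  rewrite subnKC ?(ltnW nc)// -/(ccons _ _) -(ccons_chead c0) => ->.
  by rewrite oddM oddX subn_eq0 [chead c <= n]leqNgt nc.
Qed.

Lemma rc1_tail : rc1 ctail.
Proof.
have hH := rc2_halves; have hh := rc1_head; have h2 := rc1_half.
by apply: rc1_of; rewrite /ctail; repeat rc_step.
Qed.

Lemma rc2_cons : rc2 ccons.
Proof.
have hM := rc2_mul; have hE := rc2_exp; have hS := rc1_succ; have hA := rc2_add; apply: rc2_of.
apply: (@eq_rc _ (fun v => 2 ^ nth 0 v 0 * (nth 0 v 1 + nth 0 v 1).+1)); last by repeat rc_step.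
by move=> v _; rewrite /ccons addnn.
Qed.

Lemma code_cons n s : CodeSeq.code (n :: s) = ccons n (CodeSeq.code s).
Proof. by []. Qed.

Lemma code_cons_neq0 n s : CodeSeq.code (n :: s) != 0.
Proof. by rewrite /= -lt0n muln_gt0 expn_gt0. Qed.

Lemma chead_code s : chead (CodeSeq.code s) = head 0 s.
Proof. by case: s => [|n s]; rewrite ?code_cons ?chead_cons. Qed.

Lemma ctail_code s : ctail (CodeSeq.code s) = CodeSeq.code (behead s).
Proof. by case: s => [|n s]; rewrite ?code_cons ?ctail_cons. Qed.

End NatLevel.

(** * Computable functions on encoded data *)

Class Encodable (A : Type) := encode : A -> nat.

Definition int_encode (z : int) : nat :=
  match z with Posz n => n.*2 | Negz n => n.*2.+1 end.

#[export] Instance nat_encodable : Encodable nat := id.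
#[export] Instance bool_encodable : Encodable bool := nat_of_bool.
#[export] Instance int_encodable : Encodable int := int_encode.
#[export] Instance pair_encodable A B (_ : Encodable A) (_ : Encodable B) :
  Encodable (A * B) := fun x => CodeSeq.code [:: encode x.1; encode x.2].
#[export] Instance seq_encodable A (_ : Encodable A) : Encodable (seq A) :=
  fun s => CodeSeq.code (map encode s).

(** Nothing is required on numbers that are not codes, so these functions compose without testing
    their input. *)
Definition computable A B (_ : Encodable A) (_ : Encodable B) (f : A -> B) :=
  exists r, forall a, computes r [:: encode a] (encode (f a)).
Arguments computable {A B _ _} f.

Lemma int_encodeK z : int_decode (int_encode z) = z.
Proof.
by case: z => n; rewrite /int_decode /= odd_double ?doubleK //= uphalf_double NegzE.
Qed.

Lemma int_decodeK n : int_encode (int_decode n) = n.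
Proof.
by rewrite /int_decode; case: ifP => on; rewrite -[RHS](odd_double_half n) on // -NegzE.
Qed.

Section Computable.
Context {G : Type} {eG : Encodable G}.
Local Open Scope nat_scope.

Lemma c_lift1 A B {eA : Encodable A} {eB : Encodable B} (g : nat -> nat) (h : A -> B)
  (f : G -> A) : rc1 g -> (forall a, g (encode a) = encode (h a)) ->
  computable f -> computable (fun x => h (f x)).
Proof.
move=> [r hr] gh [s hs]; exists (RComp r [:: s]) => x.
apply: (computes_comp (w := [:: encode (f x)])); last by rewrite -gh; exact: hr.
by apply: computes_cons; [exact: hs|exact: computes_nil].
Qed.

Lemma c_lift2 A B C {eA : Encodable A} {eB : Encodable B} {eC : Encodable C}
  (g : nat -> nat -> nat) (h : A -> B -> C) (f1 : G -> A) (f2 : G -> B) :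
  rc2 g -> (forall a b, g (encode a) (encode b) = encode (h a b)) ->
  computable f1 -> computable f2 -> computable (fun x => h (f1 x) (f2 x)).
Proof.
move=> [r hr] gh [s hs] [t ht]; exists (RComp r [:: s; t]) => x.
apply: (computes_comp (w := [:: encode (f1 x); encode (f2 x)])); last by rewrite -gh; exact: hr.
apply: computes_cons; first exact: hs.
by apply: computes_cons; [exact: ht|exact: computes_nil].
Qed.

Lemma c_lift3 A B C D {eA : Encodable A} {eB : Encodable B} {eC : Encodable C} {eD : Encodable D}
  (g : nat -> nat -> nat -> nat) (h : A -> B -> C -> D) (f1 : G -> A) (f2 : G -> B) (f3 : G -> C) :
  rc3 g -> (forall a b c, g (encode a) (encode b) (encode c) = encode (h a b c)) ->
  computable f1 -> computable f2 -> computable f3 ->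
  computable (fun x => h (f1 x) (f2 x) (f3 x)).
Proof.
move=> [r hr] gh [s hs] [t ht] [u hu]; exists (RComp r [:: s; t; u]) => x.
apply: (computes_comp (w := [:: encode (f1 x); encode (f2 x); encode (f3 x)])); last by rewrite -gh; exact: hr.
apply: computes_cons; first exact: hs.
apply: computes_cons; first exact: ht.
by apply: computes_cons; [exact: hu|exact: computes_nil].
Qed.

Lemma c_id : computable (fun x : G => x).
Proof. by exists (RProj 0) => x; apply: (@computes_proj 0 [:: _]). Qed.

Lemma c_const A {eA : Encodable A} (a : A) : computable (fun _ : G => a).
Proof.
have [r hr] := rc_const 1 (encode a).
by exists r => x; apply: (hr [:: _]).
Qed.

Lemma c_pair A B {eA : Encodable A} {eB : Encodable B} (f1 : G -> A) (f2 : G -> B) :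
  computable f1 -> computable f2 -> computable (fun x => (f1 x, f2 x)).
Proof.
apply: (@c_lift2 A B (A * B)%type _ _ _ (fun a b => ccons a (ccons b 0)) pair) => //.
apply: rc2_of; have hC := rc2_cons.
apply: rc_ap2 => //; first exact: rc_proj.
by apply: rc_ap2 => //; [exact: rc_proj|exact: rc_const].
Qed.

Lemma c_fst A B {eA : Encodable A} {eB : Encodable B} (f : G -> A * B) :
  computable f -> computable (fun x => (f x).1).
Proof.
apply: (@c_lift1 _ _ _ _ chead fst); first exact: rc1_head.
by move=> [a b]; rewrite chead_code.
Qed.

Lemma c_snd A B {eA : Encodable A} {eB : Encodable B} (f : G -> A * B) :
  computable f -> computable (fun x => (f x).2).
Proof.
apply: (@c_lift1 _ _ _ _ (fun c => chead (ctail c)) snd).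
  have h := rc1_head; have t := rc1_tail; apply: rc1_of.
  by apply: rc_ap1 => //; apply: rc_ap1 => //; apply: rc_proj.
by move=> [a b]; rewrite ctail_code chead_code.
Qed.

Lemma c_succ (f : G -> nat) : computable f -> computable (fun x => (f x).+1).
Proof. exact: (c_lift1 rc1_succ). Qed.
Lemma c_pred (f : G -> nat) : computable f -> computable (fun x => (f x).-1).
Proof. exact: (c_lift1 rc1_pred). Qed.
Lemma c_fact (f : G -> nat) : computable f -> computable (fun x => (f x)`!).
Proof. exact: (c_lift1 rc1_fact). Qed.

Section Binary.
Variables (f1 f2 : G -> nat).
Hypotheses (h1 : computable f1) (h2 : computable f2).
Lemma c_addn : computable (fun x => f1 x + f2 x).
Proof. exact: (c_lift2 rc2_add). Qed.
Lemma c_subn : computable (fun x => f1 x - f2 x).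
Proof. exact: (c_lift2 rc2_sub). Qed.
Lemma c_muln : computable (fun x => f1 x * f2 x).
Proof. exact: (c_lift2 rc2_mul). Qed.
Lemma c_expn : computable (fun x => f1 x ^ f2 x).
Proof. exact: (c_lift2 rc2_exp). Qed.
Lemma c_leq : computable (fun x => f1 x <= f2 x).
Proof. exact: (c_lift2 rc2_leq). Qed.
Lemma c_eqn : computable (fun x => f1 x == f2 x).
Proof. exact: (c_lift2 rc2_eq). Qed.
End Binary.

Lemma c_if A {eA : Encodable A} (b : G -> bool) (f1 f2 : G -> A) :
  computable b -> computable f1 -> computable f2 ->
  computable (fun x => if b x then f1 x else f2 x).
Proof.
apply: (c_lift3 (h := fun (b : bool) x y => if b then x else y) rc3_cond).
by case.
Qed.

Lemma c_andb (f1 f2 : G -> bool) : computable f1 -> computable f2 ->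
  computable (fun x => f1 x && f2 x).
Proof. by move=> h1 h2; apply: c_if => //; apply: c_const. Qed.

Lemma c_orb (f1 f2 : G -> bool) : computable f1 -> computable f2 ->
  computable (fun x => f1 x || f2 x).
Proof. by move=> h1 h2; apply: c_if => //; apply: c_const. Qed.

Lemma c_negb (f : G -> bool) : computable f -> computable (fun x => ~~ f x).
Proof. by move=> h; apply: c_if => //; apply: c_const. Qed.

Lemma c_decode (f : G -> nat) : computable f ->
  computable (fun x => CodeSeq.decode (f x)).
Proof.
move=> [r hr]; exists r => x; have := hr x.
by rewrite /encode /seq_encodable /nat_encodable map_id CodeSeq.decodeK.
Qed.

Lemma c_code (f : G -> seq nat) : computable f ->
  computable (fun x => CodeSeq.code (f x)).
Proof.
move=> [r hr]; exists r => x; have := hr x.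
by rewrite /encode /seq_encodable /nat_encodable map_id.
Qed.

Lemma c_int_decode (f : G -> nat) : computable f ->
  computable (fun x => int_decode (f x)).
Proof.
by move=> [r hr]; exists r => x; rewrite /encode /int_encodable int_decodeK; apply: hr.
Qed.

Lemma c_int_encode (f : G -> int) : computable f ->
  computable (fun x => int_encode (f x)).
Proof. by move=> [r hr]; exists r => x; apply: hr. Qed.

Lemma c_cons A {eA : Encodable A} (f1 : G -> A) (f2 : G -> seq A) :
  computable f1 -> computable f2 -> computable (fun x => f1 x :: f2 x).
Proof. exact: (c_lift2 rc2_cons). Qed.

Lemma c_behead A {eA : Encodable A} (f : G -> seq A) :
  computable f -> computable (fun x => behead (f x)).
Proof.
apply: (c_lift1 rc1_tail) => s; rewrite ctail_code.
by rewrite /encode /seq_encodable behead_map.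
Qed.
End Computable.

Lemma c_comp A B C {eA : Encodable A} {eB : Encodable B} {eC : Encodable C}
  (g : B -> C) (f : A -> B) : computable g -> computable f ->
  computable (fun x => g (f x)).
Proof.
move=> [r hr] [s hs]; exists (RComp r [:: s]) => x.
apply: (computes_comp (w := [:: encode (f x)])); last exact: hr.
by apply: computes_cons; [exact: hs|exact: computes_nil].
Qed.

Section Computable2.
Context {G : Type} {eG : Encodable G}.
Local Open Scope nat_scope.

(** The context, the counter and the accumulator are packed into one code, so that the loop body is
    again a function of one argument. *)
Lemma c_iteri A {eA : Encodable A} (n : G -> nat) (s : G -> nat -> A -> A) (b : G -> A) :
  computable n -> computable b ->
  computable (fun x : G * (nat * A) => s x.1 x.2.1 x.2.2) ->
  computable (fun x => iteri (n x) (s x) (b x)).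
Proof.
move=> [rn hn] [rb hb] [rs hs].
have [rp hp] : rc 3 (fun v => ccons (nth 0 v 2) (ccons (ccons (nth 0 v 0) (ccons (nth 0 v 1) 0)) 0)).
  have hC := rc2_cons.
  by do ?[apply: (rc_ap2 hC)|exact: rc_proj|exact: rc_const].
exists (RComp (RPrec rb (RComp rs [:: rp])) [:: rn; RProj 0]) => x.
apply: (computes_comp (w := [:: n x; encode x])).
  apply: computes_cons; first exact: hn.
  apply: computes_cons; last exact: computes_nil.
  exact: (@computes_proj 0 [:: _]).
elim: (n x) => [|m IH]; first exact: (computes_prec0 _ (hb x)).
apply: (computes_precS IH).
apply: (computes_comp (w := [:: encode (x, (m, iteri m (s x) (b x)))])); last exact: hs.
apply: computes_cons; last exact: computes_nil.
exact: (hp [:: m; _; _]).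
Qed.

(* [e1] may diverge on a junk code for the head of an empty list; primitive
   recursion on the nonemptiness test runs it only when needed. *)
Lemma c_case A B {eA : Encodable A} {eB : Encodable B} (l : G -> seq A) (e0 : G -> B)
    (e1 : G -> A -> B) :
  computable l -> computable e0 -> computable (fun x : G * A => e1 x.1 x.2) ->
  computable (fun x => if l x is y :: _ then e1 x y else e0 x).
Proof.
move=> [rl hl] [r0 h0] [r1 h1].
have [rp hp] : rc 4 (fun v => ccons (nth 0 v 3) (ccons (chead (nth 0 v 2)) 0)).
  have hC := rc2_cons; have hH := rc1_head.
  by do ?[apply: (rc_ap2 hC)|apply: (rc_ap1 hH)|exact: rc_proj|exact: rc_const].
have [rt ht] : rc1 (fun c => (c != 0)).
  have hE := rc2_leq; apply: rc1_of; apply: (@eq_rc _ (fun v => 0 < nth 0 v 0)).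
    by move=> v _; rewrite lt0n.
  by do ?[apply: (rc_ap2 hE)|exact: rc_proj|exact: rc_const].
pose R0 := RComp r0 [:: RProj 1].
exists (RComp (RPrec R0 (RComp r1 [:: rp])) [:: RComp rt [:: rl]; rl; RProj 0]) => x.
apply: (computes_comp (w := [:: (encode (l x) != 0 : nat); encode (l x); encode x])).
  apply: computes_cons.
    apply: (computes_comp (w := [:: encode (l x)])); last exact: ht.
    by apply: computes_cons; [exact: hl|exact: computes_nil].
  apply: computes_cons; first exact: hl.
  apply: computes_cons; last exact: computes_nil.
  exact: (@computes_proj 0 [:: _]).
have C0 v : computes (RPrec R0 (RComp r1 [:: rp])) [:: 0; v; encode x] (encode (e0 x)).
  apply: computes_prec0; apply: (computes_comp (w := [:: encode x])); last exact: h0.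
  apply: computes_cons; last exact: computes_nil.
  exact: (@computes_proj 1 [:: _; _]).
case: (l x) => [|y s]; first exact: C0.
have -> : (encode (y :: s) != 0) = true.
  exact: code_cons_neq0.
apply: (computes_precS (C0 _)).
apply: (computes_comp (w := [:: encode (x, y)])); last exact: h1.
apply: computes_cons; last exact: computes_nil.
have hd : chead (encode (y :: s)) = encode y by apply: (chead_code (map _ _)).
have -> : encode (x, y) = ccons (encode x) (ccons (chead (encode (y :: s))) 0) by rewrite hd.
exact: (hp [:: 0; encode (e0 x); encode (y :: s); encode x]).
Qed.

Lemma c_nth A {eA : Encodable A} (d : A) (l : G -> seq A) (i : G -> nat) :
  computable l -> computable i -> computable (fun x => nth d (l x) (i x)).
Proof.
move=> hl hi.
have -> : (fun x => nth d (l x) (i x)) =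
  (fun x => if iteri (i x) (fun _ => behead) (l x) is y :: _ then y else d).
  apply: funext => x; have -> : forall n s, iteri n (fun _ => behead) s = drop n s :> seq A.
    by elim=> [|n IH] s /=; rewrite ?drop0// IH -drop1 drop_drop add1n.
  by rewrite -[i x]addn0 -nth_drop addn0; case: (drop _ _).
apply: (@c_case _ _ _ _ (fun x => iteri (i x) (fun _ => behead) (l x)) (fun=> d) (fun _ y => y)).
- by apply: (@c_iteri _ _ _ (fun _ _ => behead)) => //; apply: c_behead; do 2 apply: c_snd; exact: c_id.
- exact: c_const.
- by apply: c_snd; apply: c_id.
Qed.

(** The length is the least number of tails that lead to 0, the code of the empty list. *)
Lemma c_size A {eA : Encodable A} (l : G -> seq A) :
  computable l -> computable (fun x => size (l x)).
Proof.
move=> [r hr].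
have [rt ht] : rc2 (fun n c => (iteri n (fun _ => ctail) c != 0)).
  have hE := rc2_leq; have hT := rc1_tail; apply: rc2_of.
  apply: (@eq_rc _ (fun v => 0 < iteri (nth 0 v 0) (fun i r => ctail (nth 0 [:: i, r & v] 1)) (nth 0 v 1))).
    by move=> v _; rewrite lt0n.
  apply: (rc_ap2 hE); first exact: rc_const.
  apply: (@rc_rec 2 _ (fun v => ctail (nth 0 v 1))); do ?[apply: (rc_ap1 hT)|exact: rc_proj].
have tl n s : iteri n (fun _ => ctail) (CodeSeq.code s) = CodeSeq.code (drop n s).
  by elim: n s => [|n IH] s /=; rewrite ?drop0// IH ctail_code -drop1 drop_drop add1n.
have tle n (s : seq A) : iteri n (fun _ => ctail) (encode s) = encode (drop n s).
  by rewrite [encode s]/(CodeSeq.code _) tl -map_drop.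
exists (RComp (RMin rt) [:: r]) => x.
apply: (computes_comp (w := [:: encode (l x)])).
  by apply: computes_cons; [exact: hr|exact: computes_nil].
rewrite [encode (size _)]/encode /nat_encodable.
apply: (computes_min (h := fun=> 0)) => [m ms|].
  have := ht m (@encode _ (seq_encodable eA) (l x)); cbv beta; rewrite tle.
  case E : (drop m (l x)) => [|y s].
    by move: (congr1 size E); rewrite size_drop /= => /eqP; rewrite subn_eq0 leqNgt ms.
  by rewrite [encode (y :: s)]/(CodeSeq.code (_ :: _)) code_cons_neq0.
have := ht (size (l x)) (@encode _ (seq_encodable eA) (l x)).
by cbv beta; rewrite tle drop_size.
Qed.

(** Integer arithmetic is reduced to the naturals through positive and negative parts, reassembled
    by [diffz]. *)
Definition posz (z : int) : nat := if z is Posz n then n else 0.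
Definition negz (z : int) : nat := if z is Negz n then n.+1 else 0.
Definition diffz (p m : nat) : int := if m <= p then Posz (p - m) else Negz (m - p).-1.

Lemma diffzE p m : diffz p m = (p%:Z - m%:Z)%R.
Proof. by rewrite /diffz; case: leqP; lia. Qed.

Lemma c_posz (f : G -> int) : computable f -> computable (fun x => posz (f x)).
Proof.
apply: (@c_lift1 _ _ _ _ _ _ (fun c => if (odd c : nat) != 0 then 0 else c./2) posz).
  have hO := rc1_odd; have hC := rc3_cond; have hH := rc1_half; apply: rc1_of.
  by do ?[apply: (rc_ap3 hC)|apply: (rc_ap1 hO)|apply: (rc_ap1 hH)|exact: rc_proj|exact: rc_const].
by case=> n; rewrite /encode /= odd_double //= doubleK.
Qed.

Lemma c_negz (f : G -> int) : computable f -> computable (fun x => negz (f x)).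
Proof.
apply: (@c_lift1 _ _ _ _ _ _ (fun c => if (odd c : nat) != 0 then c./2.+1 else 0) negz).
  have hO := rc1_odd; have hC := rc3_cond; have hH := rc1_half; have hS := rc1_succ; apply: rc1_of.
  by do ?[apply: (rc_ap3 hC)|apply: (rc_ap1 hO)|apply: (rc_ap1 hH)|apply: (rc_ap1 hS)|exact: rc_proj|exact: rc_const].
by case=> n; rewrite /encode /= odd_double //= uphalf_double.
Qed.

Lemma c_diffz (f1 f2 : G -> nat) : computable f1 -> computable f2 ->
  computable (fun x => diffz (f1 x) (f2 x)).
Proof.
apply: (@c_lift2 _ _ _ _ _ _ _ _ (fun p m => if ((m <= p) : nat) != 0 then (p - m) + (p - m) else ((m - p).-1 + (m - p).-1).+1) diffz).
  have hL := rc2_leq; have hC := rc3_cond; have hA := rc2_add; have hB := rc2_sub.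
  have hS := rc1_succ; have hP := rc1_pred; apply: rc2_of.
  do ?[apply: (rc_ap3 hC)|apply: (rc_ap1 hS)|apply: (rc_ap1 hP)|apply: (rc_ap2 hL)|apply: (rc_ap2 hA)|apply: (rc_ap2 hB)|exact: rc_proj|exact: rc_const].
by move=> p m; rewrite /encode /diffz /nat_encodable !addnn; case: leqP.
Qed.

Section IntOps.
Variables f1 f2 : G -> int.
Hypotheses (h1 : computable f1) (h2 : computable f2).

Lemma c_addz : computable (fun x => f1 x + f2 x)%R.
Proof.
have -> : (fun x => f1 x + f2 x)%R = (fun x => diffz (posz (f1 x) + posz (f2 x)) (negz (f1 x) + negz (f2 x))).
  by apply: funext => x; rewrite diffzE; move: (f1 x) (f2 x) => [a|a] [b|b] /=; lia.
by apply: c_diffz; apply: c_addn; do ?[apply: c_posz|apply: c_negz].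
Qed.

Lemma c_mulz : computable (fun x => f1 x * f2 x)%R.
Proof.
have -> : (fun x => f1 x * f2 x)%R = (fun x => diffz (posz (f1 x) * posz (f2 x) + negz (f1 x) * negz (f2 x)) (posz (f1 x) * negz (f2 x) + negz (f1 x) * posz (f2 x))).
  by apply: funext => x; rewrite diffzE; move: (f1 x) (f2 x) => [a|a] [b|b] /=; nia.
by apply: c_diffz; apply: c_addn; apply: c_muln; do ?[apply: c_posz|apply: c_negz].
Qed.

Lemma c_oppz : computable (fun x => - f1 x)%R.
Proof.
have -> : (fun x => - f1 x)%R = (fun x => diffz (negz (f1 x)) (posz (f1 x))).
  by apply: funext => x; rewrite diffzE; case: (f1 x) => a /=; lia.
by apply: c_diffz; do ?[apply: c_posz|apply: c_negz].
Qed.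

Lemma c_absz : computable (fun x => `|f1 x|%N).
Proof.
have -> : (fun x => `|f1 x|%N) = (fun x => posz (f1 x) + negz (f1 x)).
  by apply: funext => x; rewrite /posz /negz; case: (f1 x) => a /=; lia.
by apply: c_addn; do ?[apply: c_posz|apply: c_negz].
Qed.

Lemma c_Posz (f : G -> nat) : computable f -> computable (fun x => Posz (f x)).
Proof.
move=> h; have -> : (fun x => Posz (f x)) = (fun x => diffz (f x) 0).
  by apply: funext => x; rewrite /diffz /= subn0.
by apply: c_diffz => //; apply: c_const.
Qed.
End IntOps.
End Computable2.

(** Minimisation finds the least accepted witness; as [chk] is total, the search can fail to halt
    only when there is none. *)
Lemma recfun_search (chk : nat -> nat -> bool) (out : nat -> nat -> nat) :
  computable (fun x : nat * nat => chk x.1 x.2) ->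
  computable (fun x : nat * nat => out x.1 x.2) ->
  exists f : recfun, forall c, (exists w, chk c w) ->
    exists2 w, chk c w & computes f [:: c] (out c w).
Proof.
move=> hc [ro ho].
have [rc hrc] := c_subn (c_const 1%N) (c_if hc (c_const 1%N) (c_const 0%N)).
have [rp hp] : rc2 (fun w c => ccons c (ccons w 0%N)).
  have hC := rc2_cons; apply: rc2_of.
  by do ?[apply: (rc_ap2 hC)|exact: rc_proj|exact: rc_const].
exists (RComp ro [:: RComp rp [:: RMin (RComp rc [:: rp]); RProj 0]]) => c ex.
case: (ex_minnP ex) => w cw wmin; exists w => //.
have H m : computes (RComp rc [:: rp]) [:: m; c] (if chk c m then 0 else 1)%N.
  apply: (computes_comp (w := [:: encode (c, m)])).
    by apply: computes_cons; [exact: hp|exact: computes_nil].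
  by have := hrc (c, m); rewrite /=; case: (chk c m).
apply: (computes_comp (w := [:: encode (c, w)])); last exact: (ho (c, w)).
apply: computes_cons; last exact: computes_nil.
apply: (computes_comp (w := [:: w; c])); last exact: hp.
apply: computes_cons; last first.
  apply: computes_cons; last exact: computes_nil.
  exact: (@computes_proj 0 [:: _]).
apply: (computes_min (h := fun=> 0%N)) => [m mw|]; last by have := H w; rewrite cw.
have := H m; case E : (chk c m) => //.
by have := wmin m E; rewrite leqNgt mw.
Qed.

(** * The algorithm *)

(** A named conditional, which the syntax-directed tactic below can match. *)
Definition cond A (b : bool) (x y : A) := if b then x else y.

Ltac computability_step := match goal with
  | h : computable ?f |- computable ?f => exact h
  | |- computable (fun x => x) => exact: c_id
  | h : computable ?f |- computable (fun x => ?f (@?g x)) => refine (c_comp (g := f) (f := g) h _)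
  | |- computable (fun _ => ?a) => exact: (c_const a)
  | |- computable (fun x => (@?f x, @?g x)) => refine (c_pair (f1 := f) (f2 := g) _ _)
  | |- computable (fun x => (@?f x).1) => refine (c_fst (f := f) _)
  | |- computable (fun x => (@?f x).2) => refine (c_snd (f := f) _)
  | |- computable (fun x => (@?f x).+1) => refine (c_succ (f := f) _)
  | |- computable (fun x => (@?f x).-1) => refine (c_pred (f := f) _)
  | |- computable (fun x => factorial (@?f x)) => refine (c_fact (f := f) _)
  | |- computable (fun x => addn (@?f x) (@?g x)) => refine (c_addn (f1 := f) (f2 := g) _ _)
  | |- computable (fun x => subn (@?f x) (@?g x)) => refine (c_subn (f1 := f) (f2 := g) _ _)
  | |- computable (fun x => muln (@?f x) (@?g x)) => refine (c_muln (f1 := f) (f2 := g) _ _)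
  | |- computable (fun x => expn (@?f x) (@?g x)) => refine (c_expn (f1 := f) (f2 := g) _ _)
  | |- computable (fun x => leq (@?f x) (@?g x)) => refine (c_leq (f1 := f) (f2 := g) _ _)
  | |- computable (fun x => (@?f x) == (@?g x)) => refine (c_eqn (f1 := f) (f2 := g) _ _)
  | |- computable (fun x => cond (@?b x) (@?f x) (@?g x)) => refine (c_if (b := b) (f1 := f) (f2 := g) _ _ _)
  | |- computable (fun x => (@?f x) && (@?g x)) => refine (c_andb (f1 := f) (f2 := g) _ _)
  | |- computable (fun x => (@?f x) || (@?g x)) => refine (c_orb (f1 := f) (f2 := g) _ _)
  | |- computable (fun x => ~~ (@?f x)) => refine (c_negb (f := f) _)
  | |- computable (fun x => CodeSeq.decode (@?f x)) => refine (c_decode (f := f) _)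
  | |- computable (fun x => CodeSeq.code (@?f x)) => refine (c_code (f := f) _)
  | |- computable (fun x => int_decode (@?f x)) => refine (c_int_decode (f := f) _)
  | |- computable (fun x => int_encode (@?f x)) => refine (c_int_encode (f := f) _)
  | |- computable (fun x => (@?f x) :: (@?g x)) => refine (c_cons (f1 := f) (f2 := g) _ _)
  | |- computable (fun x => nth ?d (@?f x) (@?g x)) => refine (c_nth (l := f) (i := g) d _ _)
  | |- computable (fun x => size (@?f x)) => refine (c_size (l := f) _)
  | |- computable (fun x => iteri (@?n x) (@?s x) (@?b x)) =>
      refine (c_iteri (n := n) (s := s) (b := b) _ _ _)
  | |- computable (fun x => (@?f x + @?g x)%R) => refine (c_addz (f1 := f) (f2 := g) _ _)
  | |- computable (fun x => (@?f x * @?g x)%R) => refine (c_mulz (f1 := f) (f2 := g) _ _)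
  | |- computable (fun x => (- @?f x)%R) => refine (c_oppz (f1 := f) _)
  | |- computable (fun x => absz (@?f x)) => refine (c_absz (f1 := f) _)
  | |- computable (fun x => Posz (@?f x)) => refine (c_Posz (f := f) _)
  end.
Ltac computability := repeat (cbv beta; computability_step).

Local Notation gauss := (int * int)%type.

Definition gadd (x y : gauss) : gauss := (x.1 + y.1, x.2 + y.2).
Definition gsub (x y : gauss) : gauss := (x.1 - y.1, x.2 - y.2).
Definition gmul (x y : gauss) : gauss :=
  (x.1 * y.1 - x.2 * y.2, x.1 * y.2 + x.2 * y.1).
Definition gnat (n : nat) : gauss := (Posz n, 0).
Definition gpow (x : gauss) (n : nat) : gauss := iteri n (fun _ r => gmul r x) (gnat 1).
Definition gnorm (x : gauss) : nat := (`|x.1| ^ 2 + `|x.2| ^ 2)%N.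

Section GaussComputable.
Context {G : Type} {eG : Encodable G}.
Variables (f g : G -> gauss) (n : G -> nat).
Hypotheses (hf : computable f) (hg : computable g) (hn : computable n).
Lemma c_gadd : computable (fun x => gadd (f x) (g x)).
Proof. by rewrite /gadd; computability. Qed.
Lemma c_gsub : computable (fun x => gsub (f x) (g x)).
Proof. by rewrite /gsub; computability. Qed.
Lemma c_gmul : computable (fun x => gmul (f x) (g x)).
Proof. by rewrite /gmul; computability. Qed.
Lemma c_gnat : computable (fun x => gnat (n x)).
Proof. by rewrite /gnat; computability. Qed.
Lemma c_gnorm : computable (fun x => gnorm (f x)).
Proof. by rewrite /gnorm; computability. Qed.
End GaussComputable.

Ltac gauss_step := match goal with
  | |- computable (fun x => gadd (@?f x) (@?g x)) => refine (c_gadd (f := f) (g := g) _ _)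
  | |- computable (fun x => gsub (@?f x) (@?g x)) => refine (c_gsub (f := f) (g := g) _ _)
  | |- computable (fun x => gmul (@?f x) (@?g x)) => refine (c_gmul (f := f) (g := g) _ _)
  | |- computable (fun x => gnat (@?f x)) => refine (c_gnat (n := f) _)
  | |- computable (fun x => gnorm (@?f x)) => refine (c_gnorm (f := f) _)
  end.
Ltac gcomputability := repeat (cbv beta zeta; first [computability_step | gauss_step]).

Lemma c_gpow G (eG : Encodable G) (f : G -> gauss) (n : G -> nat) :
  computable f -> computable n -> computable (fun x => gpow (f x) (n x)).
Proof. by move=> hf hn; rewrite /gpow; gcomputability. Qed.

Ltac gpow_step := match goal with
  | |- computable (fun x => gpow (@?f x) (@?n x)) => refine (c_gpow (f := f) (n := n) _ _)
  end.
Ltac comput := repeat (cbv beta zeta; first [computability_step | gauss_step | gpow_step]).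

Definition alln n (P : nat -> bool) := iteri n (fun i b => b && P i) true.
Definition exn n (P : nat -> bool) := iteri n (fun i b => b || P i) false.

(* Projective doubling, homogenised with a common denominator [q]. *)
Definition hstep (R : comPzRingType) (q l : R) (P : R * R) : R * R :=
  ((q * P.1 ^+ 2 - l * P.2 ^+ 2) ^+ 2,
   4 * q * P.1 * P.2 * (P.1 - P.2) * (q * P.1 - l * P.2)).
Definition horbit (R : comPzRingType) (q a l : R) k := iter k (hstep q l) (a, q).
Definition hcross (R : comPzRingType) (q a l : R) i j :=
  (horbit q a l i).1 * (horbit q a l j).2 - (horbit q a l j).1 * (horbit q a l i).2.

Definition gstep (q : nat) (l : gauss) (P : gauss * gauss) : gauss * gauss :=
  let u := gsub (gmul (gnat q) (gmul P.1 P.1)) (gmul l (gmul P.2 P.2)) in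
  (gmul u u,
   gmul (gmul (gmul (gmul (gnat (4 * q)) P.1) P.2) (gsub P.1 P.2))
     (gsub (gmul (gnat q) P.1) (gmul l P.2))).
Definition gorbit (q : nat) (a l : gauss) (k : nat) :=
  iteri k (fun _ => gstep q l) (a, gnat q).
Definition gcross q a l i j :=
  gsub (gmul (gorbit q a l i).1 (gorbit q a l j).2)
       (gmul (gorbit q a l j).1 (gorbit q a l i).2).

(** The degree of the coordinates of [horbit q a l k] as forms in q, a and l: both components of
    [hstep] turn degree e into 4e + 2. *)
Definition hdegree (k : nat) : nat := iteri k (fun _ e => (4 * e + 2)%N) 1%N.
(** If differences add the bounds and every product doubles them, the second component of [hstep]
    costs 512 H^2 s^4 and the first 128 H^2 s^4. *)
Definition hbound (H k : nat) : nat := iteri k (fun _ s => (512 * H ^ 2 * s ^ 4)%N) H.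

Section Algorithm.
Local Open Scope nat_scope.

Definition fld (c i : nat) := nth 0 (CodeSeq.decode c) i.
Definition pcoef (c i : nat) : int := int_decode (nth 0 (CodeSeq.decode (fld c 0)) i).
Definition psize c := size (CodeSeq.decode (fld c 0)).
Definition center c : gauss := (int_decode (fld c 1), int_decode (fld c 2)).
Definition rad c := (fld c 3).+1.

(* Every parameter in the set is killed by [order], and every orbit that repeats
   does so within [olength] steps; [crossbound] is a Lipschitz constant for the
   quantities [hcross], whose nonzero values exceed [1 / gap]. *)
Definition order c := 2 * (4 ^ psize c)`!.
Definition dim c := psize c * order c.
Definition olength c := (32 ^ dim c).+1.
(** A common bound for the coefficients, the input and its approximation: the final 2 covers the
    radius of the disc and the error of approximation, each at most 1. *)
Definition height c := iteri (psize c) (fun i r => r + `|pcoef c i|) 0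
  + `|(center c).1| + `|(center c).2| + 2.
Definition crossbound c := 4 * (hbound (height c) (olength c)) ^ 2.
Definition gap c := crossbound c ^ dim c * height c ^ (2 * hdegree (olength c)).

(* A witness consists of approximations [wa / wq] of the input and [wz i / wq]
   of the roots of unity, accurate to [1 / wk], and of the centres [wo i / wt] of
   the discs of radius [1 / wt] to be returned. *)
Definition wq w := fld w 0.
Definition wk w := fld w 1.
Definition wa w : gauss := (int_decode (fld w 2), int_decode (fld w 3)).
Definition wt w := (fld w 4).+1.
Definition wz w i : gauss := let l := fld (fld w 5) i in (int_decode (fld l 0), int_decode (fld l 1)).
Definition wo w i : gauss := let l := fld (fld w 5) i in (int_decode (fld l 2), int_decode (fld l 3)).

(* |Z/q - O/s| < 1/s - 1/K, respectively >= 1/s + 1/K, with denominators cleared. *)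
Definition near q K (Z O : gauss) s :=
  gnorm (gsub (gmul Z (gnat s)) (gmul (gnat q) O)) * K ^ 2 < (q * (K - s)) ^ 2.
Definition far q K (Z O : gauss) s :=
  (q * (K + s)) ^ 2 <= gnorm (gsub (gmul Z (gnat s)) (gmul (gnat q) O)) * K ^ 2.
Definition hval c q (A : gauss) : gauss :=
  iteri (psize c) (fun i r => gadd r (gmul (pcoef c i, Posz 0)
     (gmul (gpow A i) (gnat (q ^ (psize c - i)))))) (gnat 0).

(** The second test says that the polynomial is smaller than K^(-n) at the approximation, n being
    the length of its coefficient list; by [root_near] a root lies within 1/K. *)
Definition approx_root c w :=
  near (wq w) (wk w) (wa w) (center c) (rad c) &&
  (gnorm (hval c (wq w) (wa w)) * wk w ^ (2 * psize c) < wq w ^ (2 * psize c)).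
Definition approx_unity c w i :=
  gnorm (gsub (gpow (wz w i) (order c)) (gnat (wq w ^ order c))) * wk w ^ (2 * order c)
    < wq w ^ (2 * order c).
Definition separated c w i :=
  alln (order c) (fun j => cond (i == j) (near (wq w) (wk w) (wz w i) (wo w i) (wt w))
    (far (wq w) (wk w) (wz w j) (wo w i) (wt w))).
Definition check c w :=
  (0 < wq w) && (2 * crossbound c * gap c < wk w) && (rad c < wk w) && (wt w < wk w) &&
  approx_root c w &&
  alln (order c) (fun i => approx_unity c w i && separated c w i).

Definition small_cross c w i a b :=
  gnorm (gcross (wq w) (wa w) (wz w i) a b) * (2 * gap c) ^ 2
    < wq w ^ (2 * (hdegree a + hdegree b)).
Definition selected c w i :=
  ~~ ((`|((wo w i).1 + - (Posz (wt w)))%R| == 0) && (`|(wo w i).2| == 0)) &&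
  exn (olength c).+1 (fun b => exn b (fun a => small_cross c w i a b)).
(** Under [int_decode] the entries 1, 0 and 2 stand for -1, 0 and 1, so for positive n this encodes
    X^n - 1. *)
Definition unity_code n := CodeSeq.code (1 :: iteri n.-1 (fun _ r => 0 :: r) [:: 2]).
Definition entry c w i :=
  CodeSeq.code [:: unity_code (order c); int_encode (wo w i).1; int_encode (wo w i).2; (wt w).-1].
Definition output c w :=
  CodeSeq.code (iteri (order c) (fun i r => cond (selected c w i) (entry c w i :: r) r) [::]).

Lemma c_check : computable (fun x : nat * nat => check x.1 x.2).
Proof.
rewrite /check /approx_root /approx_unity /separated /alln /near /far /hval /gap /crossbound /hbound /hdegree /height /olength /dim /order /wq /wk /wa /wt /wz /wo /center /rad /pcoef /psize /fld.
by comput.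
Qed.

Lemma c_output : computable (fun x : nat * nat => output x.1 x.2).
Proof.
rewrite /output /entry /unity_code /selected /small_cross /gcross /gorbit /gstep /exn /hval /gap /crossbound /hbound /hdegree /height /olength /dim /order /wq /wk /wa /wt /wz /wo /center /rad /pcoef /psize /fld.
by comput.
Qed.
End Algorithm.

(** * Numerical bounds *)

Local Open Scope complex_scope.

Lemma hdegreeS k : hdegree k.+1 = (4 * hdegree k + 2)%N. Proof. by []. Qed.
Lemma hboundS H k : hbound H k.+1 = (512 * H ^ 2 * hbound H k ^ 4)%N.
Proof. by []. Qed.

(** * Projective duplication and its scaling *)

Section Homogeneous.
Variable F : fieldType.
Implicit Types q a l : F.

Lemma horbitS q a l k : horbit q a l k.+1 = hstep q l (horbit q a l k).
Proof. by []. Qed.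

Lemma horbit_scale q a l k :
  horbit q (q * a) (q * l) k =
  (q ^+ hdegree k * (horbit 1 a l k).1, q ^+ hdegree k * (horbit 1 a l k).2).
Proof.
elim: k => [|k IH]; first by rewrite /horbit /hdegree /= expr1 mulr1.
rewrite !horbitS IH hdegreeS /hstep /=.
rewrite exprD mulnC exprM; move: (q ^+ hdegree k) => x.
by congr pair; ring.
Qed.

Lemma hcross_scale q a l i j :
  hcross q (q * a) (q * l) i j = q ^+ (hdegree i + hdegree j) * hcross 1 a l i j.
Proof. by rewrite /hcross !horbit_scale exprD /=; ring. Qed.

Section Affine.
Variables a l : F.
Hypotheses (l0 : l != 0) (l1 : l != 1) (n2 : 2 != 0 :> F).
Let X k := (horbit 1 a l k).1.
Let Z k := (horbit 1 a l k).2.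

(** The components of [hstep] have no common zero: x^2 = l z^2 together with x = 0, z = 0, x = z or
    x = l z forces x = z = 0, because l is neither 0 nor 1. *)
Lemma horbit_affine k : (X k, Z k) != (0, 0) /\
  iter k (xdouble l) (Some a) = if Z k == 0 then None else Some (X k / Z k).
Proof.
have n4 : 4 != 0 :> F by rewrite (_ : 4 = 2 * 2) ?mulf_neq0//; ring.
elim: k => [|k [XZ IH]].
  by rewrite /X /Z /horbit /= !xpair_eqE oner_eq0 andbF divr1.
rewrite /X /Z horbitS -/(X k) -/(Z k) iterS IH {IH}.
rewrite /hstep /= !mul1r.
rewrite -/(X k) -/(Z k) in XZ *; move: (X k) (Z k) XZ => x z XZ.
split.
  rewrite xpair_eqE sqrf_eq0; apply/negP => /andP[/eqP e1].
  have e2 : x ^+ 2 = l * z ^+ 2 by apply/eqP; rewrite -subr_eq0 e1.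
  rewrite mulr1 !mulf_eq0 (negPf n4) /= !subr_eq0 => /orP[/orP[/orP[]|]|] /eqP e; case/negP: XZ.
  - move: e2; rewrite e expr0n /= => /esym/eqP; rewrite mulf_eq0 (negPf l0) sqrf_eq0 => /eqP ->.
    by rewrite xpair_eqE !eqxx.
  - by move: e2; rewrite e expr0n mulr0 => /eqP; rewrite sqrf_eq0 => /eqP ->; rewrite xpair_eqE !eqxx.
  - have /eqP : (1 - l) * z ^+ 2 = 0 by rewrite mulrBl -e2 -e mul1r subrr.
    by rewrite mulf_eq0 subr_eq0 eq_sym (negPf l1) sqrf_eq0 e => /eqP ->; rewrite xpair_eqE !eqxx.
  - have /eqP : l * (l - 1) * z ^+ 2 = 0.
      by rewrite (_ : _ * z ^+ 2 = (l * z) ^+ 2 - l * z ^+ 2); [rewrite -e2 -e subrr|ring].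
    rewrite mulf_eq0 mulf_eq0 subr_eq0 (negPf l1) (negPf l0) sqrf_eq0 e => /eqP ->.
    by rewrite mulr0 xpair_eqE !eqxx.
have [z0|z0] := eqVneq z 0; first by rewrite z0 !(mulr0, mul0r) eqxx.
have xE : x = x / z * z by rewrite divfK.
move: (x / z) xE => u -> /=.
have -> : 4 * 1 * (u * z) * z * (u * z - z) * (u * z - l * z) =
  z ^+ 4 * (4 * (u * (u - 1) * (u - l))) by ring.
have -> : (z ^+ 4 * (4 * (u * (u - 1) * (u - l))) == 0) = (u * (u - 1) * (u - l) == 0).
  by rewrite mulf_eq0 expf_eq0 (negPf z0) /= mulf_eq0 (negPf n4).
case: ifP => // /negbT D0; congr Some.
move: D0; rewrite !mulf_eq0 !negb_or -andbA => /and3P[u0 u1 ul].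
by field; rewrite z0 n4 u0 u1 ul.
Qed.

Lemma hcross_eq0 i j : (hcross 1 a l i j == 0) =
  (iter i (xdouble l) (Some a) == iter j (xdouble l) (Some a)).
Proof.
have [XZi ->] := horbit_affine i; have [XZj ->] := horbit_affine j.
rewrite /hcross -/(X i) -/(X j) -/(Z i) -/(Z j).
move: (X i) (Z i) (X j) (Z j) XZi XZj => x z x' z' XZi XZj.
move: XZi XZj; rewrite !xpair_eqE.
have [->|z0] := eqVneq z 0; have [->|z'0] := eqVneq z' 0; rewrite ?andbT ?andbF ?mulr0 ?subr0 ?sub0r.
- by move=> _ _; rewrite !eqxx.
- by move=> x0 _; rewrite mulf_eq0 (negPf x0) (negPf z'0).
- by move=> _ x0; rewrite oppr_eq0 mulf_eq0 (negPf x0) (negPf z0).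
by move=> _ _; rewrite subr_eq0 (inj_eq Some_inj) eqr_div// eq_sym [x' * z]mulrC.
Qed.
End Affine.
End Homogeneous.

(** * Real moduli and Gaussian integers *)

Section Modulus.
Variable R : realType.
Implicit Types z : R[i].

(** The norm on [R[i]] takes its values in [R[i]]; this is the same number in the ordered field
    [R]. *)
Definition md z : R := complex.Re `|z|.

Lemma mdE z : `|z| = (md z)%:C.
Proof. by rewrite /md normc_def. Qed.

Lemma md_ge0 z : 0 <= md z.
Proof. by rewrite -lecR -mdE normr_ge0. Qed.

Lemma mdM z w : md (z * w) = md z * md w.
Proof. by apply: complexI; rewrite rmorphM /= -!mdE normrM. Qed.

Lemma mdN z : md (- z) = md z.
Proof. by apply: complexI; rewrite -!mdE normrN. Qed.

Lemma md_add z w : md (z + w) <= md z + md w.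
Proof. by rewrite -lecR rmorphD /= -!mdE ler_normD. Qed.

Lemma md_sub z w : md (z - w) <= md z + md w.
Proof. by rewrite -(mdN w) md_add. Qed.

Lemma md_dist z w : md (z - w) = md (w - z).
Proof. by rewrite -mdN opprB. Qed.

Lemma md_nat n : md n%:R = n%:R.
Proof. by apply: complexI; rewrite -mdE normr_nat rmorph_nat. Qed.

Lemma md_int (n : int) : md n%:~R = (`|n|%N)%:R.
Proof.
by apply: complexI; rewrite -mdE -intr_norm rmorph_nat -abszE -pmulrn.
Qed.

Lemma md0 : md 0 = 0. Proof. exact: (md_nat 0). Qed.
Lemma md1 : md 1 = 1. Proof. exact: (md_nat 1). Qed.

Lemma mdX z n : md (z ^+ n) = md z ^+ n.
Proof. by elim: n => [|n IH]; rewrite ?expr0 ?md1// !exprS mdM IH. Qed.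

Lemma mdV z : md z^-1 = (md z)^-1.
Proof. by apply: complexI; rewrite fmorphV /= -!mdE normfV. Qed.

Lemma md_eq0 z : (md z == 0) = (z == 0).
Proof. by rewrite -(inj_eq (@complexI _)) -mdE normr_eq0. Qed.

Lemma md_prod (I : Type) (s : seq I) (f : I -> R[i]) :
  md (\prod_(i <- s) f i) = \prod_(i <- s) md (f i).
Proof. by elim/big_rec2: _ => [|i y x _ <-]; rewrite ?md1 ?mdM. Qed.

Lemma md_sum (I : Type) (s : seq I) (f : I -> R[i]) :
  md (\sum_(i <- s) f i) <= \sum_(i <- s) md (f i).
Proof.
elim/big_rec2: _ => [|i y x _ h]; first by rewrite md0.
by apply: le_trans (md_add _ _) _; rewrite lerD2l.
Qed.

Lemma md_lt z (x : R) : (`|z| < x%:C) = (md z < x).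
Proof. by rewrite mdE ltcR. Qed.

Definition gz (x : int * int) : R[i] := x.1%:~R + 'i * x.2%:~R.

Lemma gzD x y : gz (gadd x y) = gz x + gz y.
Proof. by rewrite /gz /gadd !rmorphD /=; ring. Qed.
Lemma gzB x y : gz (gsub x y) = gz x - gz y.
Proof. by rewrite /gz /gsub !rmorphB /=; ring. Qed.
Lemma gz_nat n : gz (gnat n) = n%:R.
Proof. by rewrite /gz /= mulr0 addr0. Qed.
Lemma gz_int (n : int) : gz (n, 0) = n%:~R.
Proof. by rewrite /gz /= mulr0 addr0. Qed.
Lemma gzM x y : gz (gmul x y) = gz x * gz y.
Proof.
rewrite /gz /gmul rmorphB rmorphD !rmorphM /=.
have i2 : 'i * 'i = -1 :> R[i] by rewrite -expr2 sqr_i.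
transitivity (x.1%:~R * y.1%:~R + ('i * 'i) * (x.2%:~R * y.2%:~R) + 'i * (x.1%:~R * y.2%:~R + x.2%:~R * y.1%:~R) : R[i]).
  by rewrite i2; ring.
by ring.
Qed.
Lemma gzX x n : gz (gpow x n) = gz x ^+ n.
Proof.
elim: n => [|n IH]; first by rewrite gz_nat.
by rewrite exprSr -IH -gzM.
Qed.

Lemma gzE x : gz x = x.1%:~R +i* x.2%:~R.
Proof.
apply/eqP; rewrite eq_complex /gz.
rewrite -[x.1%:~R](rmorph_int (real_complex R)) -[x.2%:~R](rmorph_int (real_complex R)).
by simpc.
Qed.

Lemma gnormE x : (gnorm x)%:R = md (gz x) ^+ 2.
Proof.
apply: complexI; rewrite rmorphXn /= -mdE -add_Re2_Im2 gzE /=; congr (_%:C).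
rewrite /gnorm natrD !natrX.
have h (n : int) : `|n|%:R ^+ 2 = n%:~R ^+ 2 :> R.
  by rewrite natr_absz intr_norm real_normK ?num_real.
by rewrite !h.
Qed.

Lemma gz_orbit q a l k : 
  (gz (gorbit q a l k).1, gz (gorbit q a l k).2) = horbit q%:R (gz a) (gz l) k.
Proof.
elim: k => [|k IH]; first by rewrite /gorbit /horbit /= gz_nat.
rewrite horbitS -IH /gorbit /= -/(gorbit _ _ _ _) /gstep /hstep /=.
rewrite !(gzM, gzB, gz_nat) natrM; congr pair; ring.
Qed.

Lemma gz_cross q a l i j : gz (gcross q a l i j) = hcross q%:R (gz a) (gz l) i j.
Proof. by rewrite /gcross gzB !gzM /hcross -!gz_orbit. Qed.
End Modulus.

Section Bounds.
Variable R : realType.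
Implicit Types w z : R[i].

Lemma hbound_ge H k : (0 < H)%N -> (H <= hbound H k)%N.
Proof.
move=> H0; elim: k => [|k IH] //; rewrite hboundS.
have s0 : (0 < hbound H k)%N by apply: leq_trans IH.
apply: leq_trans IH _; move: (hbound H k) s0 => s s0.
by rewrite expnS mulnC -mulnA leq_pmulr// !muln_gt0 !expn_gt0 s0 H0.
Qed.

Lemma hbound_mono H i j : (0 < H)%N -> (i <= j)%N -> (hbound H i <= hbound H j)%N.
Proof.
move=> H0 ij; rewrite -(subnKC ij); elim: (j - i)%N => [|k IH]; first by rewrite addn0.
apply: leq_trans IH _; rewrite addnS hboundS.
have := hbound_ge (i + k) H0; move: (hbound H (i + k)) => s Hs.
have s0 : (0 < s)%N by apply: leq_trans Hs.
by rewrite expnS mulnC -mulnA leq_pmulr// !muln_gt0 !expn_gt0 s0 H0.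
Qed.

Lemma hdegree_mono i j : (i <= j)%N -> (hdegree i <= hdegree j)%N.
Proof.
move=> ij; rewrite -(subnKC ij); elim: (j - i)%N => [|k IH]; first by rewrite addn0.
by apply: leq_trans IH _; rewrite addnS hdegreeS; lia.
Qed.

(* Lipschitz constants and heights obey the same recursion; the factor [2] in
   [mulP] comes from the product rule. *)
Section Growth.
Variables (Q : nat -> R[i] -> R[i] -> Prop).
Hypothesis leP : forall M M' w w', (M <= M')%N -> Q M w w' -> Q M' w w'.
Hypothesis subP : forall M M' w w' z z', Q M w w' -> Q M' z z' -> Q (M + M') (w - z) (w' - z').
Hypothesis mulP : forall M M' w w' z z', Q M w w' -> Q M' z z' -> Q (2 * M * M') (w * z) (w' * z').
Variables (q q' a a' l l' : R[i]) (H : nat).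
Hypotheses (hq : Q H q q') (h4q : Q (4 * H) (4 * q) (4 * q')).
Hypotheses (ha : Q H a a') (hl : Q H l l') (H0 : (0 < H)%N).

Lemma growth_orbit k : Q (hbound H k) (horbit q a l k).1 (horbit q' a' l' k).1 /\
  Q (hbound H k) (horbit q a l k).2 (horbit q' a' l' k).2.
Proof.
elim: k => [|k [IHx IHz]]; first by [].
rewrite hboundS !horbitS /hstep /=; move: (hbound H k) IHx IHz => s IHx IHz.
move: (horbit q a l k).1 (horbit q a l k).2 (horbit q' a' l' k).1 (horbit q' a' l' k).2 IHx IHz => x z x' z' hx hz.
have hx2 : Q (2 * s * s) (x ^+ 2) (x' ^+ 2) by rewrite !expr2; apply: mulP.
have hz2 : Q (2 * s * s) (z ^+ 2) (z' ^+ 2) by rewrite !expr2; apply: mulP.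
have hu := subP (mulP hq hx2) (mulP hl hz2).
split.
  rewrite !(expr2 (_ - _)); apply: leP (mulP hu hu).
  apply: (@leq_trans (128 * (H ^ 2 * s ^ 4))); last by rewrite -mulnA leq_mul2r orbT.
  by rewrite leq_eqVlt; apply/orP; left; apply/eqP; ring.
have h1 := mulP (mulP (mulP (mulP h4q hx) hz) (subP hx hz)) (subP (mulP hq hx) (mulP hl hz)).
apply: leP h1; rewrite leq_eqVlt; apply/orP; left; apply/eqP; ring.
Qed.

Lemma growth_cross i j B : (i <= B)%N -> (j <= B)%N ->
  Q (4 * hbound H B ^ 2) (hcross q a l i j) (hcross q' a' l' i j).
Proof.
move=> iB jB; rewrite /hcross.
have [xi zi] := growth_orbit i; have [xj zj] := growth_orbit j.
apply: leP (subP (mulP xi zj) (mulP xj zi)).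
apply: (@leq_trans (4 * (hbound H i * hbound H j))).
  by rewrite leq_eqVlt; apply/orP; left; apply/eqP; ring.
by rewrite leq_mul2l /= expnS expn1 leq_mul// hbound_mono.
Qed.
End Growth.

Section Lipschitz.
Variable eta : R.
Hypothesis eta0 : 0 <= eta.

(** One constant bounds both the size and the variation, so that the product rule costs only a
    factor 2. *)
Definition lip (M : nat) w w' :=
  [/\ md w <= M%:R, md w' <= M%:R & md (w - w') <= M%:R * eta].

Lemma lip_le M M' w w' : (M <= M')%N -> lip M w w' -> lip M' w w'.
Proof.
move=> MM [h1 h2 h3]; have hM : M%:R <= M'%:R :> R by rewrite ler_nat.
split; [exact: le_trans hM|exact: le_trans hM|].
by apply: le_trans h3 _; apply: ler_wpM2r.
Qed.

Lemma lip_sub M M' w w' z z' : lip M w w' -> lip M' z z' ->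
  lip (M + M') (w - z) (w' - z').
Proof.
move=> [h1 h2 h3] [k1 k2 k3]; rewrite /lip natrD mulrDl; split.
- by apply: le_trans (md_sub _ _) _; apply: lerD.
- by apply: le_trans (md_sub _ _) _; apply: lerD.
have -> : w - z - (w' - z') = (w - w') - (z - z') by ring.
by apply: le_trans (md_sub _ _) _; apply: lerD.
Qed.

Lemma lip_mul M M' w w' z z' : lip M w w' -> lip M' z z' ->
  lip (2 * M * M') (w * z) (w' * z').
Proof.
move=> [h1 h2 h3] [k1 k2 k3].
have hM : 0 <= M%:R :> R by []. have hM' : 0 <= M'%:R :> R by [].
have w0 := md_ge0 w; have w0' := md_ge0 w'; have z0 := md_ge0 z; have z0' := md_ge0 z'.
rewrite /lip !natrM !mdM; split.
- by apply: le_trans (ler_pM w0 z0 h1 k1) _; rewrite -mulrA ler_peMl ?mulr_ge0// ler1n.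
- by apply: le_trans (ler_pM w0' z0' h2 k2) _; rewrite -mulrA ler_peMl ?mulr_ge0// ler1n.
have -> : w * z - w' * z' = (w - w') * z + w' * (z - z') by ring.
apply: le_trans (md_add _ _) _; rewrite !mdM.
have d0 := md_ge0 (w - w'); have d0' := md_ge0 (z - z').
have e1 : md (w - w') * md z <= (M%:R * eta) * M'%:R by apply: ler_pM.
have e2 : md w' * md (z - z') <= M%:R * (M'%:R * eta) by apply: ler_pM.
by apply: le_trans (lerD e1 e2) _; rewrite le_eqVlt; apply/orP; left; apply/eqP; ring.
Qed.

Lemma lip_const M w : md w <= M%:R -> lip M w w.
Proof. by move=> h; split=> //; rewrite subrr md0 mulr_ge0. Qed.

Lemma lip_cross a a' l l' H i j B : (0 < H)%N -> (i <= B)%N -> (j <= B)%N ->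
  lip H a a' -> lip H l l' ->
  md (hcross 1 a l i j - hcross 1 a' l' i j) <= (4 * hbound H B ^ 2)%:R * eta.
Proof.
move=> H0 iB jB ha hl.
have h1 : lip H 1 1 by apply: lip_const; rewrite md1 ler1n.
have h4 : lip (4 * H) (4 * 1) (4 * 1).
  by apply: lip_const; rewrite mulr1 md_nat ler_nat; lia.
by have [] := growth_cross lip_le lip_sub lip_mul h1 h4 ha hl H0 iB jB.
Qed.
End Lipschitz.

(** * A Liouville inequality from integer matrices *)

Section Liouville.
Variables (J : finType) (e : J -> R[i]).

(* Multiplication by [w] preserves the Z-span of the [e j], with column sums
   at most [c]. *)
Definition intact (c : nat) w := exists A : J -> J -> int,
  (forall j, (\sum_i `|A i j| <= c)%N) /\
  forall j, w * e j = \sum_i e i * (A i j)%:~R.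

Lemma intact_le c c' w : (c <= c')%N -> intact c w -> intact c' w.
Proof. by move=> cc [A [h ?]]; exists A; split=> // j; apply: leq_trans cc. Qed.

Lemma intact_sub c c' w z : intact c w -> intact c' z -> intact (c + c') (w - z).
Proof.
move=> [A [hA wA]] [B [hB zB]]; exists (fun i j => A i j - B i j); split=> j.
  apply: leq_trans (leq_add (hA j) (hB j)); rewrite -big_split; apply: leq_sum => i _ /=.
  by lia.
rewrite mulrBl wA zB -sumrB; apply: eq_bigr => i _.
by rewrite rmorphB mulrBr.
Qed.

Lemma intact_mul c c' w z : intact c w -> intact c' z -> intact (c * c') (w * z).
Proof.
move=> [A [hA wA]] [B [hB zB]].
exists (fun i j => \sum_k A i k * B k j); split=> j.
  apply: (@leq_trans (\sum_k c * `|B k j|)); last by rewrite -big_distrr leq_mul2l hB orbT.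
  apply: (@leq_trans (\sum_k (\sum_i `|A i k|) * `|B k j|)); last first.
    by apply: leq_sum => k _; rewrite leq_mul2r hA orbT.
  under [leqRHS]eq_bigr do rewrite big_distrl.
  rewrite exchange_big; apply: leq_sum => i _ /=.
  elim/big_rec2: _ => // k y x _ h.
  by apply: leq_trans (leq_add (leqnn _) h); rewrite -abszM; lia.
rewrite -mulrA zB mulr_sumr.
under eq_bigr do rewrite mulrA wA mulr_suml.
rewrite exchange_big; apply: eq_bigr => i _ /=.
rewrite rmorph_sum mulr_sumr; apply: eq_bigr => k _.
by rewrite rmorphM mulrA.
Qed.

Lemma intact_int (n : int) : intact `|n| n%:~R.
Proof.
exists (fun i j => if i == j then n else 0); split=> j.
  by rewrite (bigD1 j)//= eqxx big1 ?addn0// => i /negPf ->.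
rewrite (bigD1 j)//= eqxx big1; first by rewrite addr0 mulrC.
by move=> i /negPf ->; rewrite mulr0.
Qed.

(** The nonzero row of the [e j] is an eigenvector of an integer matrix for the eigenvalue w, and
    column sums bound all eigenvalues by c. The product of the nonzero eigenvalues is, up to sign, a
    nonzero integer, and those besides w contribute at most c each. *)
Lemma liouville j0 c w : e j0 != 0 -> intact c w -> w != 0 -> 1 <= md w * c%:R ^+ #|J|.-1.
Proof.
move=> ej0 [A [hA wA]] w0.
pose n := #|J|; pose M : 'M[int]_n := \matrix_(i, j) A (enum_val i) (enum_val j).
pose MC : 'M[R[i]]_n := map_mx intr M.
have eig v : root (char_poly MC) v -> md v <= c%:R.
  rewrite -eigenvalue_root_char => /eigenvalueP[u uM u0].
  have [k uk] : exists k, u 0 k != 0.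
    apply: contrapT => h; case/negP: u0; apply/eqP/rowP => k; rewrite mxE.
    by apply/eqP; apply: contrapT => /negP h'; apply: h; exists k.
  have [m _ mmax] := @Order.TotalTheory.arg_maxP _ R 'I_n k xpredT (fun k => md (u 0 k)) isT.
  have m0 : 0 < md (u 0 m).
    apply: lt_le_trans (mmax k isT); rewrite lt_neqAle md_ge0 andbT eq_sym md_eq0 //.
  rewrite -(ler_pM2r m0) -mdM.
  have -> : v * u 0 m = \sum_i u 0 i * MC i m.
    by have := congr1 (fun r : 'rV_n => r 0 m) uM; rewrite !mxE => <-.
  apply: le_trans (md_sum _ _) _.
  apply: (@le_trans _ _ (\sum_i (`|M i m|%N)%:R * md (u 0 m))).
    apply: ler_sum => i _; rewrite mdM mxE md_int mulrC; apply: ler_wpM2l => //.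
    exact: mmax.
  rewrite -mulr_suml; apply: ler_wpM2r; first exact: ltW.
  rewrite -natr_sum ler_nat; apply: leq_trans (hA (enum_val m)).
  rewrite leq_eqVlt; apply/orP; left; apply/eqP.
  rewrite [RHS](reindex (@enum_val J predT))//=.
    by apply: eq_bigr => i _; rewrite mxE.
  by exists enum_rank => j _; [exact: enum_valK|exact: enum_rankK].
have rw : root (char_poly MC) w.
  rewrite -eigenvalue_root_char; apply/eigenvalueP.
  exists (\row_k e (enum_val k)).
    apply/rowP => k; rewrite !mxE wA (reindex (@enum_val J predT))//=.
      by apply: eq_bigr => i _; rewrite !mxE.
    by exists enum_rank => j _; [exact: enum_valK|exact: enum_rankK].
  apply/eqP => /rowP/(_ (enum_rank j0)); rewrite !mxE enum_rankK => /eqP.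
  by rewrite (negPf ej0).
pose X := char_poly M.
have XC : char_poly MC = map_poly intr X by rewrite map_char_poly.
have Xm : X \is monic := char_poly_monic M.
(* The matrix may be singular, as the [e j] may be dependent; the power of X is split off to obtain
   a nonzero constant term. *)
have [s [Y Y0 XE]] := multiplicity_XsubC X 0.
move: Y0; rewrite monic_neq0//= => Y0.
rewrite subr0 in XE.
pose YC := map_poly intr Y : {poly R[i]}.
have Ym : Y \is monic.
  by move: Xm; rewrite !monicE XE lead_coefM lead_coefXn mulr1.
have YCm : YC \is monic by rewrite monic_map.
have [rs YE] := closed_field_poly_normal YC.
rewrite (monicP YCm) scale1r in YE.
have rrs v : v \in rs -> root (char_poly MC) v.
  move=> vr; rewrite XC XE rmorphM /= rootM -/YC YE root_prod_XsubC vr //.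
have wr : w \in rs.
  move: rw; rewrite XC XE rmorphM /= map_polyXn rootM -/YC YE root_prod_XsubC.
  by case/orP => //; rewrite /root hornerXn expf_eq0 (negPf w0) andbF.
have srs : (size rs <= n)%N.
  rewrite -ltnS -(size_prod_XsubC rs id) -YE size_map_inj_poly; last 2 first.
  - by move=> x y /intr_inj.
  - by [].
  rewrite -(size_char_poly M) -/X XE size_mulXn ?leq_addl//.
  exact: monic_neq0.
have c1 : 1 <= c%:R :> R.
  have : 0 < md w by rewrite lt_neqAle md_ge0 andbT eq_sym md_eq0.
  move/lt_le_trans/(_ (eig _ rw)); by rewrite ltr0n ler1n.
have Y1 : 1 <= md YC.[0].
  rewrite horner_coef0 coef_map /= md_int ler1n absz_gt0 -horner_coef0.
  by apply: contra Y0 => /eqP h; apply/eqP.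
apply: le_trans Y1 _; rewrite YE horner_prod md_prod.
rewrite (big_rem w)//= !hornerE mdN; apply: ler_wpM2l; first exact: md_ge0.
apply: (@le_trans _ _ (\prod_(v <- rem w rs) c%:R)).
  rewrite [X in X <= _]big_seq [X in _ <= X]big_seq; apply: ler_prod => v vr.
  by rewrite !hornerE mdN md_ge0 eig//; apply/rrs/(mem_rem vr).
rewrite big_const_seq count_predT iter_mulr_1 size_rem//.
by apply: ler_weXn2l => //; rewrite -!subn1 leq_sub2r.
Qed.

Lemma intact_cross q a l H i j B : (0 < H)%N -> (i <= B)%N -> (j <= B)%N ->
  intact H q -> intact H a -> intact H l ->
  intact (4 * hbound H B ^ 2) (hcross q a l i j).
Proof.
move=> H0 iB jB hq ha hl.
apply: (@growth_cross (fun M w _ => intact M w) _ _ _ q q a a l l) => //.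
- by move=> M M' w _; apply: intact_le.
- by move=> M M' w _ z _; apply: intact_sub.
- move=> M M' w _ z _ h h'; apply: intact_le (intact_mul h h').
  by rewrite -mulnA leq_pmull.
by apply: intact_mul => //; apply: (intact_int 4).
Qed.
End Liouville.
End Bounds.

Section Semantics.
Variable R : realType.
Local Notation C := R[i].
Implicit Types z w : C.

(** If all roots were at distance at least d from z, the product of the distances would be at least
    d^n, where d <= 1 allows n to exceed the degree. *)
Lemma root_near (P : {poly C}) n z (d : R) : 1 <= md (lead_coef P) ->
  (size P <= n.+1)%N -> 0 <= d <= 1 -> md P.[z] < d ^+ n ->
  exists2 r, root P r & md (z - r) < d.
Proof.
move=> lP sP /andP[d0 d1] Pz; have [rs PE] := closed_field_poly_normal P.
have P0 : P != 0.
  by apply: contraTneq lP => ->; rewrite lead_coef0 md0 -ltNge ltr01.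
have lc0 : lead_coef P != 0 by rewrite lead_coef_eq0.
apply: contrapT => H; have far r : r \in rs -> d <= md (z - r).
  move=> rr; rewrite leNgt; apply/negP => h; apply: H; exists r => //.
  by rewrite PE rootZ// root_prod_XsubC.
have srs : (size rs <= n)%N.
  by rewrite -ltnS -(size_prod_XsubC rs id) -(size_scale _ lc0) -PE.
move: Pz; rewrite ltNge => /negP; apply.
rewrite PE hornerZ mdM horner_prod md_prod.
apply: (@le_trans _ _ (d ^+ size rs)); first by apply: ler_wiXn2l.
apply: (@le_trans _ _ (\prod_(r <- rs) d)).
  by rewrite big_const_seq count_predT iter_mulr_1.
apply: (@le_trans _ _ (\prod_(r <- rs) md ('X - r%:P).[z])).
  rewrite big_seq [X in _ <= X]big_seq; apply: ler_prod => r rr.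
  by rewrite d0 !hornerE far.
by rewrite ler_peMl// prodr_ge0// => r _; apply: md_ge0.
Qed.

Lemma near_distE (q s : nat) (Z O : int * int) : (0 < q)%N -> (0 < s)%N ->
  md (gz R (gsub (gmul Z (gnat s)) (gmul (gnat q) O))) =
  md (gz R Z / q%:R - gz R O / s%:R) * (q%:R * s%:R).
Proof.
move=> q0 s0; rewrite gzB !gzM !gz_nat.
have q0' : q%:R != 0 :> C by rewrite pnatr_eq0 -lt0n.
have s0' : s%:R != 0 :> C by rewrite pnatr_eq0 -lt0n.
rewrite -(md_nat R q) -(md_nat R s) -!mdM; congr md.
by field; rewrite s0' q0'.
Qed.

Lemma ltr_nat_sqr (x y : R) (m n : nat) : 0 <= x -> m%:R = x ^+ 2 -> y = n%:R ->
  (m < n ^ 2)%N = (x < y).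
Proof. by move=> x0 e ->; rewrite -(ltr_nat R) natrX e ltr_pXn2r ?nnegrE. Qed.

Lemma nearP q K Z O s : (0 < q)%N -> (0 < s)%N -> (s < K)%N ->
  near q K Z O s = (md (gz R Z / q%:R - gz R O / s%:R) < s%:R^-1 - K%:R^-1).
Proof.
move=> q0 s0 sK; have K0 : (0 < K)%N by apply: ltn_trans sK.
have q0' : 0 < q%:R :> R by rewrite ltr0n.
have s0' : 0 < s%:R :> R by rewrite ltr0n.
have K0' : 0 < K%:R :> R by rewrite ltr0n.
set x := md _; have x0 : 0 <= x by apply: md_ge0.
rewrite /near (@ltr_nat_sqr (x * (q%:R * s%:R) * K%:R) (q * (K - s))%:R)//.
- rewrite natrM natrB; last exact: ltnW.
  rewrite (_ : q%:R * (K%:R - s%:R) = (s%:R^-1 - K%:R^-1) * (q%:R * s%:R * K%:R) :> R); last first.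
    by field; rewrite !gt_eqF.
  by rewrite -mulrA ltr_pM2r// !mulr_gt0.
- by rewrite !mulr_ge0.
- by rewrite natrM natrX gnormE near_distE// -exprMn.
Qed.

Lemma farP q K Z O s : (0 < q)%N -> (0 < s)%N -> (s < K)%N ->
  far q K Z O s = (s%:R^-1 + K%:R^-1 <= md (gz R Z / q%:R - gz R O / s%:R)).
Proof.
move=> q0 s0 sK; have K0 : (0 < K)%N by apply: ltn_trans sK.
have q0' : 0 < q%:R :> R by rewrite ltr0n.
have s0' : 0 < s%:R :> R by rewrite ltr0n.
have K0' : 0 < K%:R :> R by rewrite ltr0n.
set x := md _; have x0 : 0 <= x by apply: md_ge0.
rewrite /far leqNgt (@ltr_nat_sqr (x * (q%:R * s%:R) * K%:R) (q * (K + s))%:R)//.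
- rewrite natrM natrD.
  rewrite (_ : q%:R * (K%:R + s%:R) = (s%:R^-1 + K%:R^-1) * (q%:R * s%:R * K%:R) :> R); last first.
    by field; rewrite !gt_eqF.
  by rewrite -mulrA ltr_pM2r ?leNgt// !mulr_gt0.
- by rewrite !mulr_ge0.
- by rewrite natrM natrX gnormE near_distE// -exprMn.
Qed.

Lemma small_normP (g : int * int) (q K n : nat) z : (0 < q)%N -> (0 < K)%N ->
  gz R g = q%:R ^+ n * z ->
  (gnorm g * K ^ (2 * n) < q ^ (2 * n))%N = (md z < K%:R^-1 ^+ n).
Proof.
move=> q0 K0 ge.
have q0' : 0 < q%:R :> R by rewrite ltr0n.
have K0' : 0 < K%:R :> R by rewrite ltr0n.
have z0 := md_ge0 z.
rewrite [in RHS]exprVn -[X in _ = (_ < X)]mul1r ltr_pdivlMr ?exprn_gt0//.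
rewrite -(ltr_nat R) natrM !natrX gnormE ge mdM mdX md_nat.
rewrite ![(2 * n)%N]mulnC !exprM -exprMn ltr_pXn2r ?nnegrE ?mulr_ge0 ?exprn_ge0//.
by rewrite -mulrA -[X in _ < X]mulr1 ltr_pM2l ?exprn_gt0.
Qed.

Section Input.
Variables (c : nat) (a : C).
Hypothesis ca : codes_number c a.

Definition ipoly (c : nat) : {poly int} :=
  Poly [seq int_decode m | m <- CodeSeq.decode (fld c 0)].

Lemma ipolyE i : (ipoly c)`_i = pcoef c i.
Proof.
rewrite /ipoly coef_Poly /pcoef; have [h|h] := ltnP i (size (CodeSeq.decode (fld c 0))).
  by rewrite (nth_map 0%N).
by rewrite !nth_default// size_map.
Qed.

Lemma size_ipoly : (size (ipoly c) <= psize c)%N.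
Proof. by rewrite (leq_trans (size_Poly _))// size_map. Qed.

Lemma poly_decodeE : poly_decode R (fld c 0) = map_poly intr (ipoly c).
Proof.
apply/polyP => i; rewrite coef_map /= ipolyE /poly_decode coef_Poly /pcoef.
have [h|h] := ltnP i (size (CodeSeq.decode (fld c 0))).
  by rewrite (nth_map 0%N).
by rewrite [LHS]nth_default ?size_map// nth_default.
Qed.

Let P : {poly C} := map_poly intr (ipoly c).

Lemma input_spec : ipoly c != 0 /\ forall w,
  root P w /\ md (w - gz R (center c) / (rad c)%:R) < (rad c)%:R^-1 <-> w = a.
Proof.
have [p [x [y [d [cE P0 H]]]]] := ca.
have dE : CodeSeq.decode c = [:: p; x; y; d] by rewrite cE CodeSeq.codeK.
have pE : p = fld c 0 by rewrite /fld dE.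
move: P0 H; rewrite pE !poly_decodeE /= -/P => P0 H; split.
  by apply: contraNneq P0 => e; rewrite /P e rmorph0.
have -> : gz R (center c) / (rad c)%:R = ((int_decode x)%:~R / d.+1%:R) +i* ((int_decode y)%:~R / d.+1%:R).
  rewrite gzE /center /rad /fld dE /= -[d.+1%:R](rmorph_nat (real_complex R)) -fmorphV /=.
  by simpc.
move=> w; rewrite -H -md_lt /rad /fld dE /=.
by rewrite fmorphV rmorph_nat.
Qed.
End Input.
End Semantics.

(** * The gap between zero and nonzero cross products *)

Section Gap.
Variable R : realType.
Local Notation C := R[i].
Variables (c : nat) (a lam : C).
Hypothesis ca : codes_number c a.
Hypothesis lamN : lam ^+ order c = 1.

Lemma order_gt0 : (0 < order c)%N.
Proof. by rewrite /order muln_gt0 fact_gt0. Qed.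

Lemma height_ge2 : (2 <= height c)%N.
Proof. by rewrite /height leq_addl. Qed.

Lemma iteri_sum (f : nat -> nat) n :
  iteri n (fun i r => (r + f i)%N) 0%N = (\sum_(i < n) f i)%N.
Proof. by elim: n => [|n IH] /=; rewrite ?big_ord0// big_ord_recr /= IH. Qed.

Lemma sum_pcoef : (\sum_(i < size (ipoly c)) `|((ipoly c)`_i)%R| <= height c)%N.
Proof.
rewrite /height iteri_sum; apply: leq_trans (leq_addr _ _).
apply: leq_trans (leq_addr _ _); apply: leq_trans (leq_addr _ _).
rewrite (big_ord_widen (psize c) (fun i => `|((ipoly c)`_i)%R|)%N (size_ipoly c)).
rewrite big_mkcond /=; apply: leq_sum => i _; case: ifP => // _.
by rewrite ipolyE.
Qed.

Lemma root_input : root (map_poly intr (ipoly c) : {poly C}) a.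
Proof. by have [_ H] := input_spec ca; case: (proj2 (H a) erefl). Qed.

Let d := (size (ipoly c)).-2.

Lemma size_ipolyE : size (ipoly c) = d.+2.
Proof.
have [p0 _] := input_spec ca.
case E : (size (ipoly c)) => [|[|n]]; last by rewrite /d E.
  by move/eqP: E; rewrite size_poly_eq0 (negPf p0).
move/eqP: E => /size_poly1P[k k0 pE]; have := root_input.
by rewrite pE map_polyC /= rootC intr_eq0 (negPf k0).
Qed.

Let J := ('I_d.+1 * 'I_(order c))%type.
Let e (ij : J) : C := a ^+ ij.1 * lam ^+ ij.2.
Let q := lead_coef (ipoly c).

Lemma lead_height : (`|q| <= height c)%N.
Proof.
apply: leq_trans sum_pcoef; rewrite /q lead_coefE size_ipolyE /= big_ord_recr /=.
by rewrite leq_addl.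
Qed.

Lemma intact_lead : intact e (height c) q%:~R.
Proof. exact: intact_le lead_height (intact_int e q). Qed.

Lemma intact_lam : intact e 1 lam.
Proof.
pose nx (j : J) : J := (j.1, Ordinal (ltn_pmod j.2.+1 order_gt0)).
exists (fun i j : J => if i == nx j then 1 else 0); split=> j.
  by rewrite (bigD1 (nx j))//= eqxx big1 // => i /negPf ->.
rewrite (bigD1 (nx j))//= eqxx big1 ?addr0 ?mulr1 => [|i /negPf ->]; last by rewrite mulr0.
rewrite /e /= mulrCA -exprS {1}(divn_eq j.2.+1 (order c)).
by rewrite exprD mulnC exprM lamN expr1n mul1r.
Qed.

(** On powers of a this is the companion matrix scaled by the leading coefficient: q below the
    diagonal and the negated lower coefficients in the last column. *)
Lemma intact_root : intact e (height c) (q%:~R * a).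
Proof.
pose A (i j : J) : int := if i.2 == j.2 then
  (if (j.1 < d)%N then (if i.1 == j.1.+1 :> nat then q else 0) else - (ipoly c)`_i.1) else 0.
exists A; split=> [[j1 j2]|[j1 j2]].
  apply: (@leq_trans (\sum_(i : 'I_d.+1) `|A (i, j2) (j1, j2)|)).
    rewrite -(pair_bigA _ (fun i k => `|A (i, k) (j1, j2)|%N)) /=; apply: leq_sum => i _.
    by rewrite (bigD1 j2)//= big1 ?addn0// => k /negPf kj; rewrite /A /= kj.
  rewrite /A /= eqxx; case: (ltnP j1 d) => jd.
    have jd' : (j1.+1 < d.+1)%N by [].
    rewrite (bigD1 (Ordinal jd'))//= eqxx big1 ?addn0; first exact: lead_height.
    by move=> i /negPf h; rewrite (_ : (_ == _) = false)//; apply/negP => /eqP h'; move/eqP: h; apply; apply: val_inj.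
  apply: leq_trans sum_pcoef; rewrite size_ipolyE [leqRHS]big_ord_recr /=.
  by apply: leq_trans (leq_addr _ _); apply: leq_sum => i _; rewrite abszN.
rewrite -(pair_bigA _ (fun i k => e (i, k) * (A (i, k) (j1, j2))%:~R)) /=.
rewrite (eq_bigr (fun i : 'I_d.+1 => a ^+ i * (A (i, j2) (j1, j2))%:~R * lam ^+ j2)); last first.
  move=> i _; rewrite (bigD1 j2)//= big1 ?addr0; first by rewrite /e /= mulrAC.
  by move=> k /negPf kj; rewrite /A /= kj mulr0.
rewrite -mulr_suml /e /= mulrA; congr (_ * _).
rewrite /A /= eqxx; case: (ltnP j1 d) => jd.
  have jd' : (j1.+1 < d.+1)%N by [].
  rewrite (bigD1 (Ordinal jd'))//= eqxx big1 ?addr0; first by rewrite exprS; ring.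
  move=> i /negPf h; have -> : (i == j1.+1 :> nat) = false; last by rewrite mulr0.
  by apply/negP => /eqP h'; move/eqP: h; apply; apply: val_inj.
have -> : j1 = d :> nat by apply/eqP; rewrite eqn_leq -ltnS ltn_ord jd.
have := root_input; rewrite /root horner_coef size_map_inj_poly ?size_ipolyE//; last first.
  exact: intr_inj.
rewrite big_ord_recr /= !coef_map /= => /eqP h.
have -> : q%:~R * a * a ^+ d = ((ipoly c)`_d.+1)%:~R * a ^+ d.+1.
  by rewrite /q lead_coefE size_ipolyE /= exprS mulrA.
apply/eqP; rewrite -subr_eq0 -sumrN addrC; apply/eqP; rewrite -[RHS]h; congr (_ + _).
by apply: eq_bigr => i _; rewrite coef_map /= rmorphN mulrN opprK mulrC.
Qed.

Lemma height_gt0 : (0 < height c)%N.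
Proof. by apply: leq_trans height_ge2. Qed.

Lemma crossbound_gt0 : (0 < crossbound c)%N.
Proof.
by rewrite /crossbound muln_gt0 expn_gt0 (leq_trans height_gt0 (hbound_ge _ height_gt0)).
Qed.

(** Scaling by the leading coefficient q replaces (1, a, lam) by (q, q a, q lam), all acting through
    integer matrices. [liouville] applies to the scaled cross product; the power of [height c] in
    [gap] undoes the scaling. *)
Lemma gap_cross i j : (i <= olength c)%N -> (j <= olength c)%N ->
  hcross 1 a lam i j != 0 -> 1 <= md (hcross 1 a lam i j) * (gap c)%:R.
Proof.
move=> iB jB nz; have [p0 _] := input_spec ca.
have q0 : q != 0 by rewrite lead_coef_eq0.
have qC0 : q%:~R != 0 :> C by rewrite intr_eq0.
have ilam : intact e (height c) (q%:~R * lam).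
  by have := intact_mul intact_lead intact_lam; rewrite muln1.
have j0 : e (ord0, Ordinal order_gt0) != 0 by rewrite /e /= !expr0 mulr1 oner_neq0.
have := liouville j0 (intact_cross height_gt0 iB jB intact_lead intact_root ilam).
rewrite hcross_scale mulf_neq0 ?expf_neq0// => /(_ isT) h.
apply: le_trans h _; rewrite mdM mdX md_int -/(crossbound c).
rewrite mulrAC [X in X <= _]mulrC; apply: ler_wpM2l; first exact: md_ge0.
rewrite /gap natrM mulrC !natrX; apply: ler_pM; rewrite ?exprn_ge0//.
- apply: ler_weXn2l; first by rewrite ler1n crossbound_gt0.
  rewrite card_prod !card_ord /dim; apply: leq_trans (leq_pred _) _.
  by rewrite leq_mul2r; have := size_ipoly c; rewrite size_ipolyE => /ltnW ->; rewrite orbT.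
- apply: (@le_trans _ _ ((height c)%:R ^+ (hdegree i + hdegree j))).
    by rewrite lerXn2r ?nnegrE// ler_nat lead_height.
  apply: ler_weXn2l; first by rewrite ler1n height_gt0.
  by rewrite mul2n -addnn leq_add// hdegree_mono.
Qed.
End Gap.

(** * Torsion parameters that are roots of unity *)

Local Open Scope classical_set_scope.

Section TorsionSet.
Variable R : realType.
Implicit Types a lam : R[i].

Lemma T_preperiodic a lam :
  T a lam <-> [/\ lam <> 0, lam <> 1 & preperiodic lam a].
Proof.
have n2 : 2 != 0 :> R[i] by rewrite pnatr_eq0.
have tor y : lam <> 0 -> lam <> 1 -> on_legendre lam (Some (a, y)) ->
    (exists2 n, (0 < n)%N & legendre_mul lam n (Some (a, y)) = None) <-> preperiodic lam a.
  by move=> /eqP l0 /eqP l1 o; exact: (torsion_preperiodic n2 l0 l1 o).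
split=> [[l0 l1 [y [o t]]]|[l0 l1 per]]; first by split=> //; apply/(tor y).
have [y yE] : exists y : R[i], y ^+ 2 = a * (a - 1) * (a - lam).
  by exists (sqrtc (a * (a - 1) * (a - lam))); rewrite sqr_sqrtc.
split=> //; exists y; have o : on_legendre lam (Some (a, y)) by rewrite /= yE.
by split=> //; apply/(tor y).
Qed.

Lemma roots_of_unityP (z : R[i]) :
  roots_of_unity R z <-> exists2 n, (0 < n)%N & z ^+ n = 1.
Proof.
by split=> -[n n0]; [rewrite unity_rootE => /eqP|move=> h]; exists n => //;
  rewrite unity_rootE h.
Qed.

Lemma T_unity a lam : (T a `&` roots_of_unity R) lam <->
  [/\ lam != 1, preperiodic lam a & exists2 n, (0 < n)%N & lam ^+ n = 1].
Proof.
split=> [[/T_preperiodic[l0 l1 per] /roots_of_unityP h]|[l1 per h]].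
  by split=> //; apply/eqP.
split; last exact/roots_of_unityP.
apply/T_preperiodic; split=> //; last exact/eqP.
by case: h => n n0 ln; apply/eqP; apply: unity_neq0 ln.
Qed.

Section Valued.
Variable V : set R[i].
Hypotheses (hV : no_half_subring V) (Vt : forall x, V x \/ V x^-1).

Lemma T_unity_close a lam : a != 0 -> a != 1 ->
  (T a `&` roots_of_unity R) lam -> lam != a ->
  [/\ V a, vle V 1 a & vle V (lam - a ^+ 2) 2].
Proof.
move=> a0 a1 /T_unity[l1 per [n n0 ln]] la.
by case: (unity_close hV Vt a0 a1 n0 ln l1 per) => // e; rewrite e eqxx in la.
Qed.

Lemma T_unity_pm a lam lam' : a != 0 -> a != 1 ->
  (T a `&` roots_of_unity R) lam -> lam != a ->
  (T a `&` roots_of_unity R) lam' -> lam' != a -> lam' = lam \/ lam' = - lam.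
Proof.
move=> a0 a1 Tl la Tl' la'.
have [_ _ h] := T_unity_close a0 a1 Tl la.
have [_ _ h'] := T_unity_close a0 a1 Tl' la'.
case/T_unity: Tl => _ _ [n n0 ln]; case/T_unity: Tl' => _ _ [n' n'0 ln'].
have l0 := unity_neq0 n0 ln.
have V1l : V lam^-1 by apply: (unity_V hV Vt n0); rewrite exprVn ln invr1.
have : lam' / lam = 1 \/ lam' / lam = -1.
  apply: (unity_mod2 hV Vt (n := n * n')); first by rewrite muln_gt0 n0.
    by rewrite exprMn exprVn {1}mulnC !exprM ln ln' !expr1n invr1 mulr1.
  have -> : lam' / lam - 1 = lam^-1 * ((lam' - a ^+ 2) - (lam - a ^+ 2)) by field.
  by apply: (vle_trans hV (vle_mulV _ V1l)); apply: vle_sub.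
case=> e; [left|right].
  by rewrite -[LHS](divfK l0) e mul1r.
by rewrite -[LHS](divfK l0) e mulN1r.
Qed.

Lemma T_unity_root a lam : roots_of_unity R a -> a != 1 ->
  (T a `&` roots_of_unity R) lam -> [\/ lam = a, lam = a ^+ 2 | lam = - a ^+ 2].
Proof.
move=> /roots_of_unityP[m m0 am] a1 Tl.
have a0 := unity_neq0 m0 am.
have [->|la] := eqVneq lam a; first by constructor 1.
have [_ _ h] := T_unity_close a0 a1 Tl la.
case/T_unity: Tl => _ _ [n n0 ln].
have Va : V (a ^- 2) by apply: (unity_V hV Vt m0); rewrite exprVn exprAC am expr1n invr1.
have a20 : a ^+ 2 != 0 by rewrite expf_neq0.
have : lam / a ^+ 2 = 1 \/ lam / a ^+ 2 = -1.
  apply: (unity_mod2 hV Vt (n := n * m)); first by rewrite muln_gt0 n0.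
    by rewrite exprMn exprVn exprM ln expr1n mul1r mulnC exprM [_ ^+ _ ^+ m]exprAC am !expr1n invr1.
  have -> : lam / a ^+ 2 - 1 = a ^- 2 * (lam - a ^+ 2) by field.
  exact: (vle_trans hV (vle_mulV _ Va)).
case=> e; [constructor 2|constructor 3].
  by rewrite -[LHS](divfK a20) e mul1r.
by rewrite -[LHS](divfK a20) e mulN1r.
Qed.
End Valued.

(** For [lam = a] the point has ordinate 0, so its double is infinity. *)
Lemma preperiodic_self a : a != 1 -> preperiodic a a.
Proof. by move=> a1; exists 1%N, 2%N; rewrite /= subrr mulr0 eqxx. Qed.

(** For [lam = a ^+ 2] the double has abscissa 0, hence order two: the point has order four. *)
Lemma preperiodic_sqr a : a != 0 -> a != 1 -> preperiodic (a ^+ 2) a.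
Proof.
move=> a0 a1; exists 2%N, 3%N; split=> //=.
have -> : a * (a - 1) * (a - a ^+ 2) == 0 = false.
  apply/negbTE; rewrite (_ : a - a ^+ 2 = a * (1 - a)); last by ring.
  by rewrite !mulf_neq0// subr_eq0// eq_sym.
by rewrite /= subrr expr0n /= !mul0r eqxx.
Qed.

Lemma card_T_unity a : a != 0 -> a != 1 ->
  ((T a `&` roots_of_unity R) `\ a #<= `I_2)%card.
Proof.
move=> a0 a1; have [V [hV Vt]] := exists_valuation_ring R[i].
set S := _ `\ a.
have [->|/set0P[l [Tl la]]] := eqVneq S set0; first exact: card_ge0.
apply: (@card_le_trans _ _ _ [set l; - l]).
  apply: subset_card_le => l' [Tl' la'].
  by apply: (T_unity_pm hV Vt a0 a1 Tl _ Tl'); apply/eqP.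
apply: (@card_le_trans _ _ _ ((fun k : nat => if k == 0%N then l else - l) @` `I_2)).
  apply: subset_card_le => x [->|->]; [by exists 0%N|by exists 1%N].
exact: card_image_le.
Qed.

Lemma T_root_of_unity a : roots_of_unity R a -> a <> 1 -> a <> -1 ->
  [set a; a ^+ 2] `<=` T a `&` roots_of_unity R /\
  T a `&` roots_of_unity R `<=` [set a; a ^+ 2; - (a ^+ 2)].
Proof.
move=> ua /eqP a1 /eqP aN1; have [V [hV Vt]] := exists_valuation_ring R[i].
have /roots_of_unityP[m m0 am] := ua.
have a0 := unity_neq0 m0 am.
split=> [x [->|->]|x /(T_unity_root hV Vt ua a1)[->|->|->]]; last 3 first.
- by left; left.
- by left; right.
- by right.
- by apply/T_unity; split=> //; [exact: preperiodic_self|exists m].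
apply/T_unity; split; [|exact: preperiodic_sqr|].
  by rewrite sqrf_eq1 negb_or a1.
by exists m => //; rewrite exprAC am expr1n.
Qed.

(** Here a^2 = 1 is not an admissible parameter and -a^2 coincides with a. *)
Lemma T_minus_one : T (-1 : R[i]) `&` roots_of_unity R = [set -1].
Proof.
have [V [hV Vt]] := exists_valuation_ring R[i].
have n11 : -1 != 1 :> R[i].
  by rewrite -subr_eq0 (_ : -1 - 1 = - 2) ?oppr_eq0 ?pnatr_eq0//; ring.
have u1 : roots_of_unity R (-1) by apply/roots_of_unityP; exists 2%N => //; ring.
apply/seteqP; split=> [x Tx|x ->].
  have [//|e|e] := T_unity_root hV Vt u1 n11 Tx; last by rewrite e /=; ring.
  by case/T_unity: Tx; rewrite e sqrrN expr1n eqxx.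
apply/T_unity; split=> //; first exact: preperiodic_self.
by exists 2%N => //; ring.
Qed.
End TorsionSet.

(** * Correctness of the algorithm *)

Lemma allnP n P : alln n P <-> forall i, (i < n)%N -> P i.
Proof.
elim: n => [|n IH]; first by [].
rewrite /alln /= -/(alln n P); split=> [/andP[/IH h hn] i|h].
  by rewrite ltnS leq_eqVlt => /orP[/eqP->//|/h].
by apply/andP; split; [apply/IH => i iN; apply: h; apply: ltnW|apply: h].
Qed.

Lemma exnP n P : exn n P <-> exists2 i, (i < n)%N & P i.
Proof.
elim: n => [|n IH]; first by split=> // -[].
rewrite /exn /= -/(exn n P); split=> [/orP[/IH[i iN Pi]|Pn]|].
- by exists i => //; apply: ltnW.
- by exists n.
case=> i; rewrite ltnS leq_eqVlt => /orP[/eqP -> ->|iN Pi]; first by rewrite orbT.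
by apply/orP; left; apply/IH; exists i.
Qed.

Lemma iteri_filter A (sel : nat -> bool) (f : nat -> A) n :
  iteri n (fun i r => cond (sel i) (f i :: r) r) [::] =
  rev [seq f i | i <- iota 0 n & sel i].
Proof.
elim: n => [|n IH] //; rewrite -[in RHS]addn1 iotaD filter_cat map_cat rev_cat /= -IH.
by rewrite /cond add0n; case: (sel n).
Qed.

Lemma hvalE (R : realType) c q A : (0 < q)%N ->
  gz R (hval c q A) = q%:R ^+ psize c * (map_poly intr (ipoly c)).[gz R A / q%:R].
Proof.
move=> q0.
have q0' : q%:R != 0 :> R[i] by rewrite pnatr_eq0 -lt0n.
rewrite (horner_coef_wide _ (n := psize c)); last first.
  by apply: leq_trans (size_ipoly c); exact: size_poly.
have H n : gz R (iteri n (fun i r => gadd r (gmul (pcoef c i, Posz 0)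
     (gmul (gpow A i) (gnat (q ^ (psize c - i)))))) (gnat 0)) =
   \sum_(i < n) (pcoef c i)%:~R * (gz R A ^+ i * (q ^ (psize c - i))%:R).
  elim: n => [|n IH]; first by rewrite big_ord0 gz_nat.
  by rewrite big_ord_recr /= gzD IH !gzM gz_int gzX gz_nat.
rewrite /hval H mulr_sumr; apply: eq_bigr => i _.
rewrite coef_map ipolyE /= expr_div_n natrX.
rewrite -[in q%:R ^+ psize c](subnK (ltnW (ltn_ord i))) exprD.
by field; rewrite expf_neq0.
Qed.

(** * An accepted witness determines the set *)

Section Soundness.
Variable R : realType.
Local Notation C := R[i].
Variables (c w : nat) (a : C).
Hypotheses (ca : codes_number c a) (a0 : a != 0) (a1 : a != 1) (cw : check c w).

Let q := wq w.
Let K := wk w.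
Let N := order c.
Let P : {poly C} := map_poly intr (ipoly c).
Let a' : C := gz R (wa w) / q%:R.
Let zeta' i : C := gz R (wz w i) / q%:R.
Let ctr i : C := gz R (wo w i) / (wt w)%:R.

Lemma check_bounds : [/\ (0 < q)%N, (2 * crossbound c * gap c < K)%N,
  (rad c < K)%N & (wt w < K)%N].
Proof. by move: cw; rewrite /check -!andbA => /and5P[-> -> -> ->]. Qed.

Let q0 : (0 < q)%N. Proof. by case: check_bounds. Qed.
Let K0 : (0 < K)%N. Proof. by case: check_bounds => _ _ _; apply: leq_ltn_trans. Qed.
Let K0' : 0 < K%:R :> R. Proof. by rewrite ltr0n. Qed.
Let Ki0 : 0 <= K%:R^-1 :> R. Proof. by rewrite invr_ge0. Qed.
Let K1 : K%:R^-1 <= 1 :> R. Proof. by rewrite invf_le1// ler1n. Qed.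

Lemma rat_input : exists p : {poly rat},
  [/\ p != 0, root (map_poly ratr p) a & (size p <= (psize c).+1)%N].
Proof.
have [p0 _] := input_spec ca; exists (map_poly intr (ipoly c)); split.
- by rewrite map_poly_eq0_id0 // intr_eq0 lead_coef_eq0.
- rewrite -map_poly_comp (@eq_map_poly _ _ _ intr) => [|z /=]; last by rewrite ratr_int.
  exact: root_input ca.
- by apply: leq_trans (size_poly _ _) _; apply: leqW; apply: size_ipoly.
Qed.

(** Some root lies within 1/K of the approximation, and the margin 1/K in [near] keeps it inside the
    coded disc, whose only root is a. *)
Lemma approx_rootP : md (a' - a) < K%:R^-1.
Proof.
have [_ _ rK _] := check_bounds.
move: cw => /andP[/andP[_ /andP[nr sm]] _].
have [p0 H] := input_spec ca.
rewrite (@nearP R)// in nr; rewrite (small_normP q0 K0 (hvalE R c _ q0)) in sm.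
have [|||r rP ra] := root_near _ _ _ sm.
- rewrite lead_coef_map_eq ?intr_eq0 ?lead_coef_eq0// md_int ler1n absz_gt0.
  by rewrite lead_coef_eq0.
- by apply: leq_trans (size_poly _ _) _; apply: leq_trans (size_ipoly c) _.
- by rewrite Ki0 K1.
suff <- : r = a by [].
apply/(H r); split=> //.
have -> : r - gz R (center c) / (rad c)%:R = (a' - gz R (center c) / (rad c)%:R) - (a' - r) by ring.
by apply: le_lt_trans (md_sub _ _) _; rewrite -ltrBrDr; apply: lt_le_trans nr _; rewrite lerD2l lerN2 ltW.
Qed.

Lemma exists_zeta : exists zeta : nat -> C, forall i, (i < N)%N ->
  zeta i ^+ N = 1 /\ md (zeta' i - zeta i) < K%:R^-1.
Proof.
suff H i : exists z : C, (i < N)%N -> z ^+ N = 1 /\ md (zeta' i - z) < K%:R^-1.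
  by have [z hz] := choice H; exists z.
have [iN|] := boolP (i < N)%N; last by exists 0.
move: cw => /andP[_ /allnP/(_ _ iN)/andP[sm _]].
have N0 : (0 < N)%N := order_gt0 c.
have q0' : q%:R != 0 :> C by rewrite pnatr_eq0 -lt0n.
have E : gz R (gsub (gpow (wz w i) N) (gnat (q ^ N))) = q%:R ^+ N * ('X^N - 1%:P).[zeta' i].
  rewrite gzB gzX gz_nat natrX !hornerE /zeta' expr_div_n.
  by field; rewrite expf_neq0.
rewrite /approx_unity (small_normP q0 K0 E) in sm.
have [|||r rP ra] := root_near _ _ _ sm.
- by rewrite (monicP (monicXnsubC _ N0)) md1.
- by rewrite size_XnsubC.
- by rewrite Ki0 K1.
exists r => _; split=> //.
by move: rP; rewrite /root !hornerE subr_eq0 => /eqP.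
Qed.

Section Zeta.
Variable zeta : nat -> C.
Hypothesis zetaP : forall i, (i < N)%N -> zeta i ^+ N = 1 /\ md (zeta' i - zeta i) < K%:R^-1.

Lemma zeta_disc i : (i < N)%N -> md (zeta i - ctr i) < (wt w)%:R^-1.
Proof.
move=> iN; have [_ _ _ tK] := check_bounds.
move: cw => /andP[_ /allnP/(_ _ iN)/andP[_ /allnP/(_ _ iN)]].
rewrite /cond eqxx (@nearP R)// -/q -/K => h.
have -> : zeta i - ctr i = (zeta' i - ctr i) - (zeta' i - zeta i) by ring.
apply: le_lt_trans (md_sub _ _) _; rewrite -ltrBrDr; apply: lt_le_trans h _.
by rewrite lerD2l lerN2 ltW//; case: (zetaP iN).
Qed.

Lemma zeta_notdisc i j : (i < N)%N -> (j < N)%N -> i != j ->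
  (wt w)%:R^-1 < md (zeta j - ctr i).
Proof.
move=> iN jN ij; have [_ _ _ tK] := check_bounds.
move: cw => /andP[_ /allnP/(_ _ iN)/andP[_ /allnP/(_ _ jN)]].
rewrite /cond (negPf ij) (@farP R)// -/q -/K => h.
have [_ hj] := zetaP jN.
have : md (zeta' j - ctr i) <= md (zeta j - ctr i) + md (zeta' j - zeta j).
  have -> : zeta' j - ctr i = (zeta j - ctr i) + (zeta' j - zeta j) by ring.
  exact: md_add.
move=> h2; rewrite -(ltrD2r K%:R^-1); apply: le_lt_trans h _.
by apply: le_lt_trans h2 _; rewrite ltrD2l.
Qed.

Lemma zeta_inj i j : (i < N)%N -> (j < N)%N -> zeta i = zeta j -> i = j.
Proof.
move=> iN jN e; apply/eqP; apply: contrapT => /negP ij.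
have := zeta_notdisc iN jN ij; rewrite -e.
by rewrite ltNge ltW// zeta_disc.
Qed.

(** Separation makes the N approximated roots distinct, so they exhaust the roots of X^N - 1: no
    witness can omit one. *)
Lemma zeta_surj z : z ^+ N = 1 -> exists2 i, (i < N)%N & z = zeta i.
Proof.
move=> zN; have N0 : (0 < N)%N := order_gt0 c.
have [h|h] := boolP (z \in mkseq zeta N).
  by case/mapP: h => i; rewrite mem_iota => iN ->; exists i.
pose Q : {poly C} := 'X^N - 1%:P.
have : (size (z :: mkseq zeta N) < size Q)%N.
  apply: max_poly_roots; first by rewrite -size_poly_gt0 size_XnsubC.
    rewrite /= {1}/root !hornerE zN subrr eqxx /=; apply/allP => y; case/mapP => i.
    rewrite mem_iota => iN ->; rewrite /root !hornerE.
    by case: (zetaP (i := i)) => // -> _; rewrite subrr.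
  rewrite /= h /= map_inj_in_uniq ?iota_uniq// => i j.
  by rewrite !mem_iota /= add0n => iN jN; apply: zeta_inj.
by rewrite size_XnsubC// /= size_mkseq ltnn.
Qed.

(** Centres lie in (1/t) Z[i] and radii are 1/t, so a centre whose disc contains 1 is a Gaussian
    integer of norm less than 1 away from t, after scaling by t, and must be 1. Conversely, a disc
    centred at 1 contains the root 1 and only [zeta i]. *)
Lemma zeta1 i : (i < N)%N ->
  ((`|((wo w i).1 + - Posz (wt w))%R| == 0%N) && (`|(wo w i).2| == 0%N)) = (zeta i == 1).
Proof.
move=> iN; have t0 : 0 < (wt w)%:R :> R by rewrite ltr0n.
have t0' : (wt w)%:R != 0 :> C by rewrite pnatr_eq0.
apply/idP/eqP => [/andP[/eqP e1 /eqP e2]|e].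
  have [j jN zj] : exists2 j, (j < N)%N & 1 = zeta j by apply: zeta_surj; rewrite expr1n.
  have c1 : ctr i = 1.
    have -> : ctr i = gz R ((wt w)%:Z, 0) / (wt w)%:R.
      rewrite /ctr; congr (gz R _ / _); rewrite [LHS]surjective_pairing.
      by congr pair; move: e1 e2; clear; lia.
    by rewrite gz_int divff.
  have [<-|ij] := eqVneq j i; first by rewrite -zj.
  have := zeta_notdisc iN jN; rewrite eq_sym ij => /(_ isT).
  by rewrite -zj c1 subrr md0 ltNge invr_ge0 ltW.
have := zeta_disc iN; rewrite e md_dist => h.
have : (gnorm (gsub (wo w i) (gnat (wt w))) < 1 ^ 2)%N.
  rewrite (@ltr_nat_sqr R (md (ctr i - 1) * (wt w)%:R) 1)//.
  - by rewrite -ltr_pdivlMr// div1r.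
  - by rewrite mulr_ge0 ?md_ge0.
  - rewrite gnormE gzB gz_nat -(md_nat R (wt w)) -mdM; congr (md _ ^+ 2).
    by rewrite /ctr mulrBl mul1r divfK.
rewrite /gnorm /gsub /= exp1n ltnS leqn0 addn_eq0 !expn_eq0 /= !andbT.
by clear; move=> /andP[h1 h2]; apply/andP; split; move: h1 h2; lia.
Qed.

Lemma md_a : md a <= (height c)%:R /\ md a' <= (height c)%:R.
Proof.
have [_ H] := input_spec ca; have [_ h] := proj2 (H a) erefl.
have r1 : (rad c)%:R^-1 <= 1 :> R by rewrite invf_le1 ?ler1n// ltr0n.
have hc : md (gz R (center c) / (rad c)%:R) <= (`|(center c).1| + `|(center c).2|)%:R.
  rewrite mdM mdV md_nat; apply: (@le_trans _ _ (md (gz R (center c)))).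
    by rewrite ler_piMr ?md_ge0.
  rewrite /gz; apply: le_trans (md_add _ _) _; rewrite mdM !md_int natrD.
  have -> : md 'i = 1 :> R.
    by apply/eqP; rewrite -(@eqrXn2 _ 2) ?md_ge0// expr1n -mdX sqr_i mdN md1.
  by rewrite mul1r.
have hH : (`|(center c).1| + `|(center c).2|)%:R + 2 <= (height c)%:R :> R.
  by rewrite -natrD ler_nat /height leq_add2r -addnA leq_addl.
have ha : md a <= (`|(center c).1| + `|(center c).2|)%:R + 1.
  have -> : a = gz R (center c) / (rad c)%:R + (a - gz R (center c) / (rad c)%:R) by ring.
  apply: le_trans (md_add _ _) _; apply: lerD => //.
  by apply: le_trans r1; apply: ltW.
split; first by apply: le_trans ha _; apply: le_trans hH; rewrite lerD2l ler1n.
have -> : a' = a + (a' - a) by ring.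
apply: le_trans (md_add _ _) _; apply: le_trans hH.
have := approx_rootP; move: K1 ha; move: (md (a' - a)) (md a) => x y; lra.
Qed.

(** The approximate cross product differs from the true one by at most [crossbound c] / K < 1 / (2
    [gap c]), and the true one is 0 or at least 1 / [gap c]. The threshold 1 / (2 [gap c]) therefore
    decides. *)
Lemma small_crossP i b d : (i < N)%N -> (b <= olength c)%N -> (d <= olength c)%N ->
  small_cross c w i b d = (hcross 1 a (zeta i) b d == 0).
Proof.
move=> iN bB dB; have [zN zd] := zetaP iN.
have [_ KC _ _] := check_bounds.
have g0 : (0 < gap c)%N.
  by rewrite /gap muln_gt0 !expn_gt0 crossbound_gt0 height_gt0.
have q0' : 0 < q%:R :> R by rewrite ltr0n.
have qC0 : q%:R != 0 :> C by rewrite pnatr_eq0 -lt0n.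
set e := (hdegree b + hdegree d)%N.
have E : gz R (gcross q (wa w) (wz w i) b d) = q%:R ^+ e * hcross 1 a' (zeta' i) b d.
  by rewrite gz_cross -hcross_scale /a' /zeta' !mulrA ![q%:R * _]mulrC !mulfK.
have -> : small_cross c w i b d = (md (hcross 1 a' (zeta' i) b d) * (2 * gap c)%:R < 1).
  rewrite /small_cross mulnC (mulnC 2%N e) expnM.
  rewrite (@ltr_nat_sqr R (md (q%:R ^+ e * hcross 1 a' (zeta' i) b d) * (2 * gap c)%:R) (q ^ e)%:R)//.
  - rewrite mdM mdX md_nat natrX -mulrA -[X in _ < X]mulr1 ltr_pM2l// exprn_gt0//.
  - by rewrite mulr_ge0 ?md_ge0.
  - by rewrite natrM !natrX gnormE -E -exprMn mulrC.
have [ma ma'] := md_a.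
have H1 : 1 <= (height c)%:R :> R by rewrite ler1n height_gt0.
have H2 : 2 <= (height c)%:R :> R by rewrite ler_nat height_ge2.
have mz : md (zeta i) = 1.
  apply/eqP; rewrite -(@eqrXn2 _ N) ?md_ge0//; last exact: order_gt0.
  by rewrite expr1n -mdX zN md1.
have mz' : md (zeta' i) <= (height c)%:R.
  have -> : zeta' i = zeta i + (zeta' i - zeta i) by ring.
  apply: le_trans (md_add _ _) _; rewrite mz; apply: le_trans H2.
  by move: K1 zd; move: (md _) => x; lra.
have sm (x : R) : x < K%:R^-1 -> x <= (height c)%:R * K%:R^-1.
  by move=> h; apply: le_trans (ltW h) _; apply: ler_peMl.
have la : lip K%:R^-1 (height c) a a'.
  by split=> //; apply: sm; rewrite md_dist approx_rootP.
have lz : lip K%:R^-1 (height c) (zeta i) (zeta' i).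
  by split=> //; [rewrite mz|apply: sm; rewrite md_dist].
have := lip_cross Ki0 (height_gt0 c) bB dB la lz; rewrite -/(crossbound c).
have := gap_cross ca zN bB dB.
set x := hcross 1 a (zeta i) b d; set y := hcross 1 a' (zeta' i) b d => hgap hlip.
have gR : 0 < (gap c)%:R :> R by rewrite ltr0n.
have CK : (crossbound c)%:R * K%:R^-1 * (2 * gap c)%:R < 1 :> R.
  rewrite mulrAC ltr_pdivrMr// mul1r -natrM ltr_nat.
  by rewrite mulnCA mulnA.
have h2 : md (x - y) * (2 * gap c)%:R < 1.
  by apply: le_lt_trans CK; apply: ler_wpM2r.
apply/idP/eqP => [hy|x0]; last first.
  by move: h2; rewrite x0 sub0r mdN.
apply/eqP; apply: contrapT => /negP /hgap.
have : md x <= md (x - y) + md y.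
  by rewrite -{1}(subrK y x) md_add.
move: h2 hy; rewrite natrM.
move: (md x) (md y) (md (x - y)) (gap c)%:R gR => u v s g; nra.
Qed.

(** By [orbit_bound] a preperiodic orbit repeats within the range searched, so the bounded search is
    exhaustive. *)
Lemma selectedP i : (i < N)%N ->
  selected c w i <-> (T a `&` roots_of_unity R) (zeta i).
Proof.
move=> iN; have [zN _] := zetaP iN; have N0 : (0 < N)%N := order_gt0 c.
have [pq [pq0 pqa pqs]] := rat_input.
have n2 : 2 != 0 :> C by rewrite pnatr_eq0.
rewrite T_unity /selected zeta1//; split.
  move=> /andP[z1 /exnP[d dB /exnP[b bd]]].
  have dB' : (d <= olength c)%N by [].
  rewrite small_crossP// ?(leq_trans (ltnW bd))// => h0.
  split=> //; last by exists N.
  exists b, d; split=> //; apply/eqP; rewrite -hcross_eq0//.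
  exact: unity_neq0 zN.
move=> [z1 per _]; apply/andP; split=> //.
have [b [d [bd dB e]]] := orbit_bound pq0 pqa N0 zN pqs z1 per.
apply/exnP; exists d => //; apply/exnP; exists b => //.
rewrite small_crossP// ?(leq_trans (ltnW bd))// hcross_eq0//; first by rewrite e.
exact: unity_neq0 zN.
Qed.

Lemma unity_poly : poly_decode R (unity_code N) = 'X^N - 1.
Proof.
have N0 : (0 < N)%N := order_gt0 c.
rewrite /poly_decode /unity_code CodeSeq.codeK.
have -> m : iteri m (fun _ r => 0%N :: r) [:: 2%N] = nseq m 0%N ++ [:: 2%N].
  by elim: m => //= m ->.
apply/polyP => i; rewrite coef_Poly coefB coefXn coef1.
case: i => [|i]; first by rewrite (ltn_eqF N0) sub0r.
rewrite /= map_cat map_nseq /= nth_cat size_nseq subr0.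
have -> : (i.+1 == N) = (i == N.-1) by rewrite -{1}(prednK N0) eqSS.
case: ltngtP => h.
- by rewrite nth_nseq h.
- by rewrite nth_default//= subn_gt0.
- by rewrite h subnn /=.
Qed.

Lemma entry_codes i : (i < N)%N -> codes_number (entry c w i) (zeta i).
Proof.
move=> iN; have N0 : (0 < N)%N := order_gt0 c.
exists (unity_code N), (int_encode (wo w i).1), (int_encode (wo w i).2), (wt w).-1.
split=> //; first by rewrite unity_poly -size_poly_gt0 -[1]/(1%:P) size_XnsubC.
rewrite !int_encodeK unity_poly /= => z.
rewrite (_ : _ +i* _ = ctr i); last first.
  by rewrite /ctr gzE -[(wt w)%:R](rmorph_nat (real_complex R)) -fmorphV /=; simpc.
rewrite -[_.+1%:R](rmorph_nat (real_complex R)) -fmorphV md_lt -/(wt w).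
split=> [[rz zd]|->].
  have zN : z ^+ N = 1 by move: rz; rewrite /root !hornerE subr_eq0 => /eqP.
  have [j jN zj] := zeta_surj zN; rewrite zj; congr zeta.
  apply/eqP; apply: contrapT => /negP ji.
  have := zeta_notdisc iN jN; rewrite eq_sym => /(_ ji).
  by rewrite -zj ltNge ltW.
split; last exact: zeta_disc.
by rewrite /root !hornerE; case: (zetaP iN) => -> _; rewrite subrr.
Qed.

End Zeta.

Lemma check_sound : codes_set (output c w) (T a `&` roots_of_unity R).
Proof.
have [zeta zetaP] := exists_zeta; have N0 : (0 < N)%N := order_gt0 c.
have [V [hV Vt]] := exists_valuation_ring R[i].
pose sel := rev [seq i <- iota 0 N | selected c w i].
have selE i : i \in sel = (i < N)%N && selected c w i.
  by rewrite mem_rev mem_filter mem_iota /= add0n andbC.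
have outE : CodeSeq.decode (output c w) = [seq entry c w i | i <- sel].
  by rewrite /output CodeSeq.codeK iteri_filter -map_rev.
exists [seq zeta i | i <- sel]; rewrite outE !size_map; split=> //.
- rewrite map_inj_in_uniq ?rev_uniq ?filter_uniq ?iota_uniq// => i j.
  by rewrite !selE => /andP[iN _] /andP[jN _]; apply: (zeta_inj zetaP).
- apply/seteqP; split=> z /=.
    move=> Tz; have /T_unity[z1 per [n n0 zn]] := Tz.
    have [pq [pq0 pqa pqs]] := rat_input.
    have zN := order_bound hV Vt a0 a1 n0 zn z1 per pq0 pqa pqs.
    have [i iN zi] := zeta_surj zetaP zN.
    apply/mapP; exists i => //; rewrite selE iN /=.
    by apply/(selectedP zetaP iN); rewrite -zi.
  by move=> /mapP[k]; rewrite selE => /andP[kN sk] ->; apply/(selectedP zetaP kN).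
move=> k ks; rewrite !(nth_map 0%N)//.
by apply: entry_codes => //; have := mem_nth 0%N ks; rewrite selE => /andP[].
Qed.
End Soundness.

(** * Every code has an accepted witness *)

Section Completeness.
Variable R : realType.
Local Notation C := R[i].

Lemma exists_nat_inv (d : R) : 0 < d -> exists2 n, (0 < n)%N & n%:R^-1 < d.
Proof.
move=> d0; exists (Num.bound d^-1).+1 => //.
rewrite invf_plt ?posrE// (lt_trans (archi_boundP _)) ?invr_ge0 ?(ltW d0)//.
by rewrite ltr_nat.
Qed.

Lemma exists_lower_bound n (f : nat -> R) : (forall k, (k < n)%N -> 0 < f k) ->
  exists2 d, 0 < d & forall k, (k < n)%N -> d <= f k.
Proof.
elim: n => [|n IH] fp; first by exists 1.
have [|d d0 hd] := IH; first by move=> k kn; apply: fp; apply: ltnW.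
exists (Num.min d (f n)); first by rewrite lt_min d0 fp.
move=> k; rewrite ltnS leq_eqVlt => /orP[/eqP ->|kn]; first by rewrite ge_min lexx orbT.
by rewrite ge_min hd.
Qed.

Lemma md_sqr (z : C) : md z ^+ 2 = complex.Re z ^+ 2 + complex.Im z ^+ 2.
Proof. by apply: complexI; rewrite rmorphXn /= -mdE -add_Re2_Im2. Qed.

(** Rounding both coordinates leaves an error of at most sqrt(1/2) / t; the rational bound 3/4 still
    leaves room inside a disc of radius 1/t. *)
Lemma gauss_approx (z : C) (t : nat) : (0 < t)%N ->
  exists g, md (gz R g / t%:R - z) <= 3 / 4 * t%:R^-1.
Proof.
move=> t0; have t0' : 0 < t%:R :> R by rewrite ltr0n.
have round (x : R) : exists n : int, (n%:~R - x * t%:R) ^+ 2 <= 1 / 4.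
  exists (Num.floor (x * t%:R + 1 / 2)); have := floor_itv (x * t%:R + 1 / 2).
  rewrite intrD mulr1z; set n := (Num.floor _)%:~R; move: n (x * t%:R) => n y /andP[h1 h2].
  have h : 0 <= (1 / 2 - (n - y)) * (1 / 2 + (n - y)) by apply: mulr_ge0; lra.
  by rewrite expr2; lra.
have [u hu] := round (complex.Re z); have [v hv] := round (complex.Im z).
exists (u, v).
have E : gz R (u, v) / t%:R - z = (u%:~R / t%:R - complex.Re z) +i* (v%:~R / t%:R - complex.Im z).
  rewrite gzE -[t%:R in X in X - _](rmorph_nat (real_complex R)) -fmorphV /= {1}[z]complexE.
  case: z {hu hv} => x y /=; simpc; congr (_ +i* _).
rewrite -(@ler_pXn2r _ 2) ?nnegrE ?md_ge0 ?mulr_ge0 ?invr_ge0 ?ltW//.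
rewrite md_sqr E /= exprMn exprVn.
have F (n : int) (x : R) : (n%:~R / t%:R - x) ^+ 2 = (n%:~R - x * t%:R) ^+ 2 / t%:R ^+ 2.
  by field; rewrite gt_eqF.
have T0 : 0 < t%:R ^- 2 :> R by rewrite invr_gt0 exprn_gt0.
rewrite !F; move: hu hv T0; move: ((u%:~R - _) ^+ 2) ((v%:~R - _) ^+ 2) (t%:R ^- 2) => p q T.
by nra.
Qed.

Lemma poly_small (P : {poly C}) r (e : R) : root P r -> 0 < e ->
  exists2 d, 0 < d & forall z, md (z - r) < d -> md P.[z] < e.
Proof.
move=> /factor_theorem[Q ->] e0.
pose M := \sum_(k < size Q) md Q`_k * (md r + 1) ^+ k.
have M0 : 0 <= M by apply: sumr_ge0 => k _; rewrite mulr_ge0 ?exprn_ge0 ?addr_ge0 ?md_ge0.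
exists (Num.min 1 (e / (M + 1))); first by rewrite lt_min ltr01 divr_gt0// ltr_wpDl.
move=> z; rewrite lt_min => /andP[z1 ze].
rewrite hornerM !hornerE mdM.
have zr : md z <= md r + 1.
  have -> : z = r + (z - r) by ring.
  by apply: le_trans (md_add _ _) _; rewrite lerD2l ltW.
have QM : md Q.[z] <= M.
  rewrite horner_coef; apply: le_trans (md_sum _ _) _; apply: ler_sum => k _.
  by rewrite mdM mdX ler_wpM2l ?md_ge0// lerXn2r ?nnegrE ?addr_ge0 ?md_ge0.
apply: le_lt_trans (_ : M * (e / (M + 1)) < e).
  by apply: ler_pM; rewrite ?md_ge0// ltW.
by rewrite mulrCA gtr_pMr// ltr_pdivrMr ?ltr_wpDl// mul1r ltrDl.
Qed.

Lemma unity_roots N : (0 < N)%N -> exists rs : nat -> C,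
  (forall k, (k < N)%N -> rs k ^+ N = 1) /\
  forall k l, (k < N)%N -> (l < N)%N -> k != l -> rs k != rs l.
Proof.
move=> N0; have [rs E] := closed_field_poly_normal ('X^N - 1 : {poly C}).
rewrite (monicP (monic_Xn_sub_1 _ N0)) scale1r in E.
have u : uniq rs.
  by rewrite -separable_prod_XsubC -E separable_Xn_sub_1 // pnatr_eq0 -lt0n.
have s : size rs = N.
  by apply: succn_inj; rewrite -(size_prod_XsubC rs id) -E size_Xn_sub_1.
exists (nth 0 rs); split=> [k kN|k l kN lN kl]; last by rewrite nth_uniq ?s.
have : root ('X^N - 1) (nth 0 rs k) by rewrite E root_prod_XsubC mem_nth ?s.
by rewrite /root !hornerE subr_eq0 => /eqP.
Qed.

Definition witness (q K : nat) (A : int * int) (t N : nat) (Z O : nat -> int * int) : nat :=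
  CodeSeq.code [:: q; K; int_encode A.1; int_encode A.2; t.-1;
    CodeSeq.code (mkseq (fun k => CodeSeq.code [:: int_encode (Z k).1;
      int_encode (Z k).2; int_encode (O k).1; int_encode (O k).2]) N)].

Lemma witnessE q K A t N Z O : (0 < t)%N -> let w := witness q K A t N Z O in
  [/\ wq w = q, wk w = K, wa w = A, wt w = t &
      forall k, (k < N)%N -> wz w k = Z k /\ wo w k = O k].
Proof.
move=> t0 w; have F k : fld w k = nth 0%N [:: q; K; int_encode A.1; int_encode A.2; t.-1;
    CodeSeq.code (mkseq (fun k => CodeSeq.code [:: int_encode (Z k).1;
      int_encode (Z k).2; int_encode (O k).1; int_encode (O k).2]) N)] k.
  by rewrite /fld /w /witness CodeSeq.codeK.
split; rewrite /wq /wk /wa /wt ?F //=.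
- by rewrite !int_encodeK -surjective_pairing.
- by rewrite prednK.
move=> k kN; rewrite /wz /wo F /=.
have -> : fld (CodeSeq.code (mkseq (fun k => CodeSeq.code [:: int_encode (Z k).1;
      int_encode (Z k).2; int_encode (O k).1; int_encode (O k).2]) N)) k =
   CodeSeq.code [:: int_encode (Z k).1;
      int_encode (Z k).2; int_encode (O k).1; int_encode (O k).2].
  by rewrite /fld CodeSeq.codeK nth_mkseq.
by rewrite /fld CodeSeq.codeK /= !int_encodeK -!surjective_pairing.
Qed.

Lemma check_complete c (a : C) : codes_number c a -> exists w, check c w.
Proof.
move=> ca; have [p0 H] := input_spec ca; have [ra da] := proj2 (H a) erefl.
pose P : {poly C} := map_poly intr (ipoly c).
set N := order c; have N0 : (0 < N)%N := order_gt0 c.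
have [rs [rsN rsne]] := unity_roots N0.
pose m := (rad c)%:R^-1 - md (a - gz R (center c) / (rad c)%:R).
have m0 : 0 < m by rewrite subr_gt0.
have [sg sg0 hsg] : exists2 sg : R, 0 < sg &
    forall k l, (k < N)%N -> (l < N)%N -> k != l -> sg <= md (rs k - rs l).
  have H1 k : (k < N)%N -> exists2 sg : R, 0 < sg & forall l, (l < N)%N -> k != l -> sg <= md (rs k - rs l).
    move=> kN; have [|sg sg0 hsg] := @exists_lower_bound N (fun l => if k == l then 1 else md (rs k - rs l)).
      move=> l lN; case: eqVneq => // kl.
      by rewrite lt_neqAle md_ge0 andbT eq_sym md_eq0 subr_eq0 rsne.
    by exists sg => // l lN kl; have := hsg l lN; rewrite (negPf kl).
  have H2 k : exists sg : R, (k < N)%N -> 0 < sg /\ forall l, (l < N)%N -> k != l -> sg <= md (rs k - rs l).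
    have [kN|] := boolP (k < N)%N; last by exists 0.
    by have [sg sg0 hsg] := H1 k kN; exists sg.
  have [s hs] := choice H2.
  have [|sg sg0 hsg] := @exists_lower_bound N s; first by move=> k kN; case: (hs k kN).
  exists sg => // k l kN lN kl; apply: le_trans (hsg k kN) _.
  by case: (hs k kN) => _; apply.
have sg4 : 0 < sg / 4 by rewrite divr_gt0.
(* The roots of unity are more than 4/t apart, and centres will lie within 3/(4t) of them, so a disc
   of radius 1/t isolates its root. *)
have [t t0 ht] := exists_nat_inv sg4.
have ti0 : 0 < t%:R^-1 :> R by rewrite invr_gt0 ltr0n.
(* Half of m is left for the approximation of a. In units of 1/t, the tests hold because 1/16 + 3/4
   < 1 - 1/16 for [near] and 4 - 1/16 - 3/4 > 1 + 1/16 for [far]. *)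
have mt0 : 0 < Num.min (m / 2) (t%:R^-1 / 16) by rewrite lt_min !divr_gt0.
have [K1 K10 hK1] := exists_nat_inv mt0.
pose K := (K1 + (2 * crossbound c * gap c + rad c + t))%N.
have KK1 : K%:R^-1 <= K1%:R^-1 :> R by rewrite lef_pV2 ?posrE ?ltr0n ?addn_gt0 ?K10// ler_nat leq_addr.
have [Km Kt] : (K%:R^-1 < m / 2 :> R) /\ (K%:R^-1 < t%:R^-1 / 16 :> R).
  by move: hK1; rewrite lt_min => /andP[h1 h2]; split; apply: (le_lt_trans KK1).
have K0 : (0 < K)%N by rewrite addn_gt0 K10.
have Ki0 : 0 < K%:R^-1 :> R by rewrite invr_gt0 ltr0n.
have [da1 da10 hda1] := poly_small ra (exprn_gt0 (psize c) Ki0).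
have [dz dz0 hdz] : exists2 d : R, 0 < d & forall k z, (k < N)%N -> md (z - rs k) < d -> md ('X^N - 1%:P : {poly C}).[z] < K%:R^-1 ^+ N.
  have H1 k : exists d : R, (k < N)%N -> 0 < d /\ forall z, md (z - rs k) < d -> md ('X^N - 1%:P : {poly C}).[z] < K%:R^-1 ^+ N.
    have [kN|] := boolP (k < N)%N; last by exists 0.
    have rk : root ('X^N - 1%:P) (rs k) by rewrite /root !hornerE rsN// subrr.
    by have [d d0 hd] := poly_small rk (exprn_gt0 N Ki0); exists d.
  have [s hs] := choice H1.
  have [|d d0 hd] := @exists_lower_bound N s; first by move=> k kN; case: (hs k kN).
  exists d => // k z kN h; case: (hs k kN) => _; apply.
  by apply: lt_le_trans h _; apply: hd.
(* The denominator q is chosen last, because the required smallness of the polynomial values depends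
   on K. *)
pose dl := Num.min (Num.min da1 dz) (Num.min (m / 2) (t%:R^-1 / 16)).
have dl0 : 0 < dl by rewrite !lt_min da10 dz0 !divr_gt0.
have [q q0 hq] := exists_nat_inv dl0.
have [A hA] := gauss_approx a q0.
have app z (g : int * int) : md (gz R g / q%:R - z) <= 3 / 4 * q%:R^-1 -> md (gz R g / q%:R - z) < dl.
  move=> h; apply: le_lt_trans h _; apply: le_lt_trans hq.
  by rewrite ler_piMl ?invr_ge0//; lra.
have /choice[Z hZ] k : exists g, md (gz R g / q%:R - rs k) < dl.
  by have [g hg] := gauss_approx (rs k) q0; exists g; apply: app.
have {hA}/app hA := hA.
have /choice[O hO] k : exists g, md (gz R g / t%:R - rs k) <= 3 / 4 * t%:R^-1.
  exact: gauss_approx.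
exists (witness q K A t N Z O).
have [wqE wkE waE wtE wzo] := witnessE q K A N Z O t0.
set w := witness _ _ _ _ _ _ _ in wqE wkE waE wtE wzo *.
have [CK rK tK] : [/\ 2 * crossbound c * gap c < K, rad c < K & t < K]%N.
  rewrite /K; move: (2 * crossbound c * gap c)%N (rad c) K10 => x r; clear.
  by split; lia.
have q0' : q%:R != 0 :> C by rewrite pnatr_eq0 -lt0n.
move: hA hZ; rewrite /dl => hA hZ.
have hZ' k : [/\ md (gz R (Z k) / q%:R - rs k) < dz & md (gz R (Z k) / q%:R - rs k) < t%:R^-1 / 16].
  by have := hZ k; rewrite !lt_min => /andP[/andP[_ ->] /andP[_ ->]].
have [hA1 hA2] : md (gz R A / q%:R - a) < da1 /\ md (gz R A / q%:R - a) < m / 2.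
  by move: hA; rewrite !lt_min => /andP[/andP[-> _] /andP[-> _]].
rewrite /check wqE wkE wtE q0 CK rK tK /=.
apply/andP; split.
  rewrite /approx_root wqE wkE waE; apply/andP; split.
    rewrite (@nearP R)//.
    have -> : gz R A / q%:R - gz R (center c) / (rad c)%:R = (gz R A / q%:R - a) + (a - gz R (center c) / (rad c)%:R) by ring.
    apply: le_lt_trans (md_add _ _) _.
    by move: Km hA2; rewrite /m; move: (md _) (md _) => x y; lra.
  by rewrite (small_normP q0 K0 (hvalE R c _ q0)) hda1.
apply/allnP => k kN; have [wzk wok] := wzo k kN.
apply/andP; split.
  have E : gz R (gsub (gpow (Z k) N) (gnat (q ^ N))) = q%:R ^+ N * ('X^N - 1%:P).[gz R (Z k) / q%:R].
    rewrite gzB gzX gz_nat natrX !hornerE expr_div_n.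
    by field; rewrite expf_neq0.
  rewrite /approx_unity wzk wqE wkE -/N (small_normP q0 K0 E).
  by apply: (hdz k) => //; case: (hZ' k).
apply/allnP => l lN; have [wzl wol] := wzo l lN.
rewrite wzk wzl wok wqE wkE wtE /cond.
have [hk1 hk2] := hZ' k; have [hl1 hl2] := hZ' l; have hOk := hO k.
case: eqVneq => [_|kl].
  rewrite (@nearP R)//.
  have -> : gz R (Z k) / q%:R - gz R (O k) / t%:R = (gz R (Z k) / q%:R - rs k) - (gz R (O k) / t%:R - rs k) by ring.
  apply: le_lt_trans (md_sub _ _) _.
  by move: hk2 hOk Kt; move: (md _) (md _) => x y; lra.
rewrite (@farP R)//.
have hs := hsg l k lN kN; rewrite eq_sym in hs; have {}hs := hs kl.
have : md (rs l - rs k) <= md (gz R (Z l) / q%:R - gz R (O k) / t%:R) + (md (gz R (Z l) / q%:R - rs l) + md (gz R (O k) / t%:R - rs k)).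
  have -> : rs l - rs k = (gz R (Z l) / q%:R - gz R (O k) / t%:R) - ((gz R (Z l) / q%:R - rs l) - (gz R (O k) / t%:R - rs k)) by ring.
  by apply: le_trans (md_sub _ _) _; rewrite lerD2l; apply: md_sub.
move: hl2 hOk Kt hs ht; move: (md _) (md _) (md _) (md _) => x1 x2 x3 x4; lra.
Qed.
End Completeness.

Theorem corollary12 (R : realType)
    (Q2 : fieldType) (abs2 : Q2 -> R) (Q2P : is_padic_field 2 abs2)
    (Q2bar : closedFieldType) (j : {rmorphism Q2 -> Q2bar})
    (Q2barP : forall u : Q2bar, algebraicOver j u)
    (iota : {rmorphism Qbar R -> Q2bar}) :
  [/\ forall a : Qbar R, a <> 0 -> a <> 1 ->
        conjugates_in_Zunits abs2 j iota a ->
        ((T (qbar_val a) `&` roots_of_unity R) `\ qbar_val a #<= `I_2)%card,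
      exists f : recfun, forall a : Qbar R, a <> 0 -> a <> 1 ->
        conjugates_in_Zunits abs2 j iota a ->
        forall c : nat, codes_number c (qbar_val a) ->
        exists2 d : nat, computes f [:: c] d &
          codes_set d (T (qbar_val a) `&` roots_of_unity R),
      forall a : R[i], roots_of_unity R a -> a <> 1 -> a <> -1 ->
        [set a; a ^+ 2] `<=` T a `&` roots_of_unity R /\
        T a `&` roots_of_unity R `<=` [set a; a ^+ 2; - (a ^+ 2)]
    & T (-1 : R[i]) `&` roots_of_unity R = [set -1]].
Proof.
have nz (a : Qbar R) : a <> 0 -> a <> 1 -> qbar_val a != 0 /\ qbar_val a != 1.
  by move=> a0 a1; split; apply/eqP => e; [apply: a0|apply: a1]; apply: val_inj.
split.
- by move=> a a0 a1 _; have [] := nz a a0 a1; apply: card_T_unity.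
- have [f fP] := recfun_search c_check c_output.
  exists f => a a0 a1 _ c ca; have [na0 na1] := nz a a0 a1.
  have [w cw fw] := fP c (check_complete ca).
  by exists (output c w) => //; apply: check_sound.
- exact: T_root_of_unity.
- exact: T_minus_one.
Qed.
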